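(* Let $m\ge2$, let $G_1,\dots,G_m$ be finite groups, $\Gamma=G_1*\cdots*G_m$, and $\mu=\mathrm{lcm}(|G_1|,\dots,|G_m|)$. For $\gamma\in\Gamma$ let $u_k(\gamma)\in\mathbb{R}$ ($k\ge0$) be the coefficients of the asymptotic expansion of $\mathbf{E}[\mathrm{tr}\,\pi_N(\gamma)]$ in powers of $N^{-1/\mu}$, i.e. the unique real numbers such that for every integer $s\ge1$, $$\mathbf{E}[\mathrm{tr}\,\pi_N(\gamma)]=\sum_{k=0}^{s-1}u_k(\gamma)N^{-k/\mu}+O_{\gamma,s}(N^{-s/\mu})\qquad(N\to\infty),$$ and extend each $u_k$ linearly to $\mathbb{C}[\Gamma]$. Then for every positive integer $k\le\mu$, the functional $u_k$ is tempered at every self-adjoint element $x\in\mathbb{C}[\Gamma]$, i.e. $$\limsup_{p\to\infty}|u_k(x^p)|^{1/p}\le\|\lambda(x)\| .$$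
   Context: For each $N$, $\phi_N$ is a uniformly random element of $\mathrm{Hom}(\Gamma,\mathrm{Sym}(N))$ and $\pi_N=\mathrm{std}\circ\phi_N$, where $\mathrm{std}$ is the $(N-1)$-dimensional representation of $\mathrm{Sym}(N)$ on $\mathbf{1}^\perp\subset\mathbb{C}^N$. $\mathrm{tr}\,\pi_N(\gamma)=\mathrm{Tr}(\pi_N(\gamma))/N$. The expansion defining $u_k(\gamma)$ exists for every $\gamma\in\Gamma$. $\lambda$ is the left regular representation of $\Gamma$ on $\ell^2(\Gamma)$ and $\|\lambda(x)\|$ is the operator norm. Self-adjoint means $x^*=x$ for $(\sum\alpha_\gamma\gamma)^*=\sum\overline{\alpha_\gamma}\gamma^{-1}$. *)

(* Defs.v *)
From HB Require Import structures.
From mathcomp Require Import all_boot all_order all_fingroup all_algebra finmap.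
From mathcomp Require Import complex.
From mathcomp Require Import all_classical all_reals all_analysis.

Set Implicit Arguments.
Unset Strict Implicit.
Unset Printing Implicit Defensive.

Import Order.TTheory GRing.Theory Num.Theory.
Import numFieldNormedType.Exports Normc.

Local Open Scope ring_scope.
Local Open Scope complex_scope.
Local Open Scope classical_set_scope.

(* The free product of the groups G i, realized as the set of reduced words:
   a word is a sequence of letters (i, g) with g in G i; it is reduced when no
   letter is trivial and consecutive letters come from different factors. *)
Section FreeProduct.
Variables (m : nat) (G : 'I_m -> finGroupType).

Definition letter : Type := {i : 'I_m & G i}.
HB.instance Definition _ := Finite.on letter.

Definition nontriv (a : letter) : bool := tagged a != 1%g.
Definition tag_neq (a b : letter) : bool := tag a != tag b.
Definition reduced (w : seq letter) : bool := all nontriv w && sorted tag_neq w.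

Definition consred (a : letter) (w : seq letter) : seq letter :=
  if nontriv a then a :: w else w.

(* left multiplication of a reduced word by a letter *)
Definition lmul (a : letter) (w : seq letter) : seq letter :=
  if w is b :: w' then
    if tag a == tag b
    then consred (Tagged G (tagged a * tagged_as a b)%g) w'
    else consred a w
  else consred a w.

Definition linv (a : letter) : letter := Tagged G (tagged a)^-1%g.
Definition wmul (v w : seq letter) : seq letter := foldr lmul w v.
Definition winv (w : seq letter) : seq letter := rev (map linv w).

Lemma reduced_cons a w : reduced (a :: w) -> reduced w.
Proof. by rewrite /reduced /= => /andP[/andP[_ ->] /path_sorted]. Qed.

Lemma lmul_reduced a w : reduced w -> reduced (lmul a w).
Proof.
case: w => [|b w] rw; rewrite /lmul /consred.
  by case: ifP => // na; rewrite /reduced /= na.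
case: eqP => [eab|nab]; last first.
  case: ifP => // na; move: rw; rewrite /reduced /= na => /andP[-> ->].
  by rewrite /= andbT; apply/eqP.
case: ifP => [na|_]; last exact: reduced_cons rw.
move: rw; rewrite /reduced /= na /= => /andP[/andP[_ ->] /=].
by case: w => //= c w; rewrite /tag_neq /= eab.
Qed.

Lemma wmul_reduced v w : reduced w -> reduced (wmul v w).
Proof. by move=> rw; elim: v => //= a v; apply: lmul_reduced. Qed.

Lemma lmul_cons a w : reduced (a :: w) -> lmul a w = a :: w.
Proof.
rewrite /reduced /lmul /consred /= -andbA => /and3P[-> _].
by case: w => //= b w /andP[/negPf + _] => ->.
Qed.

Lemma lmul1 i w : lmul (Tagged G (1%g : G i)) w = consred (Tagged G (1%g : G i)) w
  \/ exists g w', w = Tagged G (g : G i) :: w'.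
Proof.
case: w => [|[j h] w]; first by left.
rewrite /lmul /=; case: eqP => [e|_]; last by left.
by move: h; rewrite -e => h; right; exists h, w.
Qed.

Lemma lmul_triv i w : reduced w -> lmul (Tagged G (1%g : G i)) w = w.
Proof.
case: (lmul1 i w) => [-> _|[g [w' ->]]]; first by rewrite /consred /nontriv /= eqxx.
rewrite /lmul /= eqxx tagged_asE mul1g /reduced /= => /andP[/andP[+ _] _].
by rewrite /consred => ->.
Qed.

(* left multiplication is an action of each factor on the reduced words *)
Lemma lmulA i (g h : G i) w : reduced w ->
  lmul (Tagged G g) (lmul (Tagged G h) w) = lmul (Tagged G (g * h)%g) w.
Proof.
have head (j : 'I_m) (k : G j) (s : seq letter) :
    (if s is b :: _ then tag b != j else true) ->
    lmul (Tagged G k) s = consred (Tagged G k) s.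
  by case: s => //= b s; rewrite eq_sym => /negPf ->.
have key (s : seq letter) (k : G i) :
    (if s is b :: _ then tag b != i else true) ->
    lmul (Tagged G g) (consred (Tagged G k) s) = consred (Tagged G (g * k)%g) s.
  move=> hs; rewrite {1}/consred /nontriv /=; case: eqP => [->|_] /=.
    by rewrite mulg1 head.
  by rewrite eqxx tagged_asE.
case: w => [_|[j k] w rw]; first by rewrite [lmul _ [::]]/lmul key.
have [e|ne] := eqVneq j i; last by rewrite !(head _ _ (_ :: _)) // key.
move: k rw; rewrite e => k rw; rewrite {2 3}/lmul /= eqxx !tagged_asE.
rewrite key ?mulgA //; move: rw; rewrite /reduced /= => /andP[_].
by case: w => //= b w /andP[+ _]; rewrite /tag_neq /= eq_sym.
Qed.

Lemma lmulM a b w : reduced w -> tag a = tag b ->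
  lmul a (lmul b w) = lmul (Tagged G (tagged a * tagged_as a b)%g) w.
Proof.
case: a b => [i g] [j h] rw /= e; move: h; rewrite -e => h.
by rewrite tagged_asE lmulA.
Qed.

Lemma wmul_lmul a v w : reduced v -> reduced w ->
  wmul (lmul a v) w = lmul a (wmul v w).
Proof.
have consE b s : reduced w ->
    wmul (consred b s) w = lmul b (wmul s w).
  move=> rw; rewrite /consred; case: ifP => //.
  case: b => i g /negbFE /eqP /= ->; rewrite lmul_triv //; exact: wmul_reduced.
move=> rv rw; case: v rv => [|b v] rv; rewrite {1}/lmul; first exact: consE.
case: eqP => [e|_]; rewrite consE //= lmulM //; exact: wmul_reduced.
Qed.

Lemma wmulA u v w : reduced u -> reduced v -> reduced w ->
  wmul (wmul u v) w = wmul u (wmul v w).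
Proof.
move=> ru rv rw; elim: u ru => //= a u IH /reduced_cons ru.
by rewrite wmul_lmul ?IH //; apply: wmul_reduced.
Qed.

Lemma winv_reduced w : reduced w -> reduced (winv w).
Proof.
rewrite /reduced /winv all_rev all_map rev_sorted => /andP[aw sw].
apply/andP; split.
  by apply: sub_all aw => a; rewrite /nontriv /= invg_eq1.
rewrite sorted_map; apply: sub_sorted sw => a b.
by rewrite /relpre /tag_neq /= eq_sym.
Qed.

Lemma wmulVw w : reduced w -> wmul (winv w) w = [::].
Proof.
elim: w => //= a w IH raw; have rw := reduced_cons raw.
rewrite /winv map_cons rev_cons -cats1 /wmul foldr_cat -[RHS](IH rw).
congr foldr; change (lmul (linv a) (a :: w) = w).
rewrite -[X in lmul _ X](lmul_cons raw) lmulM //.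
have -> : tagged_as (linv a) a = tagged a.
  by case: (a) => i g; rewrite tagged_asE.
by rewrite mulVg lmul_triv.
Qed.

Lemma winvK w : winv (winv w) = w.
Proof.
rewrite /winv map_rev revK -map_comp map_id_in // => -[i g] _ /=.
by rewrite /linv /= invgK.
Qed.

Definition free_product : Type := {w : seq letter | reduced w}.
HB.instance Definition _ := Countable.on free_product.

Definition fp_one : free_product := exist _ [::] isT.
Definition fp_mul (x y : free_product) : free_product :=
  exist _ (wmul (val x) (val y)) (wmul_reduced _ (valP y)).
Definition fp_inv (x : free_product) : free_product :=
  exist _ (winv (val x)) (winv_reduced (valP x)).

Fact fp_mulA : associative fp_mul.
Proof. by move=> x y z; apply: val_inj; rewrite /= wmulA //; apply: valP. Qed.
Fact fp_mul1 : left_id fp_one fp_mul.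
Proof. by move=> x; apply: val_inj. Qed.
Fact fp_mulr1 : right_id fp_one fp_mul.
Proof.
case=> w rw; apply: val_inj => /=; elim: w rw => //= a w IH raw.
by rewrite IH ?lmul_cons // (reduced_cons raw).
Qed.
Fact fp_mulV : left_inverse fp_one fp_inv fp_mul.
Proof. by move=> x; apply: val_inj; apply: wmulVw (valP x). Qed.
Fact fp_mulrV : right_inverse fp_one fp_inv fp_mul.
Proof.
move=> x; apply: val_inj => /=; rewrite -{1}[val x]winvK.
exact/wmulVw/winv_reduced/valP.
Qed.

HB.instance Definition _ := isGroup.Build free_product
  fp_mulA fp_mul1 fp_mulr1 fp_mulV fp_mulrV.

Fact fp_inj_subproof (a : letter) : reduced (consred a [::]).
Proof. by rewrite -[consred _ _]/(lmul a [::]) lmul_reduced. Qed.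

(* the canonical embedding of the factor G i *)
Definition fp_inj (i : 'I_m) (g : G i) : free_product :=
  exist _ (consred (Tagged G g) [::]) (fp_inj_subproof (Tagged G g)).

Lemma fp_injM i : {morph @fp_inj i : g h / (g * h)%g}.
Proof.
move=> g h; apply: val_inj.
change (lmul (Tagged G (g * h)%g) [::] =
        wmul (lmul (Tagged G g) [::]) (lmul (Tagged G h) [::])).
by rewrite wmul_lmul ?lmul_reduced // -lmulA.
Qed.

Lemma fp_prod (x : free_product) :
  x = (\prod_(a <- val x) fp_inj (tagged a))%g.
Proof.
case: x => w rw; apply: val_inj => /=; elim: w rw => [|a w IH] raw /=.
  by rewrite big_nil.
have rw := reduced_cons raw; rewrite big_cons.
change (a :: w = wmul (lmul (Tagged G (tagged a)) [::])
  (val (\prod_(b <- w) fp_inj (tagged b))%g)).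
have <- : w = val (\prod_(b <- w) fp_inj (tagged b))%g by exact: IH.
rewrite wmul_lmul //=; case: a raw => i g raw.
exact/esym/lmul_cons.
Qed.

End FreeProduct.

(* The complex group algebra: finitely supported functions, with convolution. *)
Section GroupAlgebra.
Variables (R : realType) (Gam : groupType).

Definition galg : Type := {fsfun Gam -> R[i] with 0}.
HB.instance Definition _ := Equality.on galg.
HB.instance Definition _ := [Choice of galg by <:].
Identity Coercion galg_fsfun : galg >-> fsfun.
Implicit Types x y z : galg.

Definition galg_zero : galg := [fsfun].
Definition galg_opp x : galg := [fsfun g in finsupp x => - x g].
Definition galg_add x y : galg :=
  [fsfun g in (finsupp x `|` finsupp y)%fset => x g + y g].
Definition galg_one : galg := [fsfun g in [fset 1%g : Gam]%fset => 1].
Definition galg_mul x y : galg :=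
  [fsfun g in [fset (a * b)%g | a in finsupp x, b in finsupp y]%fset =>
     \sum_(a <- finsupp x) x a * y (a^-1 * g)%g].

Lemma galg_oppE x g : galg_opp x g = - x g.
Proof. by rewrite fsfunE; case: finsuppP => // _; rewrite oppr0. Qed.

Lemma galg_addE x y g : galg_add x y g = x g + y g.
Proof.
rewrite fsfunE in_fsetU.
by do 2![case: finsuppP => //= _]; rewrite ?addr0.
Qed.

Lemma galg_oneE g : galg_one g = (g == 1%g)%:R.
Proof. by rewrite fsfunE in_fset1; case: eqP. Qed.

Lemma galg_mulE x y g :
  galg_mul x y g = \sum_(a <- finsupp x) x a * y (a^-1 * g)%g.
Proof.
rewrite fsfunE; case: ifPn => // gN; rewrite big_seq big1 // => a ax.
rewrite [y _]fsfun_dflt ?mulr0 //; apply: contra gN => ag.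
by apply/imfset2P; exists a => //; exists (a^-1 * g)%g => //; rewrite mulKVg.
Qed.

Lemma galg_sum_widen (S : {fset Gam}) x (F : Gam -> R[i]) :
  {subset finsupp x <= S} ->
  \sum_(a <- finsupp x) x a * F a = \sum_(a <- S) x a * F a.
Proof.
move=> /fsubsetP sS; apply: big_fset_incl => // a _ /fsfun_dflt ->.
by rewrite mul0r.
Qed.

Fact galg_addA : associative galg_add.
Proof. by move=> x y z; apply/fsfunP => g; rewrite !galg_addE addrA. Qed.
Fact galg_addC : commutative galg_add.
Proof. by move=> x y; apply/fsfunP => g; rewrite !galg_addE addrC. Qed.
Fact galg_add0 : left_id galg_zero galg_add.
Proof. by move=> x; apply/fsfunP => g; rewrite galg_addE fsfun0E add0r. Qed.
Fact galg_addN : left_inverse galg_zero galg_opp galg_add.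
Proof.
by move=> x; apply/fsfunP => g; rewrite galg_addE galg_oppE fsfun0E addNr.
Qed.

HB.instance Definition _ := GRing.isZmodule.Build galg
  galg_addA galg_addC galg_add0 galg_addN.

Fact galg_mulA : associative galg_mul.
Proof.
move=> x y z; apply/fsfunP => g; rewrite galg_mulE.
pose S := [fset (a * b)%g | a in finsupp x, b in finsupp y]%fset.
have sS : {subset finsupp (galg_mul x y) <= S}.
  move=> c; apply: contraTT => cN.
  by rewrite mem_finsupp fsfunE -/S (negPf cN) eqxx.
rewrite galg_mulE (galg_sum_widen _ sS).
under [RHS]eq_bigr do rewrite galg_mulE mulr_suml.
rewrite exchange_big /=; rewrite !big_seq; apply: eq_bigr => a ax.
rewrite galg_mulE mulr_sumr.
pose h b := (a * b)%g.
have sh : ([fset h b | b in finsupp y] `<=` S)%fset.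
  by apply/fsubsetP => _ /imfsetP[b /= yb ->]; apply: in_imfset2.
rewrite -(big_fset_incl _ sh); last first.
  move=> c _ cN; rewrite [y _]fsfun_dflt ?mulr0 ?mul0r //.
  apply: contra cN => cy; apply/imfsetP; exists (a^-1 * c)%g => //.
  by rewrite /h mulKVg.
rewrite big_imfset /=; last by move=> b b' _ _ /mulgI.
by apply: eq_bigr => b _; rewrite /h mulKg invgM !mulgA mulrA.
Qed.

Fact galg_mul1 : left_id galg_one galg_mul.
Proof.
move=> x; apply/fsfunP => g; rewrite galg_mulE.
have s1 : {subset finsupp galg_one <= [fset 1%g : Gam]%fset}.
  move=> c; rewrite mem_finsupp galg_oneE in_fset1.
  by case: (c == _) => //; rewrite eqxx.
by rewrite (galg_sum_widen _ s1) big_seq_fset1 galg_oneE eqxx mul1r invg1 mul1g.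
Qed.

Fact galg_mulr1 : right_id galg_one galg_mul.
Proof.
move=> x; apply/fsfunP => g; rewrite galg_mulE.
have sg : {subset finsupp x <= (g |` finsupp x)%fset}.
  by move=> a ax; rewrite in_fsetU ax orbT.
rewrite (galg_sum_widen _ sg) (big_fsetD1 g) ?in_fset1U ?eqxx //=.
rewrite galg_oneE mulVg eqxx mulr1 big_seq big1 ?addr0 // => a.
rewrite in_fsetD1 galg_oneE => /andP[/negPf ag _].
by rewrite -(inj_eq (mulgI a)) mulKVg mulg1 eq_sym ag mulr0.
Qed.

Fact galg_mulDl : left_distributive galg_mul galg_add.
Proof.
move=> x y z; apply/fsfunP => g; rewrite galg_addE !galg_mulE.
pose S := (finsupp x `|` finsupp y)%fset.
have sx : {subset finsupp x <= S} by move=> a ax; rewrite in_fsetU ax.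
have sy : {subset finsupp y <= S} by move=> a ay; rewrite in_fsetU ay orbT.
have sxy : {subset finsupp (galg_add x y) <= S}.
  move=> c; apply: contraTT => cN.
  by rewrite mem_finsupp fsfunE -/S (negPf cN) eqxx.
rewrite (galg_sum_widen _ sx) (galg_sum_widen _ sy) (galg_sum_widen _ sxy).
by rewrite -big_split; apply: eq_bigr => a _; rewrite galg_addE mulrDl.
Qed.

Fact galg_mulDr : right_distributive galg_mul galg_add.
Proof.
move=> x y z; apply/fsfunP => g; rewrite galg_addE !galg_mulE -big_split.
by apply: eq_bigr => a _; rewrite galg_addE mulrDr.
Qed.

Fact galg_one_neq0 : galg_one != galg_zero.
Proof.
apply/eqP => /fsfunP /(_ 1%g); rewrite galg_oneE fsfun0E eqxx.
by apply/eqP; rewrite oner_eq0.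
Qed.

HB.instance Definition _ := GRing.Zmodule_isNzRing.Build galg
  galg_mulA galg_mul1 galg_mulr1 galg_mulDl galg_mulDr galg_one_neq0.

Definition galg_star x : galg :=
  [fsfun g in [fset (a^-1)%g | a in finsupp x]%fset => (x (g^-1)%g)^*].

Definition selfadjoint x : Prop := galg_star x = x.

Lemma galg_starE x g : galg_star x g = (x (g^-1)%g)^*.
Proof.
rewrite fsfunE; case: ifPn => // gN; rewrite fsfun_dflt ?conjc0 //.
by apply: contra gN => gx; apply/imfsetP; exists (g^-1)%g; rewrite ?invgK.
Qed.

Definition lin_ext (v : Gam -> R) x : R[i] :=
  \sum_(g <- finsupp x) x g * (v g)%:C.

(* Left regular representation, extended linearly to the group algebra and
   acting on all functions; l2norm f is +oo when f is not in l^2(Gam). *)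
Definition lreg x (f : Gam -> R[i]) : Gam -> R[i] :=
  fun h => \sum_(g <- finsupp x) x g * f (g^-1 * h)%g.

Definition l2norm (f : Gam -> R[i]) : \bar R :=
  sqrte (\esum_(h in [set: Gam]) (normc (f h) ^+ 2)%:E).

Definition lreg_opnorm x : \bar R :=
  ereal_sup [set l2norm (lreg x f) | f in [set f | (l2norm f <= 1)%E]].

Definition tempered_at (v : Gam -> R) x : Prop :=
  (limn_esup (fun p => (normc (lin_ext v (x ^+ p)) `^ (p%:R^-1))%:E)
     <= lreg_opnorm x)%E.

End GroupAlgebra.

Section RandomHom.
Variables (m : nat) (G : 'I_m -> finGroupType).
Local Notation Gam := (free_product G).

Definition hom_sym (N : nat) : set (Gam -> 'S_N) :=
  [set phi | monoid.monoid_morphism phi].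
Arguments hom_sym : clear implicits.

Lemma finite_hom_sym N : finite_set (hom_sym N).
Proof.
pose r (phi : Gam -> 'S_N) := [ffun a : letter G => phi (fp_inj (tagged a))].
have rinj : {in hom_sym N &, injective r}.
  move=> f g /set_mem [f1 fM] /set_mem [g1 gM] /ffunP e.
  apply/funext => x; rewrite (fp_prod x) (big_morph f fM f1) (big_morph g gM g1).
  by apply: eq_bigr => a _; move: (e a); rewrite !ffunE.
rewrite -(eq_finite_set (inj_card_eq rinj)); exact: finite_finset.
Qed.

Variable R : realType.

Definition expect_hom N (f : (Gam -> 'S_N) -> R[i]) : R[i] :=
  (\sum_(phi \in hom_sym N) f phi) / (#|` fset_set (hom_sym N)|)%:R.

(* Row vectors with zero coordinate sum: the orthogonal complement of the
   constant vectors. *)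
Definition one_perp N : 'M[R[i]]_N := kermx (const_mx 1 : 'cV_N).

Lemma one_perp_stable N (s : 'S_N) : stablemx (one_perp N) (perm_mx s).
Proof.
apply/sub_kermxP; rewrite -mulmxA; set c := const_mx 1.
have -> : perm_mx s *m c = c by apply/matrixP => i j; rewrite -row_permE !mxE.
exact: mulmx_ker.
Qed.

(* the matrix, in a basis of one_perp, of the action of s on one_perp *)
Definition std N (s : 'S_N) : 'M[R[i]]_(\rank (one_perp N)) :=
  conjmx (row_base (one_perp N)) (perm_mx s).

Lemma std1 N : std (1 : 'S_N)%g = 1%:M.
Proof. by rewrite /std perm_mx1 conjmx_scalar ?row_base_free. Qed.

Lemma stdM N (s t : 'S_N) : std (s * t)%g = std s *m std t.
Proof.
by rewrite /std perm_mxM conjmxM // inE stablemx_row_base one_perp_stable.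
Qed.

Lemma rank_one_perp N : \rank (one_perp N) = N.-1.
Proof.
rewrite mxrank_ker; case: N => // N; rewrite -(mxrank_tr (const_mx 1)).
rewrite rank_rV; case: eqP => [/rowP/(_ ord0)|_]; last by rewrite subn1.
by rewrite !mxE => /eqP; rewrite oner_eq0.
Qed.

(* E[tr pi_N(g)], where tr is normalized by N although std has dimension N - 1 *)
Definition expected_trace (N : nat) (g : Gam) : R[i] :=
  expect_hom (fun phi : Gam -> 'S_N => \tr (std (phi g)) / N%:R).

Definition lcm_orders : nat := \big[lcmn/1%N]_(i < m) #|G i|.

Definition asymptotic_coefficients (u : nat -> Gam -> R) : Prop :=
  forall (g : Gam) (s : nat), (0 < s)%N ->
  exists K : R, \forall N \near \oo,
    normc (expected_trace N g -
           \sum_(k < s) (u k g * N%:R `^ (- (k%:R / lcm_orders%:R)))%:C)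
    <= K * N%:R `^ (- (s%:R / lcm_orders%:R)).

End RandomHom.

(* Main.v *)
Require Import Defs.
From mathcomp Require Import all_boot all_order all_fingroup all_algebra finmap.
From mathcomp Require Import complex zify ring lra.
From mathcomp Require Import all_classical all_reals all_analysis.

Set Implicit Arguments.
Unset Strict Implicit.
Unset Printing Implicit Defensive.

Import Order.TTheory GRing.Theory Num.Theory.
Import numFieldNormedType.Exports Normc.
Import fintype boot.finset fingraph.

(** Write [E_N g] for the expected number of fixed points of [phi_N(g)], so that
    the expected normalized trace of [pi_N(g)] is [(E_N g - 1) / N]. The proof
    identifies the elements on which the coefficients of order at most [mu] do
    not vanish, and shows that they are too sparse for their coefficients in
    [x ^ p] to add up to more than [M ^ p] times a polynomial in [p], for every
    [M] larger than the norm of [lambda(x)].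

    Fixed points. For a cyclically reduced [g] of length [l >= 2], [E_N g] is the
    sum over all closed walks [x_0, ..., x_(l-1)] in the [N] points of the
    probability that the random actions realize every step. In a random action of
    a finite group, points with nontrivial stabilizer number at most about
    [N ^ (1/2)], and points with stabilizer of order at least three [N ^ (1/3)],
    in all moments: replacing orbits with stabilizer [H] by free ones embeds many
    choices of such orbits into few choices of points ([sum_ffact_base],
    [sum_big_stab]). Hence the steps in one factor, if they touch [V] points, are
    realized with probability [O(N ^ (- V / 2))] ([colour_bound]); and as every
    point of the walk is touched by two factors, a given coincidence pattern
    contributes [O(1)] in total. It contributes [O(N ^ (- 1/6))] unless the walk
    is good, that is, unless no step beats this bound and no point is touched by
    a third factor ([colour_bound_not_good], [prob_not_good]). In
    a good walk, two visits of the same point force the entire cyclic word to be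
    invariant under a rotation or a reflection ([good_walk_sym]), so that there
    are only [O(l ^ 2)] patterns of good walks. Therefore [E_N g] is eventually
    at most [D (l + 1) ^ 2], with [D] independent of [g]; and if [g] has no such
    symmetry, good walks visit distinct points and [E_N g] tends to [1]
    ([sum_injective]). Consequently [u_k g = 0] for [k < mu], while [u_mu g] is
    the limit of [E_N g - 1]: it is [O(l ^ 2)], and vanishes unless [g] is a
    proper power or a product of two involutions ([coefficient_cyc]). As [u_k] is
    invariant under conjugation, every other element reduces to this case or to
    the finitely many elements of length at most one.

    Sparseness. The function [green] sums [|x ^ t (g)| / M ^ t] over [t <= p].
    Since [M] exceeds the norm of [lambda(x)], it is bounded in l2 uniformly in
    [p] ([green_sq]). The Cayley graph being tree-like, a product of elements of
    the support of [x] reaches [g1 g2], where almost nothing cancels between [g1]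
    and [g2], only by passing near [g1]; hence [green (g1 g2)] is at most a
    constant times [green g1 * green g2], up to bounded corrections
    ([fat_chain]). Applied to
    [w c w^-1], to [w v (v ^ (q - 1)) w^-1] and to
    [w y a y^-1 z b z^-1 w^-1] with letters [a] and [b], this gives products in
    which each of the free parameters [w], [v], [y], [z] occurs twice, so that
    Cauchy-Schwarz bounds the sum of [green] over all these elements independently
    of [p] ([sum_conj_type], [sum_power_type], [sum_dihedral_type]). Together with
    the quadratic bound on the coefficients this yields
    [|u_k (x ^ p)| <= C (p + 1) ^ 3 M ^ p], and the limsup of the [p]-th roots is
    at most [M]. *)

(** * Random actions of a finite group *)

Section FiniteActions.
Local Open Scope group_scope.
Variables (gT : finGroupType) (T : finType).
Implicit Types (f : {ffun gT -> {perm T}}) (g h : gT) (t s : T).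

Definition homs : {set {ffun gT -> {perm T}}} :=
  [set f : {ffun gT -> {perm T}} | [forall g, forall h, f (g * h)%g == (f g * f h)%g]].

Definition stab f t : {set gT} := [set g | f g t == t].

Lemma homsM f g h t : f \in homs -> f (g * h)%g t = f h (f g t).
Proof. by rewrite inE => /forallP/(_ g)/forallP/(_ h)/eqP->; rewrite permM. Qed.

Lemma homs1 f t : f \in homs -> f 1%g t = t.
Proof.
move=> fH; apply: (@perm_inj _ (f 1%g)); by rewrite -homsM // mulg1.
Qed.

Lemma homsK f g t : f \in homs -> f g^-1%g (f g t) = t.
Proof. by move=> fH; rewrite -homsM // mulgV homs1. Qed.

Lemma homs_neq0 : (0 < #|homs|)%N.
Proof.
apply/card_gt0P; exists [ffun=> 1%g]; rewrite inE.
by apply/forallP=> g; apply/forallP=> h; rewrite !ffunE mulg1.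
Qed.

Lemma group1_stab f t : f \in homs -> 1%g \in stab f t.
Proof. by move=> fH; rewrite inE homs1. Qed.

(** Stabilizers along an orbit are conjugate. *)
Lemma card_stab_orbit f t g : f \in homs -> #|stab f (f g t)| = #|stab f t|.
Proof.
move=> fH; rewrite -[RHS](card_imset _ (conjg_inj g)).
apply: eq_card => h; rewrite inE; apply/eqP/imsetP => [e|[k + ->]].
  exists (h ^ g^-1)%g; last by rewrite conjgKV.
  rewrite inE conjgE invgK !homsM // e homsK //.
rewrite inE conjgE => /eqP e; by rewrite !homsM // homsK // e.
Qed.

(** ** Merging orbits with stabilizer [H] into free orbits *)

Section Switch.
Variable H : {group gT}.

Definition hpts f : {set T} := [set t | stab f t == H].

Definition orb f t : {set T} := [set f g t | g : gT].

Lemma orb_refl f t : f \in homs -> t \in orb f t.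
Proof. by move=> fH; apply/imsetP; exists 1%g; rewrite ?homs1. Qed.

Lemma orb_eq f s t : f \in homs -> s \in orb f t -> orb f s = orb f t.
Proof.
move=> fH /imsetP[g _ ->]; apply/setP=> r; apply/idP/idP=> /imsetP[h _ ->]; apply/imsetP.
  by exists (g * h)%g; rewrite ?homsM.
by exists (g^-1 * h)%g; rewrite // homsM // homsK.
Qed.

(** Choosing through the whole orbit makes [rep] constant on orbits, so that
    [base] is a transversal of the orbits of [hpts]. *)
Definition rep f t : T := odflt t [pick s | (s \in orb f t) && (stab f s == H)].

Definition base f : {set T} := [set t in hpts f | rep f t == t].

Lemma rep_eq f s t : f \in homs -> t \in hpts f -> s \in orb f t ->
  rep f s = rep f t.
Proof.
move=> fH tH st; rewrite /rep.
have -> : [pick r | (r \in orb f s) && (stab f r == H)]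
       = [pick r | (r \in orb f t) && (stab f r == H)].
  by apply: eq_pick => r /=; rewrite (orb_eq fH st).
by case: pickP => //= /(_ t); rewrite orb_refl //; move: tH; rewrite inE => ->.
Qed.

Lemma rep_orb f t : f \in homs -> t \in hpts f ->
  (rep f t \in orb f t) /\ (rep f t \in base f).
Proof.
move=> fH tH.
have [rt rH] : rep f t \in orb f t /\ stab f (rep f t) = H.
  rewrite /rep; case: pickP => [s /andP[] ? /eqP|/(_ t)] //=.
  by rewrite orb_refl //; move: tH; rewrite inE => ->.
by split=> //; rewrite !inE rH eqxx /= (rep_eq fH tH rt) eqxx.
Qed.

Lemma base_orb f s t : f \in homs -> s \in base f -> t \in base f ->
  s \in orb f t -> s = t.
Proof.
move=> fH; rewrite [s \in _]inE [t \in _]inE.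
by move=> /andP[_ /eqP es] /andP[tH /eqP et] /(rep_eq fH tH); rewrite es et.
Qed.

Lemma card_hpts f : f \in homs -> (#|hpts f| <= #|gT| * #|base f|)%N.
Proof.
move=> fH.
have: hpts f \subset [set f p.1 p.2 | p in setX [set: gT] (base f)].
  apply/subsetP=> t tH; have [rt rb] := rep_orb fH tH.
  have /imsetP[g _ tE] : t \in orb f (rep f t) by rewrite (orb_eq fH rt) orb_refl.
  by apply/imsetP; exists (g, rep f t); rewrite // in_setX inE.
move=> /subset_leq_card /leq_trans; apply.
by apply: (leq_trans (leq_imset_card _ _)); rewrite cardsX cardsT.
Qed.

(** The free action obtained from [f] when the [H]-orbits of the points
    [y (k, eta)], for [eta] in [H], are glued into one regular orbit for each
    [k]: the points of that orbit are the [glue f y (k, g)]. *)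
Section Glue.
Variable K : finType.
Implicit Types (y : {ffun K * subg_of H -> T}) (p : K * gT).

(** The part of [g] in [H], relative to a transversal of the right cosets. *)
Definition hpart g : subg_of H := subg H (g * (repr (H :* g))^-1).

Definition glue f y p : T := f p.2 (y (p.1, hpart p.2)).

Definition glue_fun f y g t : T :=
  if [pick p | glue f y p == t] is Some p then glue f y (p.1, (p.2 * g)%g)
  else f g t.

Definition switchable f y : bool :=
  [&& f \in homs, injectiveb y & y \in ffun_on (mem (base f))].

Lemma hpart_mem g : g * (repr (H :* g))^-1 \in H.
Proof.
have /rcosetP[h hH ->] := mem_repr_rcoset H g.
by rewrite invMg mulVKg // groupV.
Qed.

Lemma hpartE g : (sgval (hpart g) * repr (H :* g))%g = g.
Proof. by rewrite subgK ?hpart_mem // mulgKV. Qed.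

Lemma switch_stab f y a : switchable f y -> stab f (y a) = H.
Proof.
by case/and3P=> _ _ /ffun_onP/(_ a); rewrite !inE => /andP[/eqP].
Qed.

Lemma glue_inj f y : switchable f y -> injective (glue f y).
Proof.
move=> sw; case/and3P: (sw) => fH /injectiveP yi /ffun_onP yB [k g] [k' g'].
rewrite /glue /= => e.
have yE : y (k, hpart g) = y (k', hpart g').
  apply: (base_orb fH (yB _) (yB _)); apply/imsetP; exists (g' * g^-1)%g => //.
  by rewrite homsM // -e homsK.
have [ek eh] := yi _ _ yE; rewrite ek; congr pair.
have: (g' * g^-1)%g \in stab f (y (k, hpart g)).
  by rewrite inE homsM // [in X in f g' X]yE -e homsK.
rewrite (switch_stab _ sw) => gg.
have eH : H :* g = H :* g' by apply/esym/rcoset_eqP; rewrite mem_rcoset.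
by rewrite -(hpartE g) -(hpartE g') eH eh.
Qed.

Lemma glue_funE f y g p : switchable f y ->
  glue_fun f y g (glue f y p) = glue f y (p.1, (p.2 * g)%g).
Proof.
move=> sw; rewrite /glue_fun; case: pickP => [q /eqP/(glue_inj sw) ->//|].
by move=> /(_ p); rewrite eqxx.
Qed.

Lemma glue_fun_out f y g t : t \notin codom (glue f y) -> glue_fun f y g t = f g t.
Proof.
move=> tN; rewrite /glue_fun; case: pickP => // p /eqP e.
by case/negP: tN; rewrite -e codom_f.
Qed.

(** In the original action the second coordinate moves only inside the
    transversal: this is what the gluing changes. *)
Lemma glue_act f y g p : switchable f y ->
  f g (glue f y p) = glue f y (p.1, (sgval (hpart p.2) * repr (H :* (p.2 * g)))%g).
Proof.
move=> sw; have fH : f \in homs by case/and3P: sw.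
case: p => k h; rewrite /glue /=; set r := repr _; set s := hpart h.
have rH : H :* r = H :* (h * g)%g.
  by apply/rcoset_eqP; rewrite mem_repr_rcoset.
have sH : sgval s \in H by rewrite subgP.
have -> : hpart (sgval s * r)%g = s.
  rewrite /hpart; have -> : H :* (sgval s * r)%g = H :* (h * g)%g.
    by rewrite rcosetM (rcoset_id sH).
  by rewrite -/r mulgK sgvalK.
have st a : a \in H -> f a (y (k, s)) = y (k, s).
  by rewrite -(switch_stab (k, s) sw) inE => /eqP.
rewrite -homsM // [RHS]homsM // (st _ sH) -(mulgKV r (h * g)%g) [LHS]homsM // st //.
by rewrite -mem_rcoset rH rcoset_refl.
Qed.

Lemma glue_act_out f y g t : switchable f y ->
  t \notin codom (glue f y) -> f g t \notin codom (glue f y).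
Proof.
move=> sw; have fH : f \in homs by case/and3P: sw.
apply: contra => /codomP[p e].
by rewrite -(homsK g t fH) e (glue_act _ _ sw) codom_f.
Qed.

Lemma glue_funM f y g h t : switchable f y ->
  glue_fun f y (g * h)%g t = glue_fun f y h (glue_fun f y g t).
Proof.
move=> sw; have fH : f \in homs by case/and3P: sw.
have [/codomP[p ->]|tN] := boolP (t \in codom (glue f y)).
  by rewrite !glue_funE //= mulgA.
by rewrite !glue_fun_out ?homsM ?glue_act_out.
Qed.

Lemma glue_fun_inj f y g : switchable f y -> injective (glue_fun f y g).
Proof.
move=> sw; have fH : f \in homs by case/and3P: sw.
apply: (can_inj (g := glue_fun f y g^-1)) => t; rewrite -glue_funM // mulgV.
have [/codomP[[k h] ->]|tN] := boolP (t \in codom (glue f y)).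
  by rewrite glue_funE //= mulg1.
by rewrite glue_fun_out ?homs1.
Qed.

(** The images of the points [(k, 1)] are kept, since together with the glued
    action they locate the glued orbits. *)
Definition switch (fy : {ffun gT -> {perm T}} * {ffun K * subg_of H -> T}) :
    {ffun gT -> {perm T}} * {ffun K -> T} :=
  ([ffun g => if pick (fun h : {perm T} => [forall t, h t == glue_fun fy.1 fy.2 g t])
              is Some h then h else 1%g],
   [ffun k => glue fy.1 fy.2 (k, 1%g)]).

Lemma switchE f y g t : switchable f y ->
  (switch (f, y)).1 g t = glue_fun f y g t.
Proof.
move=> sw; rewrite /= ffunE; case: pickP => [h /forallP/(_ t)/eqP//|].
move=> /(_ (perm (glue_fun_inj (g:=g) sw))); case/idP.
by apply/forallP=> s; rewrite permE.
Qed.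

Lemma switch_homs f y : switchable f y -> (switch (f, y)).1 \in homs.
Proof.
move=> sw; rewrite inE; apply/forallP=> g; apply/forallP=> h; apply/eqP.
by apply/permP=> t; rewrite permM !switchE // glue_funM.
Qed.

(** From the glued action and one point of each new orbit, [glue f y] is
    recovered as an orbit map, [y] as its restriction to [H], and the original
    action by [glue_act]. *)
Lemma switch_inj f y f' y' : switchable f y -> switchable f' y' ->
  switch (f, y) = switch (f', y') -> (f, y) = (f', y').
Proof.
move=> sw sw' e.
have eg : glue f y =1 glue f' y'.
  move=> [k g].
  have /ffunP/(_ k) := congr1 snd e; rewrite !ffunE => e1.
  rewrite -[g]mul1g -[LHS](glue_funE g (k, 1%g) sw).
  rewrite -[RHS](glue_funE g (k, 1%g) sw') -!switchE //.
  by rewrite e1 e.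
have gy f0 y0 (k : K) (h : subg_of H) : switchable f0 y0 -> glue f0 y0 (k, sgval h) = y0 (k, h).
  move=> sw0; rewrite /glue /=; have hH : sgval h \in H := subgP h.
  have -> : hpart (sgval h) = h.
    rewrite /hpart rcoset_id //.
    have -> : repr H = 1%g by rewrite /repr group1.
    by rewrite invg1 mulg1 sgvalK.
  by apply/eqP; move: hH; rewrite -(switch_stab (k, h) sw0) inE.
have ey : y = y' by apply/ffunP=> -[k h]; rewrite -(gy f) // -(gy f') // eg.
rewrite ey; congr pair; apply/ffunP=> g; apply/permP=> t.
have ec : codom (glue f y) =i codom (glue f' y').
  by move=> s; apply/codomP/codomP=> -[p ->]; exists p; rewrite eg.
have [/codomP[p tE]|tN] := boolP (t \in codom (glue f y)).
  by rewrite {1}tE glue_act // eg -glue_act // -eg -tE.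
rewrite -(glue_fun_out (y := y) _ tN) -switchE // e switchE //.
by rewrite glue_fun_out // -ec.
Qed.

(** The switch replaces [#|K| * #|H|] marked base points by [#|K|] marked points
    without loss of information: this is why a random action has at most about
    [#|T| ^ (1 / #|H|)] orbits with stabilizer [H]. *)
Lemma sum_ffact_base :
  (\sum_(f in homs) #|base f| ^_ (#|K| * #|H|) <= #|homs| * #|T| ^ #|K|)%N.
Proof.
have <- : #|[set fy | switchable fy.1 fy.2]|
          = (\sum_(f in homs) #|base f| ^_ (#|K| * #|H|))%N.
  rewrite -sum1_card (eq_bigl (fun fy => (fy.1 \in homs) &&
     (fy.2 \in [set y in ffun_on (mem (base fy.1)) | injectiveb y]))); last first.
    by move=> [f y]; rewrite inE /switchable /= [y \in [set _ | _]]inE [_ && injectiveb y]andbC.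
  rewrite -(pair_big_dep (fun f => f \in homs) (fun f y =>
     y \in [set y in ffun_on (mem (base f)) | injectiveb y]) (fun _ _ => 1%N)) /=.
  apply: eq_bigr => f _; rewrite sum1_card card_inj_ffuns_on.
  by rewrite card_prod; congr (_ ^_ (_ * _))%N; rewrite card_sub; apply: eq_card => g; rewrite !inE.
have <- : #|setX homs [set: {ffun K -> T}]| = (#|homs| * #|T| ^ #|K|)%N.
  by rewrite cardsX cardsT card_ffun.
rewrite -(card_in_imset (f := switch)); last first.
  by move=> [f y] [f' y']; rewrite !inE; apply: switch_inj.
apply/subset_leq_card/subsetP=> _ /imsetP[[f y] sw ->].
by rewrite inE in sw; rewrite in_setX (switch_homs sw) inE.
Qed.

End Glue.
End Switch.
End FiniteActions.

(** ** Moments of the number of points with a large stabilizer *)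

Section Moments.
Local Open Scope nat_scope.

Lemma expn_ffact_lb b a k : k <= a -> (b - a) ^ k <= b ^_ k.
Proof.
elim: k => // k IH ka; rewrite expnSr ffactnSr; apply: leq_mul; first exact/IH/ltnW.
exact/leq_sub2l/ltnW.
Qed.

Lemma expn_le_ffact b a : b ^ a <= 2 ^ a * b ^_ a + (2 * a) ^ a.
Proof.
have [ab|ba] := leqP (2 * a) b; last first.
  by apply: (leq_trans _ (leq_addl _ _)); case: a ba => // a ba; rewrite leq_exp2r // ltnW.
apply: (leq_trans _ (leq_addr _ _)).
apply: (@leq_trans (2 ^ a * (b - a) ^ a)); last by rewrite leq_mul2l expn_ffact_lb ?orbT.
by rewrite -expnMn; case: (a) ab => // k kb; rewrite leq_exp2r //; lia.
Qed.

Lemma sum_hpts_expn (gT : finGroupType) (T : finType) (H : {group gT}) (q : nat) :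
  0 < #|T| ->
  \sum_(f in homs gT T) #|hpts H f| ^ (q * #|H|) <=
  #|gT| ^ (q * #|H|) * (2 ^ (q * #|H|) + (2 * (q * #|H|)) ^ (q * #|H|)) *
  (#|homs gT T| * #|T| ^ q).
Proof.
move=> T0; set a := q * #|H|.
have sw := sum_ffact_base T H 'I_q; rewrite card_ord -/a in sw.
apply: (@leq_trans (\sum_(f in homs gT T)
    (#|gT| ^ a * (2 ^ a * #|base H f| ^_ a + (2 * a) ^ a)))).
  apply: leq_sum => f fH; apply: (@leq_trans ((#|gT| * #|base H f|) ^ a)).
    by case: (a) => // k; rewrite leq_exp2r // card_hpts.
  by rewrite expnMn leq_mul2l expn_le_ffact orbT.
rewrite -big_distrr /= big_split /= -big_distrr /= sum_nat_const -mulnA leq_mul2l.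
apply/orP; right; rewrite mulnDl leq_add //; first by rewrite leq_mul2l sw orbT.
by rewrite mulnC leq_mul2l leq_pmulr ?orbT // expn_gt0 T0.
Qed.

End Moments.

Definition big_stab (gT : finGroupType) (T : finType) (j : nat)
    (f : {ffun gT -> {perm T}}) : {set T} := [set t | (j <= #|stab f t|)%N].

Section RealMoments.
Variables (R : realType) (gT : finGroupType).
Local Open Scope ring_scope.

(** Moments of every order follow from those of an order divisible by [#|H|].
    With [tau = #|T| ^ (1/6)], both exponents [1/2] and [1/3] that matter below
    become integral powers of [tau]. *)
Lemma sum_hpts_real (H : {group gT}) (s a : nat) : (6 <= s * #|H|)%N ->
  exists2 C : R, 0 <= C & forall (T : finType) (tau : R),
    1 <= tau -> tau ^+ 6 = #|T|%:R ->
    \sum_(f in homs gT T) #|hpts H f|%:R ^+ a <= C * #|homs gT T|%:R * tau ^+ (s * a).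
Proof.
move=> sH; set b := (a * #|H|)%N.
set C := (#|gT| ^ b * (2 ^ b + (2 * b) ^ b))%N.
exists (1 + C%:R); first by rewrite addr_ge0.
move=> T tau tau1 tauT.
have tau0 : 0 < tau by apply: lt_le_trans tau1.
have T0 : (0 < #|T|)%N.
  by rewrite -(ltr0n R) -tauT exprn_gt0.
pose u := tau ^+ s; have u0 : 0 < u by rewrite exprn_gt0.
have pt (x : R) : 0 <= x -> x ^+ a <= u ^+ a + x ^+ b * (u ^+ a / u ^+ b).
  move=> x0; have [xu|ux] := leP x u.
    apply: (le_trans (lerXn2r _ _ _ xu)); rewrite ?nnegrE ?(ltW u0) //.
    by rewrite lerDl mulr_ge0 ?divr_ge0 ?exprn_ge0 // ltW.
  have -> : x ^+ a = u ^+ a * (x / u) ^+ a.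
    by rewrite expr_div_n mulrCA divff ?mulr1 // expf_neq0 // gt_eqF.
  have -> : x ^+ b * (u ^+ a / u ^+ b) = u ^+ a * (x / u) ^+ b.
    by rewrite expr_div_n mulrCA.
  apply: (@le_trans _ _ (u ^+ a * (x / u) ^+ b)).
    apply: ler_wpM2l; first by rewrite exprn_ge0 // ltW.
    apply: ler_weXn2l; last by rewrite leq_pmulr // cardG_gt0.
    by rewrite ler_pdivlMr ?mul1r // ltW.
  by rewrite lerDr exprn_ge0 // ltW.
apply: (@le_trans _ _ (\sum_(f in homs gT T)
   (u ^+ a + #|hpts H f|%:R ^+ b * (u ^+ a / u ^+ b)))).
  by apply: ler_sum => f _; apply: pt.
rewrite big_split /= sumr_const -mulr_suml.
have -> : (1 + C%:R) * #|homs gT T|%:R * tau ^+ (s * a)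
   = u ^+ a *+ #|homs gT T| + C%:R * #|homs gT T|%:R * u ^+ a.
  by rewrite exprM -/u -mulr_natl; ring.
rewrite lerD2l.
have /(_ T0) := @sum_hpts_expn gT T H a; rewrite -/b -/C => hb.
have hbR : \sum_(f in homs gT T) #|hpts H f|%:R ^+ b <=
    C%:R * (#|homs gT T|%:R * #|T|%:R ^+ a) :> R.
  rewrite -natrX -!natrM; apply: le_trans (_ : _ <= _%:R) _; last first.
    by rewrite ler_nat; apply: hb.
  by rewrite natr_sum; apply: ler_sum => f _; rewrite natrX.
apply: (@le_trans _ _ (C%:R * (#|homs gT T|%:R * #|T|%:R ^+ a) * (u ^+ a / u ^+ b))).
  by rewrite ler_wpM2r // divr_ge0 // exprn_ge0 // ltW.
rewrite -!mulrA ler_wpM2l // ler_wpM2l // mulrCA.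
apply: ler_piMr; first by rewrite exprn_ge0 // ltW.
rewrite ler_pdivrMr ?exprn_gt0 // mul1r.
rewrite -tauT -!exprM; apply: ler_weXn2l => //.
by rewrite /b mulnCA mulnC leq_mul2l sH orbT.
Qed.

Lemma ler_sum_expr (I : finType) (P : pred I) (F : I -> R) a : (0 < a)%N ->
  (forall i, 0 <= F i) ->
  (\sum_(i | P i) F i) ^+ a <= #|I|%:R ^+ a * \sum_(i | P i) F i ^+ a.
Proof.
move=> a0 F0; case: (pickP P) => [i0 Pi0|P0]; last first.
  by rewrite !big_pred0 // mulr0 expr0n; case: a a0.
have [i Pi imax] := arg_maxP F Pi0.
have le1 : \sum_(i | P i) F i <= #|I|%:R * F i.
  rewrite mulr_natl -sumr_const big_mkcond /=.
  by apply: ler_sum => j _; case: ifP => // Pj; apply: imax.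
apply: (@le_trans _ _ ((#|I|%:R * F i) ^+ a)).
  by rewrite lerXn2r // nnegrE ?mulr_ge0 ?sumr_ge0.
rewrite exprMn ler_wpM2l ?exprn_ge0 // (bigD1 i) //= lerDl.
by apply: sumr_ge0 => j _; rewrite exprn_ge0.
Qed.

Lemma card_big_stab (T : finType) j (f : {ffun gT -> {perm T}}) : f \in homs gT T ->
  #|big_stab j f|%:R <= \sum_(H : {group gT} | (j <= #|H|)%N) #|hpts H f|%:R :> R.
Proof.
move=> fH; rewrite -natr_sum ler_nat.
have gS t : group_set (stab f t).
  apply/group_setP; split; first exact: group1_stab.
  by move=> g h; rewrite !inE => /eqP gt /eqP ht; rewrite homsM // gt ht.
rewrite -sum1_card (partition_big (fun t => group (gS t)) (fun H => j <= #|H|)%N) /=.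
  apply: leq_sum => H _; rewrite sum1_card subset_leq_card //.
  by apply/subsetP=> t /andP[_ /eqP e]; rewrite inE -e.
by move=> t; rewrite inE.
Qed.

Lemma sum_big_stab (j s a : nat) : (6 <= s * j)%N ->
  exists2 C : R, 0 <= C & forall (T : finType) (tau : R),
    1 <= tau -> tau ^+ 6 = #|T|%:R ->
    \sum_(f in homs gT T) #|big_stab j f|%:R ^+ a
      <= C * #|homs gT T|%:R * tau ^+ (s * a).
Proof.
move=> sj; have [->|a0] := posnP a.
  exists 1 => // T tau _ _; rewrite muln0 expr0 mulr1 mul1r.
  by under eq_bigr do rewrite expr0; rewrite sumr_const.
have ex (H : {group gT}) : exists C : R, 0 <= C /\ ((j <= #|H|)%N ->
    forall (T : finType) (tau : R), 1 <= tau -> tau ^+ 6 = #|T|%:R ->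
    \sum_(f in homs gT T) #|hpts H f|%:R ^+ a <= C * #|homs gT T|%:R * tau ^+ (s * a)).
  have [jH|] := boolP (j <= #|H|)%N; last by exists 0.
  have [|C C0 CP] := @sum_hpts_real H s a; first exact: (leq_trans sj (leq_mul _ _)).
  by exists C.
have [C CP] := choice ex.
pose D : R := #|{: {group gT}}|%:R ^+ a.
exists (D * \sum_(H : {group gT} | (j <= #|H|)%N) C H).
  by rewrite mulr_ge0 ?exprn_ge0 ?sumr_ge0 // => H _; case: (CP H).
move=> T tau tau1 tauT.
apply: (@le_trans _ _ (\sum_(f in homs gT T)
   D * \sum_(H : {group gT} | (j <= #|H|)%N) #|hpts H f|%:R ^+ a)).
  apply: ler_sum => f fH; apply: le_trans (ler_sum_expr _ a0 _) => //.
  by rewrite lerXn2r ?nnegrE ?sumr_ge0 // card_big_stab.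
rewrite -mulr_sumr exchange_big /= -!mulrA ler_wpM2l ?exprn_ge0 //.
rewrite mulr_suml; apply: ler_sum => H jH; rewrite mulrA.
by case: (CP H) => _; apply.
Qed.

(** The mixed moment by Cauchy-Schwarz, in the form of a weighted
    arithmetic-geometric inequality. *)
Lemma sum_big_stab23 (a : nat) :
  exists2 C : R, 0 <= C & forall (T : finType) (tau : R),
    1 <= tau -> tau ^+ 6 = #|T|%:R ->
    \sum_(f in homs gT T) #|big_stab 2 f|%:R ^+ a * #|big_stab 3 f|%:R
      <= C * #|homs gT T|%:R * tau ^+ (3 * a + 2).
Proof.
have [C2 C20 C2P] := @sum_big_stab 2 3 (a * 2) isT.
have [C3 C30 C3P] := @sum_big_stab 3 2 2 isT.
exists (C2 + C3); first by rewrite addr_ge0.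
move=> T tau tau1 tauT; have tau0 : 0 < tau by apply: lt_le_trans tau1.
pose v := tau ^+ (3 * a); pose w := tau ^+ 2.
have v0 : 0 < v by rewrite exprn_gt0.
have w0 : 0 < w by rewrite exprn_gt0.
apply: (@le_trans _ _ (\sum_(f in homs gT T)
   ((w / v) * #|big_stab 2 f|%:R ^+ (a * 2) + (v / w) * #|big_stab 3 f|%:R ^+ 2))).
  apply: ler_sum => f _; rewrite exprM.
  set x := _ ^+ a; set y := #|big_stab 3 f|%:R.
  have x0 : 0 <= x by rewrite exprn_ge0.
  have y0 : 0 <= y by [].
  have -> : w / v * x ^+ 2 + v / w * y ^+ 2 =
      (v * w) * ((x / v) ^+ 2 + (y / w) ^+ 2) by field; rewrite !gt_eqF.
  have -> : x * y = (v * w) * ((x / v) * (y / w)) by field; rewrite !gt_eqF.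
  apply: ler_wpM2l; first exact/ltW/mulr_gt0.
  have p0 : 0 <= x / v by rewrite divr_ge0 // ltW.
  have q0 : 0 <= y / w by rewrite divr_ge0 // ltW.
  by have := sqr_ge0 (x / v - y / w); nra.
rewrite big_split /= -!mulr_sumr !mulrDl exprD -/v -/w.
have vE : tau ^+ (3 * (a * 2)) = v ^+ 2 by rewrite mulnA exprM.
have wE : tau ^+ (2 * 2) = w ^+ 2 by rewrite exprM.
apply: lerD.
  apply: (@le_trans _ _ (w / v * (C2 * #|homs gT T|%:R * v ^+ 2))).
    by rewrite ler_wpM2l ?divr_ge0 ?(ltW w0) ?(ltW v0) // -vE; apply: C2P.
  by rewrite le_eqVlt; apply/orP; left; apply/eqP; field; rewrite gt_eqF.
apply: (@le_trans _ _ (v / w * (C3 * #|homs gT T|%:R * w ^+ 2))).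
  by rewrite ler_wpM2l ?divr_ge0 ?(ltW w0) ?(ltW v0) // -wE; apply: C3P.
by rewrite le_eqVlt; apply/orP; left; apply/eqP; field; rewrite gt_eqF.
Qed.

End RealMoments.

(** * Probability that a random action realizes a pattern of labelled edges *)

Section Colour.
Local Open Scope nat_scope.
Variables (gT : finGroupType) (T J : finType) (nx : J -> J) (e : J -> option gT).
Hypothesis e_neq1 : forall j g, e j = Some g -> g != 1%g.
Implicit Types (x : J -> T) (f : {ffun gT -> {perm T}}) (s : {perm T}).

(** A labelled pattern: [f] must send [x j] to [x (nx j)] under the label of [j],
    for those [j] that carry one. *)
Definition realizes f x : bool :=
  [forall j, if e j is Some g then f g (x j) == x (nx j) else true].

Lemma realizesP f x j g : realizes f x -> e j = Some g -> f g (x j) = x (nx j).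
Proof. by move=> /forallP/(_ j) + ej; rewrite ej => /eqP. Qed.

Lemma eq_realizes f x x' : x =1 x' -> realizes f x = realizes f x'.
Proof.
by move=> xx; apply: eq_forallb => j; case: (e j) => // g; rewrite !xx.
Qed.

(** Conjugating a random action by a permutation does not change its law. *)
Lemma card_realizes_perm x s :
  #|[set f in homs gT T | realizes f (s \o x)]| = #|[set f in homs gT T | realizes f x]|.
Proof.
pose c s' f : {ffun gT -> {perm T}} := [ffun g => f g ^ s']%g.
have cE s' f g t : c s' f g (s' t) = s' (f g t) by rewrite ffunE permJ.
have cK s' : cancel (c s'^-1)%g (c s').
  by move=> f; apply/ffunP=> g; rewrite !ffunE conjgKV.
have c_homs s' f : f \in homs gT T -> c s' f \in homs gT T.
  rewrite !inE => /forallP fM; apply/forallP=> g; apply/forallP=> h.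
  by rewrite !ffunE -conjMg (eqP (forallP (fM g) h)).
have c_real s' f y : realizes f y -> realizes (c s' f) (s' \o y).
  move=> fy; apply/forallP=> j; case ej: (e j) => [g|] //=.
  by rewrite cE (realizesP fy ej).
rewrite -[RHS](card_imset _ (can_inj (cK s^-1%g))) invgK; apply: eq_card => f.
apply/idP/imsetP => [|[h hP ->]].
  rewrite in_set => /andP[fH fx]; exists (c s^-1%g f); last by rewrite cK.
  rewrite in_set c_homs //= -(@eq_realizes _ ((s^-1)%g \o (s \o x)) x).
    exact: c_real.
  by move=> j /=; rewrite permK.
by move: hP; rewrite !(in_set (fun _ => _ && _)) => /andP[hH hx]; rewrite c_homs // c_real.
Qed.

Section Pattern.
Variable x : J -> T.

(** The labelled steps form a graph on [T], with vertices [touched] and adjacency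
    [linked]; its components are represented by [comp_root]. *)
Definition touched : {set T} :=
  [set t | [exists j, e j && ((t == x j) || (t == x (nx j)))]].

Definition linked : rel T := [rel s t | [exists j, e j &&
  ((s == x j) && (t == x (nx j)) || (t == x j) && (s == x (nx j)))]].

Lemma linked_sym : connect_sym linked.
Proof.
by apply: sym_connect_sym => s t /=; apply: eq_existsb => j; rewrite orbC.
Qed.

Lemma linked_edge j g : e j = Some g -> connect linked (x j) (x (nx j)).
Proof. by move=> ej; apply/connect1/existsP; exists j; rewrite ej !eqxx. Qed.

Lemma touched_l j g : e j = Some g -> x j \in touched.
Proof. by move=> ej; rewrite inE; apply/existsP; exists j; rewrite ej eqxx. Qed.

Lemma touched_r j g : e j = Some g -> x (nx j) \in touched.
Proof. by move=> ej; rewrite inE; apply/existsP; exists j; rewrite ej eqxx orbT. Qed.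

Lemma touchedP t : reflect (exists j g, e j = Some g /\ (t = x j \/ t = x (nx j)))
  (t \in touched).
Proof.
rewrite inE; apply: (iffP existsP) => [[j]|[j [g [ej tj]]]].
  by case ej: (e j) => [g|] //= /orP[] /eqP; exists j, g; split=> //; [left|right].
by exists j; rewrite ej /=; case: tj => ->; rewrite eqxx ?orbT.
Qed.

Lemma linked_touched t u : connect linked t u -> t \in touched -> u \in touched.
Proof.
have cl : closed linked touched.
  move=> s t' /existsP[j]; case ej: (e j) => [g|] //=.
  by case/orP=> /andP[/eqP-> /eqP->]; rewrite (touched_l ej) (touched_r ej).
by move=> /(closed_connect cl) ->.
Qed.

Definition comp_root : {set T} := [set t in touched | root linked t == t].
Definition comp (t : T) : {set T} := [set u | root linked u == t].

Lemma root_comp_root t : t \in touched -> root linked t \in comp_root.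
Proof.
move=> tS; rewrite inE root_root ?eqxx ?andbT; last exact: linked_sym.
exact: linked_touched (connect_root _ _) tS.
Qed.

Lemma sum_card_comp : \sum_(r in comp_root) #|comp r| = #|touched|.
Proof.
apply/esym; rewrite -[LHS]sum1_card (partition_big (root linked) (fun r => r \in comp_root)) /=; last first.
  by move=> t; apply: root_comp_root.
apply: eq_bigr => r; rewrite inE => /andP[rS /eqP rr].
rewrite -[RHS]sum1_card; apply: eq_bigl => t; rewrite [t \in comp _]inE andbC.
have [/eqP tr /=|//] := boolP (root linked t == r).
rewrite (@linked_touched r) //.
by rewrite -root_connect ?tr ?rr //; apply: linked_sym.
Qed.

Lemma comp_gt0 r : r \in comp_root -> 0 < #|comp r|.
Proof. by rewrite inE => /andP[_ rr]; apply/card_gt0P; exists r; rewrite inE. Qed.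

(** The values on one point of each component determine the permutation on
    all the touched points. *)
Lemma card_realizing_perms f (A : T -> {set T}) :
  (forall s, realizes f (s \o x) -> forall r, r \in comp_root -> s r \in A r) ->
  #|[set s : {perm T} | realizes f (s \o x)]|
    <= (\prod_(r in comp_root) #|A r|) * (#|T| - #|touched|)`!.
Proof.
move=> AP; pose rs s := [ffun t => if t \in comp_root then s t else t].
pose F := [set h : {ffun T -> T} | h \in family (fun t =>
  if t \in comp_root then mem (A t) else mem (pred1 t))].
have cF : #|F| = \prod_(r in comp_root) #|A r|.
  rewrite cardsE card_family foldrE.
  rewrite big_image /= [RHS]big_mkcond /=; apply: eq_bigr => t _.
  by case: ifP; rewrite ?card1.
rewrite -sum1_card (partition_big rs (mem F)) /=; last first.
  move=> s; rewrite inE => /AP sA; rewrite inE; apply/familyP=> t; rewrite ffunE.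
  by case: ifP => [/sA //|_]; rewrite inE.
rewrite -cF -sum_nat_const; apply: leq_sum => h hF; rewrite sum1_card.
rewrite -cardsE; set D := [set s | _].
have [->|[s0]] := set_0Vmem D; first by rewrite cards0.
rewrite inE unfold_in /= => /andP[]; rewrite inE => s0f /eqP s0h.
have agree s : s \in D -> {in touched, s =1 s0}.
  rewrite inE unfold_in /= => /andP[]; rewrite inE => sf /eqP sh t tS.
  have: connect linked (root linked t) t by rewrite linked_sym connect_root.
  case/connectP=> p; set r := root linked t => rp ->.
  have rC : r \in comp_root by apply: root_comp_root.
  have: s r = s0 r.
    by have /ffunP/(_ r) := etrans sh (esym s0h); rewrite !ffunE rC.
  elim: p r {rC} rp => //= u p IH r /andP[ru up] er; apply: IH up _.
  case/existsP: ru => j; case ej: (e j) => [g|] //=.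
  have g1 := realizesP sf ej; have g2 := realizesP s0f ej; rewrite /= in g1 g2.
  case/orP=> /andP[/eqP rE /eqP uE].
    by rewrite uE -g1 -g2 -rE er.
  by rewrite rE; apply: (@perm_inj _ (f g)); rewrite g1 g2 -uE er.
have <- : #|perm_on (~: touched)| = (#|T| - #|touched|)`!.
  by rewrite card_perm cardsCs setCK.
rewrite -(card_imset _ (mulIg s0^-1%g)); apply/subset_leq_card/subsetP=> _ /imsetP[s sD ->].
apply/subsetP=> t; rewrite unfold_in in_setC permM; apply: contraNN => tS.
by rewrite (agree s sD t tS) permK.
Qed.

End Pattern.
End Colour.

Section ColourBound.
Local Open Scope nat_scope.
Variables (gT : finGroupType) (T J : finType) (nx : J -> J) (e : J -> option gT).
Hypothesis e_neq1 : forall j g, e j = Some g -> g != 1%g.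
Variable x : J -> T.
Implicit Types (f : {ffun gT -> {perm T}}) (s : {perm T}).

Local Notation realizes := (realizes nx e).
Local Notation touched := (touched nx e x).
Local Notation linked := (linked nx e x).
Local Notation comp_root := (comp_root nx e x).
Local Notation comp := (comp nx e x).

(** Averaging over all relabellings [s] of the points by conjugation invariance,
    a realized relabelled pattern is determined, up to the untouched points, by
    the images of the roots, and these must lie in [A f r]. *)
Lemma card_realizes_le (A : {ffun gT -> {perm T}} -> T -> {set T}) :
  (forall f s r, f \in homs gT T -> realizes f (s \o x) -> r \in comp_root ->
     s r \in A f r) ->
  #|[set f in homs gT T | realizes f x]| * #|T| ^_ #|touched|
    <= \sum_(f in homs gT T) \prod_(r in comp_root) #|A f r|.
Proof.
move=> AP; have VT : #|touched| <= #|T| by apply: max_card.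
rewrite -(@leq_pmul2r (#|T| - #|touched|)`!) ?fact_gt0 //.
rewrite -mulnA ffact_fact // big_distrl /=.
apply: (@leq_trans (\sum_(f in homs gT T) #|[set s : {perm T} | realizes f (s \o x)]|)).
  have <- : #|{: {perm T}}| = (#|T|)`!.
    by rewrite -[#|T|]cardsT -card_perm ; apply: eq_card => s; rewrite !inE; apply/esym/subsetP=> t; rewrite inE.
  under [leqRHS]eq_bigr do rewrite -sum1_card.
  rewrite (exchange_big_dep xpredT) //= mulnC -sum_nat_const.
  apply: leq_sum => s _; rewrite -(card_realizes_perm nx e x s) -sum1_card.
  by rewrite leq_eqVlt; apply/orP; left; apply/eqP/eq_bigl => f; rewrite !inE.
apply: leq_sum => f fH; apply: card_realizing_perms => s sf r rC.
exact: AP.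
Qed.

Lemma card_stab_linked f s u v : f \in homs gT T -> realizes f (s \o x) ->
  connect linked u v -> #|stab f (s u)| = #|stab f (s v)|.
Proof.
move=> fH sf /connectP[p up ->]; elim: p u up => //= w p IH u /andP[/existsP[j]].
case ej: (e j) => [g|] //= uw /IH <-.
have := realizesP sf ej => /= E.
by case/orP: uw => /andP[/eqP-> /eqP->]; rewrite -E card_stab_orbit.
Qed.

Lemma stab_gt1 f t g : f \in homs gT T -> g != 1%g -> f g t = t -> t \in big_stab 2 f.
Proof.
move=> fH g1 gt; rewrite inE; apply: (@leq_trans #|[set 1%g; g]|).
  by rewrite cards2 eq_sym g1.
apply/subset_leq_card/subsetP=> h; rewrite !inE => /orP[]/eqP->; last exact/eqP.
by rewrite homs1.
Qed.

Lemma stab_gt2 f t g h : f \in homs gT T -> g != 1%g -> h != 1%g -> g != h ->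
  f g t = t -> f h t = t -> t \in big_stab 3 f.
Proof.
move=> fH g1 h1 gh gt ht; rewrite inE.
apply: (@leq_trans #|[set 1%g] :|: [set g; h]|).
  by rewrite cardsU1 cards2 gh !inE negb_or eq_sym g1 eq_sym h1.
apply/subset_leq_card/subsetP=> k; rewrite !inE => /orP[|/orP[]]/eqP->; last 2 first.
- exact/eqP.
- exact/eqP.
by rewrite homs1.
Qed.

Lemma singleton_comp r : r \in comp_root -> #|comp r| = 1 ->
  exists j g, [/\ e j = Some g, x j = r & x (nx j) = r].
Proof.
rewrite inE => /andP[rS /eqP rr] /eqP/cards1P[t tE].
have inr u : connect linked r u -> u = r.
  move=> ru; have : u \in comp r.
    by rewrite inE -[in X in _ == X]rr eq_sym root_connect //; apply: linked_sym.
  have : r \in comp r by rewrite inE rr.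
  by rewrite tE !inE => /eqP-> /eqP.
have [j [g [ej rj]]] := touchedP _ _ _ _ rS; exists j, g; split=> //.
  case: rj => [->//|rj]; apply: inr; rewrite rj linked_sym; exact: linked_edge ej.
by case: rj => [rj|->//]; apply: inr; rewrite rj; apply: linked_edge ej.
Qed.

Definition loop_roots : {set T} := [set r in comp_root | #|comp r| == 1].

(** A component with a single point carries a loop, and hence a nontrivial
    element that fixes its root. *)
Definition allowed f r : {set T} := if #|comp r| == 1 then big_stab 2 f else [set: T].

Lemma allowedP f s r : f \in homs gT T -> realizes f (s \o x) -> r \in comp_root ->
  s r \in allowed f r.
Proof.
move=> fH sf rC; rewrite /allowed; case: eqP => [c1|_]; last by rewrite in_setT.
have [j [g [ej xj xnj]]] := singleton_comp rC c1.
apply: (stab_gt1 (g := g)) => //; first exact: e_neq1 ej.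
by have := realizesP sf ej; rewrite /= xj xnj.
Qed.

(** Each component of size one is worth half a point, every other component one
    point; since the latter have at least two points, a pattern with [V] touched
    points is worth at most [V / 2]. *)
Lemma card_comp_root (D : {set T}) : D \subset comp_root ->
  #|D :&: loop_roots| + 2 * #|D :\: loop_roots| <= \sum_(r in D) #|comp r|.
Proof.
move=> /subsetP DC; rewrite (big_setID loop_roots) /= leq_add //.
  rewrite -sum1_card; apply: leq_sum => r; rewrite inE => /andP[/DC rC _].
  exact: comp_gt0.
rewrite mulnC -sum_nat_const; apply: leq_sum => r; rewrite in_setD => /andP[+ rD].
have rC := DC r rD; have := comp_gt0 rC; rewrite [_ \in loop_roots]inE rC /=.
by case: #|comp r| => [|[]].
Qed.

Lemma prod_allowed f (D : {set T}) : D \subset comp_root ->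
  \prod_(r in D) #|allowed f r| =
  #|big_stab 2 f| ^ #|D :&: loop_roots| * #|T| ^ #|D :\: loop_roots|.
Proof.
move=> /subsetP DC; rewrite (big_setID loop_roots) /= -!prod_nat_const; congr (_ * _).
  apply: eq_bigr => r; rewrite !inE => /andP[rD /andP[_ c1]].
  by rewrite /allowed c1.
apply: eq_bigr => r; rewrite in_setD => /andP[rL rD].
rewrite /allowed; case: ifP => [c1|]; last by rewrite cardsT.
by case/negP: rL; rewrite inE DC.
Qed.

End ColourBound.

(** * Reduced words: conjugation, powers and involutions *)

Section Words.
Variables (m : nat) (G : 'I_m -> finGroupType).
Local Notation Gam := (free_product G).
Local Open Scope nat_scope.
Implicit Types (x y z : Gam) (v w : seq (letter G)).

Definition len x : nat := size (val x).

Lemma val_mul x y : val (x * y)%g = wmul (val x) (val y).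
Proof. by []. Qed.

Lemma val_inv x : val x^-1%g = winv (val x).
Proof. by []. Qed.

Lemma len_inv x : len x^-1%g = len x.
Proof. by rewrite /len val_inv size_rev size_map. Qed.

Lemma winv_cat v w : winv (v ++ w) = winv w ++ winv v.
Proof. by rewrite /winv map_cat rev_cat. Qed.

Lemma size_consred (a : letter G) w : size (consred a w) <= (size w).+1.
Proof. by rewrite /consred; case: ifP. Qed.

Lemma size_lmul (a : letter G) w : size w <= (size (lmul a w)).+1 /\ size (lmul a w) <= (size w).+1.
Proof.
rewrite /lmul /consred; case: w => [|b w]; first by case: ifP.
by case: eqP => _; case: ifP => _ /=; split; lia.
Qed.

Lemma size_wmul v w : size (wmul v w) <= size v + size w.
Proof.
by elim: v => //= a v IH; have [_] := size_lmul a (wmul v w); lia.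
Qed.

Lemma len_mul x y : len (x * y)%g <= len x + len y.
Proof. exact: size_wmul. Qed.

Lemma wmul_cat v w : reduced (v ++ w) -> wmul v w = v ++ w.
Proof.
elim: v => //= a v IH r; rewrite IH ?lmul_cons //; exact: reduced_cons r.
Qed.

Lemma reduced_catl v w : reduced (v ++ w) -> reduced v.
Proof.
rewrite /reduced all_cat => /andP[/andP[-> _]] /=.
by case: v => //= a v; rewrite cat_path => /andP[].
Qed.

Lemma reduced_catr v w : reduced (v ++ w) -> reduced w.
Proof. by elim: v => //= a v IH /reduced_cons. Qed.

Definition word w (r : reduced w) : Gam := exist _ w r.

Lemma val_cat_mul x y z : val x = val y ++ val z -> x = (y * z)%g.
Proof.
move=> E; apply: val_inj; rewrite val_mul wmul_cat // -E; exact: valP.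
Qed.

Definition cyc_reduced x : bool :=
  if val x is a :: b :: s then tag a != tag (last b s) else false.

Definition letter_elt (a : letter G) : Gam := fp_inj (tagged a).

Lemma val_letter a : nontriv a -> val (letter_elt a) = [:: a].
Proof. by case: a => i g na; rewrite /letter_elt /= /consred na. Qed.

Lemma letter_eltV a : letter_elt (linv a) = (letter_elt a)^-1%g.
Proof.
apply: (mulgI (letter_elt a)); rewrite mulgV -fp_injM /= mulgV.
by apply: val_inj; rewrite /= /consred /nontriv /= eqxx.
Qed.

Lemma len_letter a : len (letter_elt a) <= 1.
Proof. exact: size_consred. Qed.

(** Strip the first and the last letter as long as they lie in the same factor;
    only the last step, where they merge into one letter, loses a letter. *)
Lemma conj_decomp x : exists w c : Gam,
  [/\ x = (w * c * w^-1)%g, 2 * len w + len c <= len x + 1 & (len c <= 1) || cyc_reduced c].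
Proof.
have [n xn] := ubnP (len x); elim: n x xn => // n IH x xn.
have [l1|l1] := leqP (len x) 1.
  by exists 1%g, x; split; rewrite ?l1 // ?mul1g ?invg1 ?mulg1 //= addn1.
have [cx|ncx] := boolP (cyc_reduced x).
  by exists 1%g, x; split; rewrite ?cx ?orbT // ?mul1g ?invg1 ?mulg1 //= addn1.
have [a [b [s [E tE]]]] : exists a b s, val x = [:: a, b & s] /\ tag a = tag (last b s).
  move: l1 ncx; rewrite /len /cyc_reduced.
  by case: (val x) => [|a [|b s]] // _ /negbNE/eqP tE; exists a, b, s.
have := valP x; rewrite E => rx.
have [s' zE] : exists s', b :: s = rcons s' (last b s) by exists (belast b s); rewrite lastI.
set z := last b s in tE zE; rewrite zE -cat1s -cats1 catA in E rx.
have na : nontriv a by case/andP: rx => /andP[].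
have nz : nontriv z by case/andP: rx; rewrite all_cat /= andbT => /andP[_].
have rs' : reduced s' by apply: reduced_catr (reduced_catl rx).
have lx : len x = size s' + 2 by rewrite /len E size_cat /=; lia.
have lrs : len (word rs') = size s' by [].
have xE : x = (letter_elt a * word rs' * letter_elt z)%g.
  have ras : reduced ([:: a] ++ s') := reduced_catl rx.
  rewrite (@val_cat_mul x (word ras) (letter_elt z)) ?val_letter //.
  by rewrite (@val_cat_mul (word ras) (letter_elt a) (word rs')) ?val_letter.
have [az|az] := eqVneq z (linv a).
  have [|w [c [E1 E2 E3]]] := IH (word rs'); first by move: xn; rewrite lx /len /=; lia.
  exists (letter_elt a * w)%g, c; split=> //.
    by rewrite xE az letter_eltV E1 invMg !mulgA.
  by have := len_mul (letter_elt a) w; have := len_letter a; move: E2; rewrite lx lrs; lia.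
have [s0|s0] := posnP (size s').
  move: rx; rewrite (size0nil s0) /= => /andP[_] /=; rewrite andbT /tag_neq tE.
  by rewrite eqxx.
pose za : letter G := Tagged G (tagged z * tagged_as z a)%g.
have nza : nontriv za.
  apply: contra az; rewrite /za /linv; case: (a) (z) tE => [i g] [j h] /= ij.
  move: h; rewrite -ij => h; rewrite tagged_asE => /eqP hg.
  by apply/eqP; congr (Tagged G _); apply/eqP; rewrite eq_mulgV1 invgK hg.
have rc : reduced (s' ++ [:: za]).
  move: (reduced_catr (v := [:: a]) (w := s' ++ [:: z])); rewrite catA => /(_ rx).
  rewrite /reduced !all_cat /= nza => /andP[/and3P[-> _ _]] /=.
  by case: (s') => //= b' s1; rewrite !cat_path /= /tag_neq.
exists (letter_elt a), (word rc); split.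
- rewrite xE (@val_cat_mul (word rc) (word rs') (letter_elt za)) ?val_letter //.
  rewrite -!mulgA; congr (_ * (_ * _))%g; apply: (mulIg (letter_elt a)).
  rewrite -mulgA mulVg mulg1 /za; case: (a) (z) tE => [i g] [j h] /= ij.
  move: h; rewrite -ij => h; rewrite tagged_asE; exact/esym/fp_injM.
- rewrite lx [len (word rc)]/len /= size_cat /=.
  by have := len_letter a; lia.
apply/orP; right; rewrite /cyc_reduced /=; clear zE lrs; case: s' s0 rs' rc rx E lx xE => // b' s1 _ rs' rc rx E lx xE /=.
case: s1 {rs' rc lx xE E} rx => /= [|b2 s2]; rewrite /reduced /= ?last_cat /= => /andP[_].
  by rewrite /tag_neq -tE eq_sym => /and3P[].
by rewrite /tag_neq -tE eq_sym => /andP[].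
Qed.

(** The word is its own reversed inverse, so its first and last letters are
    inverse to each other, and can be stripped until one letter is left. *)
Lemma involution_decomp x : x^-1%g = x -> 0 < len x ->
  exists p a, x = (p * letter_elt a * p^-1)%g /\ 2 * len p + 1 <= len x.
Proof.
have [n xn] := ubnP (len x); elim: n x xn => // n IH x xn xV x0.
have [l1|l1] := leqP (len x) 1.
  case E: (val x) => [|a [|b s]]; move: x0 l1; rewrite /len E // => _ _.
  exists 1%g, a; rewrite mul1g invg1 mulg1; split=> //; apply: val_inj.
  by rewrite val_letter ?E //; have := valP x; rewrite E => /andP[/andP[]].
have [a [b [s E]]] : exists a b s, val x = [:: a, b & s].
  by move: l1; rewrite /len; case: (val x) => [|a [|b s]] // _; exists a, b, s.
have := valP x; have vV := congr1 val xV; rewrite val_inv in vV; rewrite E in vV * => rx.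
have [s' zE] : exists s', b :: s = rcons s' (last b s) by exists (belast b s); rewrite lastI.
set z := last b s in zE; rewrite zE -cat1s -cats1 catA in E rx vV.
have [za sV] : z = linv a /\ winv s' = s'.
  move: vV; rewrite !winv_cat /= => -[_ /eqP].
  by rewrite !cats1 eqseq_rcons => /andP[/eqP-> /eqP<-].
have rs' : reduced s' by apply: reduced_catr (reduced_catl rx).
have na : nontriv a by case/andP: rx => /andP[].
have nz : nontriv z by case/andP: rx; rewrite all_cat /= andbT => /andP[_].
have lx : len x = size s' + 2 by rewrite /len E size_cat /=; lia.
have lrs : len (word rs') = size s' by [].
have xE : x = (letter_elt a * word rs' * letter_elt z)%g.
  have ras : reduced ([:: a] ++ s') := reduced_catl rx.
  rewrite (@val_cat_mul x (word ras) (letter_elt z)) ?val_letter //.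
  by rewrite (@val_cat_mul (word ras) (letter_elt a) (word rs')) ?val_letter.
have [s0|s0] := posnP (size s').
  move: rx; rewrite (size0nil s0) /= => /andP[_] /=; rewrite andbT /tag_neq za.
  by rewrite eqxx.
have [|||p [b' [pE pl]]] := IH (word rs').
- by move: xn; rewrite lx /len /=; lia.
- by apply: val_inj; rewrite val_inv.
- by rewrite /len.
exists (letter_elt a * p)%g, b'; split.
  by rewrite xE za letter_eltV pE invMg !mulgA.
by have := len_mul (letter_elt a) p; have := len_letter a; move: pl; rewrite lx lrs; lia.
Qed.

End Words.

Local Open Scope ring_scope.

(** * Patterns that are less likely than the generic bound *)

(** At most [tau ^ 3] points have a nontrivial stabilizer and at most [tau ^ 2]
    one of order at least three, in the sense of moments up to order [A]. *)
Definition moment_bound (R : realType) (gT : finGroupType) (A : nat) (C : R) : Prop :=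
  0 <= C /\ forall (T : finType) (tau : R), 1 <= tau -> tau ^+ 6 = #|T|%:R ->
  forall a, (a <= A)%N ->
    \sum_(f in homs gT T) #|big_stab 2 f|%:R ^+ a <= C * #|homs gT T|%:R * tau ^+ (3 * a)
    /\ \sum_(f in homs gT T) #|big_stab 2 f|%:R ^+ a * #|big_stab 3 f|%:R
         <= C * #|homs gT T|%:R * tau ^+ (3 * a + 2).

Lemma ex_moment_bound (R : realType) (gT : finGroupType) (A : nat) :
  exists C : R, moment_bound gT A C.
Proof.
have ex (a : nat) : exists C : R, 0 <= C /\
    forall (T : finType) (tau : R), 1 <= tau -> tau ^+ 6 = #|T|%:R ->
    \sum_(f in homs gT T) #|big_stab 2 f|%:R ^+ a <= C * #|homs gT T|%:R * tau ^+ (3 * a)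
    /\ \sum_(f in homs gT T) #|big_stab 2 f|%:R ^+ a * #|big_stab 3 f|%:R
         <= C * #|homs gT T|%:R * tau ^+ (3 * a + 2).
  have [C1 C10 C1P] := @sum_big_stab R gT 2 3 a isT.
  have [C2 C20 C2P] := @sum_big_stab23 R gT a.
  exists (C1 + C2); split; first exact: addr_ge0.
  move=> T tau tau1 tauT; have tau0 : 0 <= tau by apply: le_trans tau1.
  split.
    apply: le_trans (C1P T tau tau1 tauT) _.
    by rewrite !ler_wpM2r ?exprn_ge0 // lerDl.
  apply: le_trans (C2P T tau tau1 tauT) _.
  by rewrite !ler_wpM2r ?exprn_ge0 // lerDr.
have [C CP] := choice ex.
exists (\sum_(a < A.+1) C a); split; first by apply: sumr_ge0 => a _; case: (CP a).
move=> T tau tau1 tauT a aA; have tau0 : 0 <= tau by apply: le_trans tau1.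
have le : C a <= \sum_(a < A.+1) C a.
  rewrite (bigD1 (Ordinal (aA : a < A.+1)%N)) //= lerDl.
  by apply: sumr_ge0 => i _; case: (CP i).
have [_ /(_ T tau tau1 tauT) [h1 h2]] := CP a.
by split; [apply: le_trans h1 _|apply: le_trans h2 _];
  rewrite !ler_wpM2r ?exprn_ge0.
Qed.

Section Good.
Variables (R : realType) (gT : finGroupType) (T J : finType) (nx : J -> J).
Variable e : J -> option gT.
Hypothesis e_neq1 : forall j g, e j = Some g -> g != 1%g.
Variable x : J -> T.

Local Notation realizes := (realizes nx e).
Local Notation touched := (touched nx e x).
Local Notation linked := (linked nx e x).
Local Notation comp_root := (comp_root nx e x).
Local Notation comp := (comp nx e x).
Local Notation loop_roots := (loop_roots nx e x).
Local Notation allowed := (allowed nx e x).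

Definition meets (j k : J) : bool :=
  [|| x j == x k, x j == x (nx k), x (nx j) == x k | x (nx j) == x (nx k)].

(** No component gives a gain: two edges that meet are the same labelled edge,
    up to orientation, and loops are labelled by involutions. *)
Definition good : bool :=
  [forall j, forall k, if (e j, e k) is (Some g, Some h) then
     meets j k ==> ([&& x j == x k, x (nx j) == x (nx k) & g == h]
       || [&& x j == x (nx k), x (nx j) == x k & g == h^-1])%g else true]
  && [forall j, if e j is Some g then (x j == x (nx j)) ==> (g == g^-1)%g else true].

(** A component whose root is constrained more than [card_comp_root] accounts
    for: by one factor [tau] at least. *)
Definition gains (r : T) (B : {ffun gT -> {perm T}} -> {set T}) : Prop :=
  [/\ r \in comp_root,
    forall f (s : {perm T}), f \in homs gT T -> realizes f (s \o x) -> s r \in B f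
  & [\/ (3 <= #|comp r|)%N /\ B = (fun=> [set: T]),
        (2 <= #|comp r|)%N /\ B = big_stab 2
      | #|comp r| = 1%N /\ B = big_stab 3]].

(** Two nontrivial elements fixing a point force a stabilizer of order three; on
    a component with several points, a nontrivial stabilizer is already a gain. *)
Lemma gains3 v : v \in touched ->
  (forall f (s : {perm T}), f \in homs gT T -> realizes f (s \o x) -> s v \in big_stab 3 f) ->
  exists r B, gains r B.
Proof.
move=> vS vP; have rC := root_comp_root vS; set r := root linked v in rC.
have rP f (s : {perm T}) : f \in homs gT T -> realizes f (s \o x) -> s r \in big_stab 3 f.
  move=> fH sf; have := vP f s fH sf; rewrite !inE => /leq_trans; apply.
  by rewrite (card_stab_linked fH sf (connect_root linked v)).
have [c1|c1] := eqVneq #|comp r| 1%N.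
  by exists r, (big_stab 3); split=> //; apply: Or33.
exists r, (big_stab 2); split=> //.
  by move=> f s fH /(rP f s fH); rewrite !inE => /ltnW.
by apply: Or32; split=> //; rewrite ltn_neqAle eq_sym c1 comp_gt0.
Qed.

Lemma comp_card_ge (D : {set T}) v : (forall u, u \in D -> connect linked v u) ->
  (#|D| <= #|comp (root linked v)|)%N.
Proof.
move=> vD; apply/subset_leq_card/subsetP=> u /vD vu.
by rewrite inE eq_sym root_connect //; apply: linked_sym.
Qed.

Lemma gains2 v : v \in touched -> (2 <= #|comp (root linked v)|)%N ->
  (forall f (s : {perm T}), f \in homs gT T -> realizes f (s \o x) -> s v \in big_stab 2 f) ->
  exists r B, gains r B.
Proof.
move=> vS v2 vP; have rC := root_comp_root vS; set r := root linked v in rC v2.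
exists r, (big_stab 2); split=> //; last by apply: Or32.
move=> f s fH sf; have := vP f s fH sf; rewrite !inE => /leq_trans; apply.
by rewrite (card_stab_linked fH sf (connect_root linked v)).
Qed.

Lemma gains_size v : v \in touched -> (3 <= #|comp (root linked v)|)%N ->
  exists r B, gains r B.
Proof.
move=> vS v3; exists (root linked v), (fun=> [set: T]); split.
- exact: root_comp_root.
- by move=> *; rewrite in_setT.
- by apply: Or31.
Qed.

(** If two steps that meet are different, then either they touch three points of
    one component, or comparing their labels gives a nontrivial element that
    fixes a point of a component of size two, or two such elements fixing the
    same point. *)
Lemma not_good_gains : ~~ good -> exists r B, gains r B.
Proof.
have pair j g : e j = Some g -> x j != x (nx j) ->
    (2 <= #|comp (root linked (x j))|)%N.
  move=> ej d; apply: leq_trans (comp_card_ge (D := [set x j; x (nx j)]) _).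
    by rewrite cards2 d.
  by move=> u; rewrite !inE => /orP[]/eqP->; [apply: connect0|apply: linked_edge ej].
have three v a b c : v \in touched -> connect linked v a -> connect linked v b ->
    connect linked v c -> a != b -> a != c -> b != c -> exists r B, gains r B.
  move=> vS va vb vc ab ac bc; apply: (gains_size vS).
  apply: leq_trans (comp_card_ge (D := [set a] :|: [set b; c]) _).
    by rewrite cardsU1 cards2 bc !inE negb_or ab ac.
  by move=> u; rewrite !inE => /orP[|/orP[]]/eqP->.
rewrite negb_and => /orP[]; last first.
  case/forallPn=> j; case ej: (e j) => [g|] //.
  rewrite negb_imply => /andP[/eqP l gN]; apply: (gains3 (touched_l nx x ej)).
  move=> f s fH sf; have := realizesP sf ej; rewrite /= -l => gl.
  have g1 := e_neq1 ej.
  apply: (stab_gt2 (g := g) (h := g^-1%g)) => //; first by rewrite invg_eq1.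
  by rewrite -[in LHS]gl homsK.
case/forallPn=> j /forallPn[k]; case ej: (e j) => [g|] //; case ek: (e k) => [h|] //.
rewrite negb_imply negb_or => /andP[jk /andP[N1 N2]].
have g1 := e_neq1 ej; have h1 := e_neq1 ek.
have jS := touched_l nx x ej; have kS := touched_l nx x ek.
have lj := linked_edge nx x ej; have lk := linked_edge nx x ek.
have lk' : connect linked (x (nx k)) (x k) by rewrite linked_sym.
have lj' : connect linked (x (nx j)) (x j) by rewrite linked_sym.
have l1 : connect linked (x j) (x k).
  case/or4P: jk => /eqP E.
  - by rewrite E connect0.
  - by rewrite E.
  - by rewrite -E.
  - by apply: connect_trans lj _; rewrite E.
have l2 := connect_trans l1 lk.
have [a_b|a_b] := eqVneq (x j) (x (nx j)).
  have [c_d|c_d] := eqVneq (x k) (x (nx k)).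
    have a_c : x j = x k by move: jk; rewrite /meets -a_b -c_d !orbb => /eqP.
    apply: (gains3 jS) => f s fH sf.
    have := realizesP sf ej; rewrite /= -a_b => E1.
    have := realizesP sf ek; rewrite /= -c_d -a_c => E2.
    apply: (stab_gt2 (g := g) (h := h)) => //.
    by move: N1; rewrite -a_b -c_d a_c eqxx.
  apply: (gains2 kS (pair _ _ ek c_d)) => f s fH sf.
  have : s (x j) \in big_stab 2 f.
    apply: (stab_gt1 fH g1); have := realizesP sf ej; by rewrite /= -a_b.
  by rewrite !inE (card_stab_linked fH sf l1).
have [c_d|c_d] := eqVneq (x k) (x (nx k)).
  apply: (gains2 jS (pair _ _ ej a_b)) => f s fH sf.
  have : s (x k) \in big_stab 2 f.
    apply: (stab_gt1 fH h1); have := realizesP sf ek; by rewrite /= -c_d.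
  by rewrite !inE (card_stab_linked fH sf l1).
have [a_c|a_c] := eqVneq (x j) (x k).
  have [b_d|b_d] := eqVneq (x (nx j)) (x (nx k)); last first.
    by apply: (three _ _ _ _ jS (connect0 _ _) lj l2) => //; rewrite a_c.
  apply: (gains2 jS (pair _ _ ej a_b)) => f s fH sf.
  have := realizesP sf ej; have := realizesP sf ek => /= E2 E1.
  apply: (stab_gt1 (g := (g * h^-1)%g)) => //.
    by move: N1; rewrite a_c b_d !eqxx /=; apply: contra => /eqP gh; rewrite -(invgK h) -(mulg1_eq gh) invgK.
  by rewrite homsM // E1 b_d -E2 homsK // a_c.
have [b_c|b_c] := eqVneq (x (nx j)) (x k); last first.
  by apply: (three _ _ _ _ jS (connect0 _ _) lj l1).
have [a_d|a_d] := eqVneq (x j) (x (nx k)); last first.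
  by apply: (three _ _ _ _ jS (connect0 _ _) lj l2); rewrite // b_c.
apply: (gains2 jS (pair _ _ ej a_b)) => f s fH sf.
have := realizesP sf ej; have := realizesP sf ek => /= E2 E1.
apply: (stab_gt1 (g := (g * h)%g)) => //.
  by move: N2; rewrite a_d b_c !eqxx /=; apply: contra => /eqP gh; rewrite -(mulg1_eq gh) invgK.
by rewrite homsM // E1 b_c E2 a_d.
Qed.

End Good.

Section RealColour.
Variables (R : realType) (gT : finGroupType) (T J : finType) (nx : J -> J).
Variable e : J -> option gT.
Hypothesis e_neq1 : forall j g, e j = Some g -> g != 1%g.
Variables (x : J -> T) (tau : R).
Hypotheses (tau1 : 1 <= tau) (tauT : tau ^+ 6 = #|T|%:R).

Local Notation V := #|touched nx e x|.
Local Notation count := #|[set f in homs gT T | realizes nx e f x]|.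

(** The pattern has probability [O(#|T| ^ (- V / 2))]. *)
Lemma colour_bound (A : nat) (C : R) : moment_bound gT A C ->
  (#|loop_roots nx e x| <= A)%N ->
  count%:R * (#|T| ^_ V)%:R <= C * #|homs gT T|%:R * tau ^+ (3 * V).
Proof.
move=> [C0 CP] loopA; have tau0 : 0 <= tau by apply: le_trans tau1.
have le := @card_realizes_le _ _ _ nx e x (allowed nx e x)
  (fun f s r fH sf => allowedP e_neq1 fH sf).
rewrite -natrM; apply: (@le_trans _ _ _%:R); first by rewrite ler_nat; apply: le.
set cr := comp_root nx e x; set lr := loop_roots nx e x.
have crl : cr :&: lr = lr.
  by apply/setIidPr/subsetP=> r; rewrite inE => /andP[].
have := @card_comp_root _ _ _ nx e x cr (subxx _); rewrite crl -/lr sum_card_comp => VE.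
under eq_bigr do rewrite (@prod_allowed _ _ _ nx e x _ cr (subxx _)) crl.
rewrite -big_distrl /= natrM natr_sum natrX -tauT -exprM.
have [+ _] := CP T tau tau1 tauT _ loopA => h1.
apply: (@le_trans _ _ (C * #|homs gT T|%:R * tau ^+ (3 * #|lr|) *
    tau ^+ (6 * #|cr :\: lr|))).
  rewrite ler_wpM2r ?exprn_ge0 //; apply: le_trans h1.
  by rewrite le_eqVlt; apply/orP; left; apply/eqP/eq_bigr => f _; rewrite natrX.
rewrite -[leLHS]mulrA -exprD ler_wpM2l ?mulr_ge0 //.
by apply: ler_weXn2l => //; move: VE; lia.
Qed.

(** A pattern that is not good is less likely by a factor [tau]. *)
Lemma colour_bound_not_good (C : R) : moment_bound gT (2 * #|J|) C ->
  ~~ good nx e x ->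
  tau * (count%:R * (#|T| ^_ V)%:R) <= C * #|homs gT T|%:R * tau ^+ (3 * V).
Proof.
move=> [C0 CP] /(not_good_gains e_neq1)[r0 [B [rC BP Bcase]]].
have tau0 : 0 <= tau by apply: le_trans tau1.
set cr := comp_root nx e x; set lr := loop_roots nx e x; rewrite -/cr in rC.
pose A f r := if r == r0 then B f else allowed nx e x f r.
have AP f (s : {perm T}) r : f \in homs gT T -> realizes nx e f (s \o x) -> r \in cr ->
    s r \in A f r.
  move=> fH sf rr; rewrite /A; case: eqP => [->|_]; first exact: BP.
  exact: (allowedP e_neq1 fH sf rr).
have le := card_realizes_le AP.
apply: (@le_trans _ _ (tau * \sum_(f in homs gT T) (\prod_(r in cr) #|A f r|)%:R)).
  by rewrite ler_wpM2l // -natrM -natr_sum ler_nat; apply: le.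
(* all components but the gaining one are estimated as in [colour_bound] *)
pose D := cr :\ r0; have Dcr : D \subset cr by apply: subsetDl.
set a := #|D :&: lr|; set b := #|D :\: lr|.
have := @card_comp_root _ _ _ nx e x D Dcr; rewrite -/a -/b => VE.
have VE' : (\sum_(r in D) #|comp nx e x r| + #|comp nx e x r0| = V)%N.
  rewrite -sum_card_comp [RHS](bigD1 r0) //= addnC; congr (_ + _)%N.
  by apply: eq_bigl => r; rewrite !inE andbC.
have aJ : (a < 2 * #|J|)%N.
  have VJ : (V <= 2 * #|J|)%N.
    apply: (@leq_trans #|[set x j | j : J] :|: [set x (nx j) | j : J]|).
      apply/subset_leq_card/subsetP=> t /touchedP[j [g [_ [->|->]]]];
        rewrite inE; apply/orP; [left|right]; apply/imsetP; by exists j.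
    apply: (leq_trans (leq_card_setU _ _)); rewrite mul2n -addnn.
    by apply: leq_add; apply: (leq_trans (leq_imset_card _ _)); rewrite cardT.
  by have := comp_gt0 rC; move: VE VE' VJ; lia.
have prodE f : (\prod_(r in cr) #|A f r|)%:R
    = #|big_stab 2 f|%:R ^+ a * #|B f|%:R * tau ^+ (6 * b) :> R.
  rewrite (bigD1 r0) //= {1}/A eqxx.
  have -> : \prod_(i in cr | i != r0) #|A f i| = \prod_(i in D) #|allowed nx e x f i|.
    apply: eq_big => [r|r]; first by rewrite !inE andbC.
    by case/andP=> _ /negPf r0N; rewrite /A r0N.
  rewrite prod_allowed // !natrM !natrX -tauT -exprM; ring.
under eq_bigr do rewrite prodE.
rewrite -mulr_suml.
have conc k (S : R) : S <= C * #|homs gT T|%:R * tau ^+ k ->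
    (k + 6 * b + 1 <= 3 * V)%N ->
    tau * (S * tau ^+ (6 * b)) <= C * #|homs gT T|%:R * tau ^+ (3 * V).
  move=> Sk kV; apply: (@le_trans _ _ (tau * (C * #|homs gT T|%:R * tau ^+ k * tau ^+ (6 * b)))).
    by rewrite ler_wpM2l // ler_wpM2r ?exprn_ge0.
  rewrite mulrC -[leLHS]mulrA -[leLHS]mulrA -exprSr -exprD ler_wpM2l ?mulr_ge0 //.
  by apply: ler_weXn2l => //; move: kV; lia.
case: Bcase => -[cc BE].
- apply: (conc (3 * a + 6)%N); last by move: VE VE' cc; lia.
  rewrite (eq_bigr (fun f => #|big_stab 2 f|%:R ^+ a * tau ^+ 6)); last first.
    by move=> f _; rewrite BE cardsT tauT.
  have [h1 _] := CP T tau tau1 tauT a (ltnW aJ).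
  by rewrite -mulr_suml exprD mulrA ler_wpM2r ?exprn_ge0.
- apply: (conc (3 * a.+1)%N); last by move: VE VE' cc; lia.
  rewrite (eq_bigr (fun f => #|big_stab 2 f|%:R ^+ a.+1)); last first.
    by move=> f _; rewrite BE exprSr.
  by have [h1 _] := CP T tau tau1 tauT a.+1 aJ.
apply: (conc (3 * a + 2)%N); last by move: VE VE' cc; lia.
rewrite (eq_bigr (fun f => #|big_stab 2 f|%:R ^+ a * #|big_stab 3 f|%:R)); last first.
  by move=> f _; rewrite BE.
by have [_ h1] := CP T tau tau1 tauT a (ltnW aJ).
Qed.

End RealColour.

(** * Sums over patterns *)

Lemma ffact_lb (R : realType) (N v : nat) : (0 < N)%N ->
  N%:R ^+ v * (1 - (v ^ 2)%:R / N%:R) <= (N ^_ v)%:R :> R.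
Proof.
move=> N0; have N0R : 0 < N%:R :> R by rewrite ltr0n.
elim: v => [|v IH]; first by rewrite expr0 mul1r mul0r subr0.
have [vN|Nv] := leqP N v.
  apply: (@le_trans _ _ 0) => //.
  rewrite mulr_ge0_le0 ?exprn_ge0 // subr_le0 ler_pdivlMr // mul1r ler_nat.
  by apply: (leq_trans vN); rewrite -[v in (v <= _)%N]expn1; nia.
rewrite ffactnSr natrM natrB; last exact: ltnW.
apply: (@le_trans _ _ (N%:R ^+ v * (1 - (v ^ 2)%:R / N%:R) * (N%:R - v%:R))); last first.
  by rewrite ler_wpM2r // subr_ge0 ler_nat ltnW.
have -> : N%:R ^+ v * (1 - (v ^ 2)%:R / N%:R) * (N%:R - v%:R) =
    N%:R ^+ v.+1 * ((1 - (v ^ 2)%:R / N%:R) * (1 - v%:R / N%:R)) :> R.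
  by rewrite exprSr; field; rewrite gt_eqF.
apply: ler_wpM2l; first by rewrite exprn_ge0.
have -> : (v.+1 ^ 2)%:R = (v ^ 2)%:R + v%:R + v%:R + 1 :> R.
  have -> : (v.+1 ^ 2 = v ^ 2 + v + v + 1)%N by rewrite !expnS !expn0; lia.
  by rewrite !natrD.
have p1 : 0 <= v%:R / N%:R :> R by rewrite divr_ge0.
have p2 : 0 <= (v ^ 2)%:R / N%:R :> R by rewrite divr_ge0.
have p3 : 0 <= 1 / N%:R :> R by rewrite divr_ge0.
rewrite !mulrDl; nra.
Qed.

Section Kernels.
Variables (R : realType) (J T : finType).
Implicit Types x : {ffun J -> T}.

Definition kernel x : {ffun J * J -> bool} := [ffun p => x p.1 == x p.2].

Definition points x : {set T} := [set x j | j : J].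

Lemma kernelP x y j k : kernel x = kernel y -> (x j == x k) = (y j == y k).
Proof. by move=> /ffunP/(_ (j, k)); rewrite !ffunE. Qed.

Lemma card_points_kernel x y : kernel x = kernel y -> #|points x| = #|points y|.
Proof.
move=> xy; wlog suff le : x y xy / (#|points x| <= #|points y|)%N.
  by apply/eqP; rewrite eqn_leq !le.
have [p Pp] : exists p : T -> T, forall j, p (y j) = x j.
  exists (fun t => if [pick j | y j == t] is Some j then x j else t) => j.
  by case: pickP => [k /eqP|/(_ j)]; rewrite ?eqxx // => /eqP; rewrite -(kernelP _ _ xy) => /eqP.
apply: leq_trans (leq_imset_card p _).
apply/subset_leq_card/subsetP=> _ /imsetP[j _ ->].
by rewrite -Pp; apply/imsetP; exists (y j); rewrite // imset_f.
Qed.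

(** A map with a given coincidence pattern is determined by its values on one
    index in each block. *)
Lemma card_kernel y : (#|[set x | kernel x == kernel y]| <= #|T| ^ #|points y|)%N.
Proof.
pose r t := [pick j | y j == t]; pose D := [set j | r (y j) == Some j].
have DP : #|D| = #|points y|.
  rewrite -(card_in_imset (f := y) (D := mem D)); last first.
    by move=> j k; rewrite !inE => /eqP rj /eqP rk e; move: rj; rewrite e rk => -[].
  apply: eq_card => t; apply/imsetP/imsetP => -[j _ ->]; first by exists j.
  rewrite /r; case E : (r (y j)) => [k|]; last first.
    by move: E; rewrite /r; case: pickP => // /(_ j); rewrite eqxx.
  have yk : y k = y j by move: E; rewrite /r; case: pickP => // k' /eqP + [<-].
  by exists k => //; rewrite inE yk E.
pose F := [set h : {ffun J -> T} | h \in family (fun j =>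
  if j \in D then mem predT else mem (pred1 (y j)))].
have <- : #|F| = (#|T| ^ #|points y|)%N.
  rewrite cardsE card_family foldrE big_image /= -DP -prod_nat_const [RHS]big_mkcond /=.
  by apply: eq_bigr => j _; case: ifP; rewrite ?card1.
pose f x := [ffun j => if j \in D then x j else y j].
rewrite -(card_in_imset (f := f)).
  apply/subset_leq_card/subsetP=> _ /imsetP[x _ ->]; rewrite inE.
  by apply/familyP=> j; rewrite ffunE; case: ifP; rewrite ?inE.
move=> x x'; rewrite !inE => /eqP xy /eqP xy' /ffunP E; apply/ffunP=> j.
case rj : (r (y j)) => [k|]; last first.
  by move: rj; rewrite /r; case: pickP => // /(_ j); rewrite eqxx.
have yk : y k = y j by move: rj; rewrite /r; case: pickP => // k' /eqP + [<-].
have kD : k \in D by rewrite inE yk rj.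
have := E k; rewrite !ffunE kD => xk.
have /eqP <- : x k == x j by rewrite (kernelP _ _ xy) yk.
by rewrite xk; apply/eqP; rewrite (kernelP _ _ xy') yk.
Qed.

(** Summing [#|T|] to the power minus the number of visited points amounts to
    counting the coincidence patterns. *)
Lemma sum_points_le (P : pred {ffun J -> T}) : (0 < #|T|)%N ->
  \sum_(x | P x) (#|T|%:R ^+ #|points x|)^-1
     <= #|[set kernel x | x in P]|%:R :> R.
Proof.
move=> T0; have T0R : 0 < #|T|%:R :> R by rewrite ltr0n.
rewrite (partition_big_imset kernel) /= -[leRHS]sumr_const; apply: ler_sum => k /imsetP[y Py ->].
apply: (@le_trans _ _ (\sum_(x | kernel x == kernel y) (#|T|%:R ^+ #|points y|)^-1)).
  rewrite [leLHS]big_mkcondl /=; apply: ler_sum => x /eqP xy; rewrite (card_points_kernel xy).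
  by case: ifP => // _; rewrite invr_ge0 exprn_ge0.
rewrite sumr_const -[leLHS]mulr_natl ler_pdivrMr ?exprn_gt0 // mul1r -natrX ler_nat.
by rewrite -cardsE card_kernel.
Qed.

End Kernels.

(** * Symmetries of closed walks along a cyclic word *)

Lemma Zp_subgroup_dvd (L : nat) (R : {set 'I_L.+2}) :
  0 \in R -> (forall a b, a \in R -> b \in R -> a - b \in R) ->
  exists r : nat, [/\ (0 < r)%N, (r %| L.+2)%N & forall d, (d \in R) = (r %| d)%N].
Proof.
move=> R0 RB; have RN a : a \in R -> - a \in R by move=> aR; rewrite -sub0r RB.
have RD a b : a \in R -> b \in R -> a + b \in R.
  by move=> aR bR; rewrite -[b]opprK RB // RN.
have RM a k : a \in R -> a *+ k \in R.
  by move=> aR; elim: k => [|k IH]; rewrite ?mulr0n // mulrS RD.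
have L0 : (L.+2%:R : 'I_L.+2) = 0 by apply: (@pchar_Zp L.+2).
have exr : exists r, (0 < r)%N && (r%:R \in R) by exists L.+2; rewrite L0 R0.
have [r /andP[r0 rR] rmin] := ex_minnP exr.
have dv d : (d%:R \in R) = (r %| d)%N.
  apply/idP/idP => [dR|/dvdnP[k ->]]; last by rewrite mulnC natrM mulr_natr RM.
  have mR : (d %% r)%:R \in R.
    have -> : (d %% r)%:R = d%:R - r%:R *+ (d %/ r) :> 'I_L.+2.
      by rewrite {2}(divn_eq d r) natrD natrM [_%:R * _]mulrC mulr_natr addrC addKr.
    by rewrite RB // RM.
  rewrite /dvdn; apply/negPn/negP; rewrite -lt0n => m0.
  have := rmin (d %% r)%N; rewrite m0 mR => /(_ isT); by rewrite leqNgt ltn_pmod.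
exists r; split=> // [|d]; first by rewrite -dv L0.
by rewrite -{1}(natr_Zp d) dv.
Qed.

Section CyclicWord.
Variables (m : nat) (G : 'I_m -> finGroupType) (L : nat).
Variable c : 'I_L.+2 -> letter G.
Hypothesis c_nontriv : forall j, nontriv (c j).
Hypothesis c_tag : forall j, tag (c j) != tag (c (j + 1)).

Definition nxt (j : 'I_L.+2) : 'I_L.+2 := j + 1.

(** The steps of the walk labelled by the factor [i] form one pattern. *)
Definition label i (j : 'I_L.+2) : option (G i) := [pick g : G i | c j == Tagged G g].

Lemma labelP i j g : label i j = Some g <-> c j = Tagged G g.
Proof.
rewrite /label; split; first by case: pickP => // h /eqP E [<-].
move=> E; case: pickP => [h|/(_ g)]; last by rewrite E eqxx.
by rewrite E => /eqP e; rewrite (eq_from_Tagged e).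
Qed.

Lemma label_tag j : label (tag (c j)) j = Some (tagged (c j)).
Proof. by apply/labelP; case: (c j). Qed.

Lemma label_some i j : tag (c j) = i -> exists g, label i j = Some g.
Proof. by move=> <-; exists (tagged (c j)); apply: label_tag. Qed.

Lemma label_neq1 i j g : label i j = Some g -> g != 1%g.
Proof. by move/labelP => E; have := c_nontriv j; rewrite E. Qed.

Lemma label_tagE i j g : label i j = Some g -> tag (c j) = i.
Proof. by move/labelP => ->. Qed.

Section Walk.
Variables (T : finType) (x : 'I_L.+2 -> T).

(** All visits of a point enter and leave it through the same two factors. *)
Definition two_colours : bool :=
  [forall j, forall k, (x j == x k) ==>
    ((tag (c k) \in [:: tag (c (j - 1)); tag (c j)]) &&
     (tag (c (k - 1)) \in [:: tag (c (j - 1)); tag (c j)]))].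

Definition good_walk : bool := [forall i, good nxt (label i) x] && two_colours.

Hypothesis gw : good_walk.

Lemma good_edges j k : tag (c j) = tag (c k) -> meets nxt x j k ->
  [\/ [/\ x j = x k, x (nxt j) = x (nxt k) & c j = c k]
    | [/\ x j = x (nxt k), x (nxt j) = x k & c j = linv (c k)]].
Proof.
move=> tjk jk; have /andP[/forallP/(_ (tag (c j))) + _] := gw.
move=> /andP[/forallP/(_ j)/forallP/(_ k) + _].
rewrite label_tag; have [h lk] := label_some (esym tjk); rewrite lk.
have ck := (labelP _ _).1 lk.
rewrite jk /= => /orP[] /and3P[/eqP e1 /eqP e2 /eqP e3]; [left|right]; split=> //.
  by rewrite ck -e3; case: (c j).
by rewrite ck /linv /= -e3; case: (c j).
Qed.

Lemma good_loop j : x j = x (nxt j) -> c j = linv (c j).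
Proof.
move=> l; have /andP[/forallP/(_ (tag (c j))) + _] := gw.
move=> /andP[_ /forallP/(_ j)]; rewrite label_tag l eqxx /= => /eqP e.
by rewrite /linv -e; case: (c j).
Qed.

Lemma tag_prev j : tag (c (j - 1)) != tag (c j).
Proof. by have := c_tag (j - 1); rewrite subrK. Qed.

Lemma colours_eq j k : x j = x k ->
  (tag (c j) = tag (c k) /\ tag (c (j - 1)) = tag (c (k - 1)))
  \/ (tag (c j) = tag (c (k - 1)) /\ tag (c (j - 1)) = tag (c k)).
Proof.
move=> jk; have /andP[_ /forallP/(_ j)/forallP/(_ k)] := gw.
rewrite jk eqxx /= !inE => /andP[]; have := tag_prev j; have := tag_prev k.
by move=> nk nj /orP[]/eqP e1 /orP[]/eqP e2; move: nk nj; rewrite e1 e2 ?eqxx // => _ _;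
  [right|left].
Qed.

(** The walk together with its labels is invariant under the rotation by [d];
    [ref_sym s] is invariance under the reflection [t |-> s - t], which reverses
    steps and therefore inverts labels. *)
Definition rot_sym d : bool := [forall t, (x t == x (t + d)) && (c t == c (t + d))].
Definition ref_sym s : bool :=
  [forall t, (x t == x (s - t)) && (c t == linv (c (s - 1 - t)))].

(** At two visits of one point that leave by the same factor, the outgoing steps
    meet, hence coincide; and so the next visits are again of this form. *)
Lemma rot_step j k : x j = x k -> tag (c j) = tag (c k) ->
  [/\ x (j + 1) = x (k + 1), c j = c k & tag (c (j + 1)) = tag (c (k + 1))].
Proof.
move=> jk tjk; have [] := good_edges tjk; first by rewrite /meets jk eqxx.
  move=> [_ e2 e3]; split=> //.
  have [[//]|[t1 t2]] := colours_eq e2.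
  rewrite -/(nxt j) -/(nxt k) t1 /nxt addrK; move: t2; rewrite /nxt addrK => t2.
  by move: (c_tag k); rewrite -t2 tjk eqxx.
move=> [e1 e2 e3].
have lk : x k = x (nxt k) by rewrite -e1.
have ek := good_loop lk.
have e2' : x (nxt j) = x (nxt k) by rewrite e2 lk.
split=> //; first by rewrite e3 -ek.
have [[//]|[t1 t2]] := colours_eq e2'.
move: t2; rewrite /nxt addrK => t2.
by move: (c_tag k); rewrite -t2 tjk eqxx.
Qed.

(** When one visit leaves by the factor through which the other one arrives, the
    two steps are opposite to each other. *)
Lemma ref_step j k : x j = x k -> tag (c j) = tag (c (k - 1)) ->
  [/\ x (j + 1) = x (k - 1), c j = linv (c (k - 1)) &
      tag (c (j + 1)) = tag (c (k - 1 - 1))].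
Proof.
move=> jk tjk.
have [] := good_edges tjk; first by rewrite /meets /nxt subrK jk eqxx !orbT.
  rewrite /nxt subrK => -[e1 e2 e3].
  have lk : x (k - 1) = x (nxt (k - 1)) by rewrite /nxt subrK -e1.
  have e : x (j + 1) = x (k - 1) by rewrite e2 -jk.
  split=> //; first by rewrite e3; apply: good_loop.
  have [[t1 t2]|[//]] := colours_eq e.
  by move: (c_tag j); rewrite t1 -tjk eqxx.
rewrite /nxt subrK => -[e1 e2 e3]; split=> //.
have [[t1 t2]|[//]] := colours_eq e2.
by move: (c_tag j); rewrite t1 -tjk eqxx.
Qed.

(** Two visits of the same point propagate to a symmetry of the whole walk. *)
Lemma good_walk_sym j k : x j = x k -> rot_sym (k - j) || ref_sym (j + k).
Proof.
move=> jk; apply/orP; case: (colours_eq jk) => -[t1 t2]; [left|right].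
  have it t : [/\ x (j + t%:R) = x (k + t%:R), c (j + t%:R) = c (k + t%:R)
                & tag (c (j + t%:R)) = tag (c (k + t%:R))].
    elim: t => [|t [e1 _ e3]]; first by rewrite !addr0; have [] := rot_step jk t1.
    have [f1 _ f3] := rot_step e1 e3.
    rewrite -natr1 !addrA; have [] := rot_step f1 f3; by split.
  apply/forallP=> t; have [] := it (val (t - j)); rewrite natr_Zp.
  by rewrite !(addrC _ (t - j)) subrK -addrA (addrC (- j)) => -> -> _; rewrite !eqxx.
have it t : [/\ x (j + t%:R) = x (k - t%:R), c (j + t%:R) = linv (c (k - t%:R - 1))
              & tag (c (j + t%:R)) = tag (c (k - t%:R - 1))].
  elim: t => [|t [e1 _ e3]]; first by rewrite !addr0 subr0; have [] := ref_step jk t1.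
  have [f1 _ f3] := ref_step e1 e3.
  rewrite -natr1 !addrA opprD !addrA; have [] := ref_step f1 f3; by split.
apply/forallP=> t; have [] := it (val (t - j)); rewrite natr_Zp.
have -> : j + (t - j) = t by rewrite addrC subrK.
have -> : k - (t - j) = j + k - t by ring.
have -> : j + k - 1 - t = j + k - t - 1 by ring.
by move=> -> -> _; rewrite !eqxx.
Qed.

Lemma good_walk_kernel j k : (x j == x k) = rot_sym (k - j) || ref_sym (j + k).
Proof.
apply/eqP/idP => [|/orP[]/forallP/(_ j)/andP[/eqP -> _]]; first exact: good_walk_sym.
  by rewrite addrC subrK.
by rewrite [j + k]addrC addrK.
Qed.

Lemma rot_sym0 : rot_sym 0.
Proof. by apply/forallP=> t; rewrite addr0 !eqxx. Qed.

Lemma rot_symB a b : rot_sym a -> rot_sym b -> rot_sym (a - b).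
Proof.
move=> /forallP ra /forallP rb; apply/forallP=> t.
have /andP[/eqP e1 /eqP e2] := ra (t - b).
have /andP[] := rb (t - b); rewrite subrK => /eqP e3 /eqP e4.
by rewrite -e3 -e4 e1 e2 -addrA [- b + a]addrC !eqxx.
Qed.

Lemma ref_symB r s : ref_sym r -> ref_sym s -> rot_sym (r - s).
Proof.
move=> /forallP hr /forallP hs; apply/forallP=> t.
have /andP[/eqP e1 /eqP e2] := hr (t + (r - s)).
have /andP[/eqP e3 /eqP e4] := hs t.
have E1 : r - (t + (r - s)) = s - t by ring.
have E2 : r - 1 - (t + (r - s)) = s - 1 - t by ring.
by rewrite e3 e4 e1 e2 E1 E2 !eqxx.
Qed.

Lemma ref_rot s d : ref_sym s -> rot_sym d -> ref_sym (s + d).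
Proof.
move=> /forallP hs /forallP hd; apply/forallP=> t.
have /andP[/eqP e1 /eqP e2] := hs t.
have /andP[/eqP e3 _] := hd (s - t).
have /andP[_ /eqP e4] := hd (s - 1 - t).
have E1 : s + d - t = s - t + d by ring.
have E2 : s + d - 1 - t = s - 1 - t + d by ring.
by rewrite E1 E2 -e3 -e4 -e1 -e2 !eqxx.
Qed.

Lemma rot_sym_dvd : exists r : nat,
  [/\ (0 < r)%N, (r %| L.+2)%N & forall d, rot_sym d = (r %| d)%N].
Proof.
have [||r [r0 rL rP]] := @Zp_subgroup_dvd L [set d | rot_sym d].
- by rewrite inE rot_sym0.
- by move=> a b; rewrite !inE; apply: rot_symB.
by exists r; split=> // d; rewrite -rP inE.
Qed.

Lemma loop_ref j : x j = x (nxt j) -> ref_sym (j + (j + 1)).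
Proof.
move=> l; have := good_walk_sym l; rewrite /nxt.
have -> : j + 1 - j = 1 by ring.
case/orP=> // /forallP/(_ j)/andP[_ /eqP E].
by move: (c_tag j); rewrite -E eqxx.
Qed.

(** A loop at [j] is a reflection [j + (j + 1)]; modulo the period [r], the doubles
    of the positions of any two loops agree, which leaves only two positions. *)
Lemma card_loops : (#|[set t | [exists j, (x j == t) && (x (nxt j) == t)]]| <= 2)%N.
Proof.
have [r [r0 rL rP]] := rot_sym_dvd.
rewrite leqNgt; apply/negP => /card_gt2P[a [b [d [[]]]]].
rewrite !inE => /existsP[j /andP[/eqP ja /eqP ja']] /existsP[k /andP[/eqP kb /eqP kb']].
move=> /existsP[l /andP[/eqP ld /eqP ld']] [ab bd da].
have lj : ref_sym (j + (j + 1)) by apply: loop_ref; rewrite ja ja'.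
have lk : ref_sym (k + (k + 1)) by apply: loop_ref; rewrite kb kb'.
have ll : ref_sym (l + (l + 1)) by apply: loop_ref; rewrite ld ld'.
have dist (p q : 'I_L.+2) : x p != x q -> ref_sym (p + (p + 1)) -> ref_sym (q + (q + 1)) ->
   (r %| 2 * (q - p)%R)%N && ~~ (r %| (q - p)%R)%N.
  move=> pq rp rq; rewrite -rP; apply/andP; split; last first.
    by move: pq; rewrite good_walk_kernel negb_or => /andP[].
  have := ref_symB rq rp; rewrite rP.
  have -> : q + (q + 1) - (p + (p + 1)) = (q - p) *+ 2 by ring.
  by rewrite Zp_mulrn /= /dvdn modn_dvdm // mulnC.
have /andP[u1 u2] := dist j k (etrans (congr2 (fun u v => u != v) ja kb) ab) lj lk.
have da' : a != d by rewrite eq_sym.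
have /andP[v1 v2] := dist j l (etrans (congr2 (fun u v => u != v) ja ld) da') lj ll.
have /andP[_ w2] := dist k l (etrans (congr2 (fun u v => u != v) kb ld) bd) lk ll.
case/negP: w2; have -> : l - k = (l - j) - (k - j) by ring.
(* the differences of positions of two loops are odd multiples of [r / 2] *)
have half (p : nat) : (r %| 2 * p)%N -> ~~ (r %| p)%N -> exists q, (p * 2 = r * q.*2.+1)%N.
  move=> /dvdnP[q qE] rN; exists q./2; rewrite mulnC qE mulnC; congr (_ * _)%N.
  rewrite -[LHS]odd_double_half; case: (boolP (odd q)) => [//|/negPf oq].
  case/negP: rN; apply/dvdnP; exists q./2; apply/eqP.
  by rewrite -(eqn_pmul2l (isT : 0 < 2)%N) qE -{1}[q]odd_double_half oq add0n -mul2n mulnA.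
have [p pE] := half _ u1 u2; have [q qE] := half _ v1 v2.
move: (k - j) (l - j) pE qE {u1 u2 v1 v2} => A B AE BE.
have -> : nat_of_ord (B - A) = ((B + (L.+2 - A)) %% L.+2)%N by rewrite /= modnDmr.
rewrite /dvdn modn_dvdm // -/(dvdn _ _).
have [s sE] := dvdnP rL; have AL := ltn_ord A.
have {}AE : (A * 2 = (r * p) * 2 + r)%N by rewrite AE; lia.
have {}BE : (B * 2 = (r * q) * 2 + r)%N by rewrite BE; lia.
have E : (B + (L.+2 - A) + r * p = r * q + s * r)%N by rewrite -sE; lia.
have dv : (r %| r * p)%N by rewrite dvdn_mulr.
by rewrite -(dvdn_addl _ dv) E; apply: dvdn_add; [apply: dvdn_mulr|apply: dvdn_mull].
Qed.

(** The coincidence pattern of a walk whose rotations are the multiples of [p.1]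
    and whose reflections, if any, are the translates of [p.2] by them: there
    are only quadratically many. *)
Definition sym_kernel (p : 'I_L.+3 * option 'I_L.+2) : {ffun 'I_L.+2 * 'I_L.+2 -> bool} :=
  [ffun jk : 'I_L.+2 * 'I_L.+2 => (p.1 %| (jk.2 - jk.1)%R)%N ||
     (if p.2 is Some s then (p.1 %| (jk.1 + jk.2 - s)%R)%N else false)].

Lemma good_walk_sym_kernel :
  exists p, forall j k, (x j == x k) = sym_kernel p (j, k).
Proof.
have [r [r0 rL rP]] := rot_sym_dvd.
have rL' : (r < L.+3)%N by rewrite ltnS dvdn_leq.
exists (Ordinal rL', [pick s | ref_sym s]) => j k.
rewrite ffunE good_walk_kernel rP; congr (_ || _).
case: pickP => [s sP|/(_ (j + k))//].
apply/idP/idP => jk; first by have := ref_symB jk sP; rewrite rP.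
have {}jk : rot_sym (j + k - s) by rewrite rP.
by have := ref_rot sP jk; rewrite addrC subrK.
Qed.

End Walk.
End CyclicWord.

(** * Expected number of closed walks *)

(** An action of the free product is a family of actions of the factors. *)
Definition rhoms (m : nat) (G : 'I_m -> finGroupType) (T : finType) :
    {set {dffun forall i, {ffun G i -> {perm T}}}} := setXn (fun i => homs (G i) T).
Arguments rhoms {m} G T.

Section ClosedWalks.
Variables (R : realType) (m : nat) (G : 'I_m -> finGroupType) (L : nat).
Variable c : 'I_L.+2 -> letter G.
Hypothesis c_nontriv : forall j, nontriv (c j).
Hypothesis c_tag : forall j, tag (c j) != tag (c (j + 1)).

Local Notation nxt := (@nxt L).

Section FixT.
Variable T : finType.
Implicit Types (x : {ffun 'I_L.+2 -> T}) (f : {dffun forall i, {ffun G i -> {perm T}}}).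

Definition closed_walk f x : bool :=
  [forall j, f (tag (c j)) (tagged (c j)) (x j) == x (nxt j)].

Local Notation count i x := #|[set f in homs (G i) T | realizes nxt (label c i) f x]|.
Local Notation V i x := #|touched nxt (label c i) x|.

(** The factors act independently. *)
Definition prob x : R := \prod_i ((count i x)%:R / #|homs (G i) T|%:R).

Lemma closed_walkE f x :
  closed_walk f x = [forall i, realizes nxt (label c i) (f i) x].
Proof.
apply/forallP/forallP => [fx i|fx j].
  apply/forallP=> j; case E: (label c i j) => [g|] //.
  by have := fx j; rewrite ((labelP c _ _).1 E).
by have /forallP/(_ j) := fx (tag (c j)); rewrite label_tag.
Qed.

Lemma rhoms_gt0 : (0 < #|rhoms G T|)%N.
Proof. by rewrite cardsXn prodn_gt0 // => i; apply: homs_neq0. Qed.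

Lemma mean_closed_walks :
  (\sum_(f in rhoms G T) #|[set x | closed_walk f x]|)%:R / #|rhoms G T|%:R
  = \sum_x prob x.
Proof.
have -> : (\sum_(f in rhoms G T) #|[set x | closed_walk f x]|)%N
        = (\sum_(x : {ffun 'I_L.+2 -> T}) \prod_i count i x)%N.
  under eq_bigr do rewrite -sum1_card.
  rewrite (exchange_big_dep xpredT) //=; apply: eq_bigr => x _.
  rewrite -cardsXn sum1_card; apply: eq_card => f.
  rewrite -[LHS]/((f \in rhoms G T) && (x \in [set x0 | closed_walk f x0])).
  rewrite [x \in _]inE closed_walkE !in_setXn.
  apply/andP/forallP => [[/forallP fH /forallP fx] i|fP]; first by rewrite inE fH fx.
  by split; apply/forallP=> i; have := fP i; rewrite inE => /andP[].
rewrite natr_sum mulr_suml; apply: eq_bigr => x _.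
by rewrite cardsXn !natr_prod -prodf_div.
Qed.

Lemma touched_points i x : touched nxt (label c i) x \subset points x.
Proof.
by apply/subsetP=> t /touchedP[j [g [_ [->|->]]]]; apply: imset_f.
Qed.

Lemma card_points_le x : (#|points x| <= L.+2)%N.
Proof. by apply: (leq_trans (leq_imset_card _ _)); rewrite cardT size_enum_ord. Qed.

Lemma touched_out x j : x j \in touched nxt (label c (tag (c j))) x.
Proof. exact: touched_l (label_tag c j). Qed.

Lemma touched_in x j : x j \in touched nxt (label c (tag (c (j - 1)))) x.
Proof.
by have := touched_r nxt x (label_tag c (j - 1)); rewrite /nxt subrK.
Qed.

(** A point is touched by the factors through which the walk enters and leaves
    it, which are distinct, and by a third one if [two_colours] fails there. *)
Lemma sum_touched x :
  (2 * #|points x| + (~~ two_colours c x) <= \sum_i V i x)%N.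
Proof.
pose S t := [set i | t \in touched nxt (label c i) x].
have -> : (\sum_i V i x = \sum_(t in points x) #|S t|)%N.
  under eq_bigr do rewrite -sum1_card.
  rewrite (exchange_big_dep (mem (points x))) /=; last first.
    by move=> i t _ /(subsetP (touched_points i x)).
  by apply: eq_bigr => t _; rewrite -sum1_card; apply: eq_bigl => i; rewrite [in RHS]inE.
have S2 j : (2 <= #|S (x j)|)%N.
  apply: (@leq_trans #|[set tag (c (j - 1)); tag (c j)]|).
    by rewrite cards2 (tag_prev c_tag).
  apply/subset_leq_card/subsetP=> i; rewrite [i \in S _]inE !in_set2 => /orP[]/eqP->.
    exact: touched_in.
  exact: touched_out.
case: (boolP (two_colours c x)) => /= [_|].
  rewrite addn0 mulnC -sum_nat_const; apply: leq_sum => t /imsetP[j _ ->]; exact: S2.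
case/forallPn=> j /forallPn[k]; rewrite negb_imply => /andP[/eqP jk].
move=> col3; have [i iS iN] : exists2 i, i \in S (x j) & i \notin [:: tag (c (j - 1)); tag (c j)].
  move: col3; rewrite negb_and => /orP[]; [exists (tag (c k))|exists (tag (c (k - 1)))] => //;
    rewrite [_ \in S _]inE jk; [exact: touched_out|exact: touched_in].
have S3 : (3 <= #|S (x j)|)%N.
  apply: (@leq_trans #|[set i] :|: [set tag (c (j - 1)); tag (c j)]|).
    by rewrite cardsU1 cards2 (tag_prev c_tag) in_set2; move: iN; rewrite !inE => ->.
  apply/subset_leq_card/subsetP=> k'; rewrite in_setU in_set1 in_set2 => /orP[/eqP->//|].
  rewrite [k' \in S _]inE => /orP[]/eqP->.
  - exact: touched_in.
  - exact: touched_out.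
rewrite (bigD1 (x j)) ?imset_f //= addn1 -addn1.
have -> : #|points x| = (1 + \sum_(t in points x | t != x j) 1)%N.
  by rewrite -sum1_card (bigD1 (x j)) ?imset_f.
rewrite mulnDr big_distrr /= -addnA addnC -addnA addnC leq_add //; last first.
  by apply: leq_sum => t /andP[/imsetP[j' _ ->] _]; apply: S2.
Qed.

End FixT.
End ClosedWalks.

(** ** Bounds for good and for other walks *)

Section Mean.
Variables (R : realType) (m : nat) (G : 'I_m -> finGroupType).

Section Bounds.
Variable L : nat.
Variable c : 'I_L.+2 -> letter G.
Hypothesis c_nontriv : forall j, nontriv (c j).
Hypothesis c_tag : forall j, tag (c j) != tag (c (j + 1)).

Local Notation nxt := (@nxt L).

Section FixT.
Variables (T : finType) (tau : R).
Hypotheses (tau1 : 1 <= tau) (tauT : tau ^+ 6 = #|T|%:R).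
Hypothesis T_large : (2 * L.+2 ^ 2 <= #|T|)%N.
Implicit Types (x : {ffun 'I_L.+2 -> T}).

Local Notation count i x := #|[set f in homs (G i) T | realizes nxt (label c i) f x]|.
Local Notation V i x := #|touched nxt (label c i) x|.
Local Notation prob := (@prob R m G L c T).

Let tau_gt0 : 0 < tau. Proof. exact: lt_le_trans tau1. Qed.
Let T_gt0 : (0 < #|T|)%N. Proof. by apply: leq_trans T_large; rewrite muln_gt0 expn_gt0. Qed.

Lemma ffact_half v : (v <= L.+2)%N -> tau ^+ (6 * v) <= 2 * (#|T| ^_ v)%:R.
Proof.
move=> vL; rewrite exprM tauT; have := ffact_lb R v T_gt0.
have NR : 0 < #|T|%:R :> R by rewrite ltr0n.
move=> lb; have h : (v ^ 2)%:R / #|T|%:R <= 2^-1 :> R.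
  rewrite ler_pdivrMr // mulrC ler_pdivlMr // -natrM ler_nat.
  by apply: leq_trans T_large; rewrite mulnC leq_mul2l /= leq_exp2r.
have P : 0 <= #|T|%:R ^+ v :> R by rewrite exprn_ge0.
have := ler_wpM2l P h; move: lb; rewrite mulrBr mulr1.
by set a := _ ^+ v; set b := a * _; lra.
Qed.

(** Falling factorials may be replaced by powers when [T] is large compared with
    the length of the word. *)
Lemma count_le i x (C d : R) : 0 <= C -> 0 < d ->
  d * ((count i x)%:R * (#|T| ^_ (V i x))%:R) <= C * #|homs (G i) T|%:R * tau ^+ (3 * V i x) ->
  (count i x)%:R / #|homs (G i) T|%:R <= 2 * C * (tau ^- (3 * V i x)) / d.
Proof.
move=> C0 d0 le; set v := V i x in le *.
have h0 : 0 < #|homs (G i) T|%:R :> R by rewrite ltr0n homs_neq0.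
have vL : (v <= L.+2)%N.
  exact: leq_trans (subset_leq_card (touched_points _ _ _)) (card_points_le x).
have t0 : 0 < tau ^+ (3 * v) by rewrite exprn_gt0.
have ff := ffact_half vL.
have tE : tau ^+ (6 * v) = tau ^+ (3 * v) * tau ^+ (3 * v) by rewrite -exprD; congr (_ ^+ _); lia.
rewrite ler_pdivrMr //.
have n0 : 0 <= (count i x)%:R * d :> R by rewrite mulr_ge0 // ltW.
have := ler_wpM2l n0 ff; rewrite tE => le2.
have -> : 2 * C * tau ^- (3 * v) / d * #|homs (G i) T|%:R
   = (2 * (C * #|homs (G i) T|%:R * tau ^+ (3 * v))) / (d * (tau ^+ (3 * v) * tau ^+ (3 * v))).
  by field; rewrite !gt_eqF.
rewrite ler_pdivlMr ?mulr_gt0 // [leLHS]mulrA; apply: (le_trans le2).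
have -> (a b : R) : a * d * (2 * b) = 2 * (d * (a * b)) by ring.
by rewrite ler_wpM2l.
Qed.

Lemma ratio_ge0 i x : 0 <= (count i x)%:R / #|homs (G i) T|%:R :> R.
Proof. by rewrite divr_ge0. Qed.

Lemma prod_tau x (D : R) : \prod_i (D * tau ^- (3 * V i x)) =
  D ^+ m * tau ^- (3 * \sum_i V i x).
Proof.
rewrite big_split /= prodr_const card_ord; congr (_ * _).
by rewrite prodfV -expr_sum -big_distrr.
Qed.

Lemma tau_points x k : (k <= 3 * \sum_i V i x)%N -> (6 * #|points x| <= k)%N ->
  tau ^- (3 * \sum_i V i x) <= (#|T|%:R ^+ #|points x|)^-1 / tau ^+ (k - 6 * #|points x|).
Proof.
move=> kV Pk; rewrite -tauT -exprM -invfM -exprD subnKC // lef_pV2 ?posrE ?exprn_gt0 //.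
exact: ler_weXn2l.
Qed.

(** Only two components carry loops, so the constant does not involve the length
    of the word. *)
Lemma prob_good x (C : R) : 0 <= C -> (forall i, moment_bound (G i) 2 C) ->
  good_walk c x -> prob x <= (2 * C) ^+ m * (#|T|%:R ^+ #|points x|)^-1.
Proof.
move=> C0 CP gw; apply: (@le_trans _ _ (\prod_i (2 * C * tau ^- (3 * V i x)))).
  apply: ler_prod => i _; rewrite ratio_ge0 /= -[leRHS]divr1; apply: count_le => //.
  rewrite mul1r; apply: (colour_bound (@label_neq1 _ _ _ _ c_nontriv i) tau1 tauT (CP i)).
  apply: leq_trans (card_loops c_tag gw); apply/subset_leq_card/subsetP=> t.
  rewrite [t \in loop_roots _ _ _]inE => /andP[tC /eqP t1].
  have [j [g [_ xj xj1]]] := singleton_comp tC t1.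
  by rewrite inE; apply/existsP; exists j; rewrite xj xj1 eqxx.
rewrite prod_tau ler_wpM2l ?exprn_ge0 ?mulr_ge0 //.
have := sum_touched c_tag x; have [kV _|] := leqP (6 * #|points x|) (3 * \sum_i V i x).
  by have := tau_points kV (leqnn _); rewrite subnn expr0 divr1.
by lia.
Qed.

(** Either some factor gains by [colour_bound_not_good], or some point is
    touched by three factors, which is worth [#|T| ^ (1/2)]. *)
Lemma prob_not_good x (C : R) : 1 <= C -> (forall i, moment_bound (G i) (2 * L.+2) C) ->
  ~~ good_walk c x -> prob x <= (2 * C) ^+ m * (#|T|%:R ^+ #|points x|)^-1 / tau.
Proof.
move=> C1 CP ngw; have C0 : 0 <= C by apply: le_trans C1.
have D0 : 0 <= (2 * C) ^+ m by rewrite exprn_ge0 // mulr_ge0.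
have q i : (count i x)%:R / #|homs (G i) T|%:R <= 2 * C * tau ^- (3 * V i x).
  rewrite -[leRHS]divr1; apply: count_le => //; rewrite mul1r.
  apply: (colour_bound (@label_neq1 _ _ _ _ c_nontriv i) tau1 tauT (CP i)).
  apply: (@leq_trans (V i x)).
    by apply/subset_leq_card/subsetP=> t; rewrite inE => /andP[]; rewrite inE => /andP[].
  apply: leq_trans (subset_leq_card (touched_points _ _ _)) _.
  by apply: leq_trans (card_points_le x) _; rewrite leq_pmull.
have sT := sum_touched c_tag x.
have [/forallP gi|] := boolP [forall i, good nxt (label c i) x].
  have tc : ~~ two_colours c x by move: ngw; rewrite negb_and => /orP[/negP[]|//]; apply/forallP.
  rewrite tc /= in sT.
  apply: (@le_trans _ _ (\prod_i (2 * C * tau ^- (3 * V i x)))).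
    by apply: ler_prod => i _; rewrite ratio_ge0 /= q.
  rewrite prod_tau -mulrA ler_wpM2l //.
  have aux p S : (2 * p + 1 <= S -> 6 * p + 1 <= 3 * S)%N by lia.
  have k1 : (6 * #|points x| + 1 <= 3 * \sum_i V i x)%N by exact: aux sT.
  by have := tau_points k1 (leq_addr _ _); rewrite addKn expr1.
case/forallPn=> i0 i0N.
have q0 : (count i0 x)%:R / #|homs (G i0) T|%:R <= 2 * C * tau ^- (3 * V i0 x) / tau.
  apply: count_le => //.
  apply: (colour_bound_not_good (@label_neq1 _ _ _ _ c_nontriv i0) tau1 tauT _ i0N).
  by rewrite card_ord.
apply: (@le_trans _ _ ((\prod_i (2 * C * tau ^- (3 * V i x))) / tau)).
  rewrite /prob (bigD1 i0) //= [X in _ <= X / _](bigD1 i0) //= [leRHS]mulrAC.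
  apply: ler_pM => //.
    by apply: prodr_ge0 => i _; apply: ratio_ge0.
  by apply: ler_prod => i _; rewrite ratio_ge0 /= q.
rewrite prod_tau ler_wpM2r ?invr_ge0 ?(ltW tau_gt0) // ler_wpM2l //.
have [kV|] := leqP (6 * #|points x|) (3 * \sum_i V i x); last by lia.
by have := tau_points kV (leqnn _); rewrite subnn expr0 divr1.
Qed.

Lemma sum_not_good (C : R) : 1 <= C -> (forall i, moment_bound (G i) (2 * L.+2) C) ->
  \sum_(x : {ffun 'I_L.+2 -> T} | ~~ good_walk c x) prob x
    <= (2 * C) ^+ m * #|{: {ffun 'I_L.+2 * 'I_L.+2 -> bool}}|%:R / tau.
Proof.
move=> C1 CP; have C0 : 0 <= C by apply: le_trans C1.
apply: (@le_trans _ _ (\sum_(x : {ffun 'I_L.+2 -> T} | ~~ good_walk c x)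
    ((2 * C) ^+ m / tau) * (#|T|%:R ^+ #|points x|)^-1)).
  apply: ler_sum => x gx; apply: le_trans (prob_not_good C1 CP gx) _.
  by rewrite mulrAC.
rewrite -mulr_sumr [leRHS]mulrAC ler_wpM2l //.
  by rewrite divr_ge0 ?exprn_ge0 ?mulr_ge0 // ltW.
by apply: le_trans (sum_points_le R _ T_gt0) _; rewrite ler_nat max_card.
Qed.

(** By [good_walk_sym_kernel] the good walks have at most [L.+3 ^ 2] patterns. *)
Lemma sum_good (C : R) : 0 <= C -> (forall i, moment_bound (G i) 2 C) ->
  \sum_(x : {ffun 'I_L.+2 -> T} | good_walk c x) prob x <= (2 * C) ^+ m * (L.+3 ^ 2)%:R.
Proof.
move=> C0 CP.
apply: (@le_trans _ _ (\sum_(x : {ffun 'I_L.+2 -> T} | good_walk c x)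
    (2 * C) ^+ m * (#|T|%:R ^+ #|points x|)^-1)).
  by apply: ler_sum => x gx; apply: prob_good.
rewrite -mulr_sumr ler_wpM2l ?exprn_ge0 ?mulr_ge0 //.
apply: le_trans (sum_points_le R _ T_gt0) _; rewrite ler_nat.
apply: (@leq_trans #|[set sym_kernel p | p : 'I_L.+3 * option 'I_L.+2]|).
  apply/subset_leq_card/subsetP=> _ /imsetP[x gx ->].
  have [p pP] := good_walk_sym_kernel c_tag gx.
  by apply/imsetP; exists p => //; apply/ffunP=> -[j k]; rewrite ffunE pP.
apply: leq_trans (leq_imset_card _ _) _.
by rewrite cardT -cardE card_prod card_option !card_ord.
Qed.

End FixT.
End Bounds.
End Mean.

(** ** Closed walks through distinct points *)

Lemma perm_extend (J T : finType) (x y : J -> T) : injective x -> injective y ->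
  exists s : {perm T}, forall j, s (x j) = y j.
Proof.
move=> xi yi.
pose A := [set t | t \notin codom x]; pose B := [set t | t \notin codom y].
have AB : #|A| = #|B|.
  by apply/eqP; rewrite !cardsE -(eqn_add2l #|J|) -{1}(card_codom xi) -{1}(card_codom yi)
    !cardC.
pose h t := if [pick j | x j == t] is Some j then y j
            else nth t (enum B) (index t (enum A)).
have hx j : h (x j) = y j.
  by rewrite /h; case: pickP => [k /eqP/xi ->|/(_ j)]; rewrite ?eqxx.
have hA t : t \in A -> h t = nth t (enum B) (index t (enum A)).
  rewrite inE /h; case: pickP => // k /eqP <-; by rewrite codom_f.
have iA t : t \in A -> (index t (enum A) < size (enum B))%N.
  by move=> tA; rewrite -cardE -AB cardE index_mem mem_enum.
have hB t : t \in A -> h t \in B.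
  by move=> tA; rewrite hA // -mem_enum mem_nth ?iA.
have hi : injective h.
  move=> s t; case: (boolP (s \in A)) => sA; case: (boolP (t \in A)) => tA.
  - rewrite !hA // (set_nth_default t) ?iA // => /eqP.
    rewrite nth_uniq ?iA ?enum_uniq // => /eqP E.
    by rewrite -(nth_index s (s := enum A) (x := s)) ?mem_enum // E nth_index ?mem_enum.
  - have := hB s sA; move: tA; rewrite !inE negbK => /codomP[k ->] + E.
    by rewrite E hx codom_f.
  - have := hB t tA; move: sA; rewrite !inE negbK => /codomP[k ->] + E.
    by rewrite -E hx codom_f.
  by move: sA tA; rewrite !inE !negbK => /codomP[j ->] /codomP[k ->]; rewrite !hx => /yi ->.
by exists (perm hi) => j; rewrite permE hx.
Qed.

Lemma card_determined (J T : finType) (P : pred {ffun J -> T}) (D : {set J})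
    (B : J -> {set T}) :
  (forall x, P x -> forall j, j \in D -> x j \in B j) ->
  (forall x y, P x -> P y -> {in D, x =1 y} -> x = y) ->
  (#|[set x | P x]| <= \prod_(j in D) #|B j|)%N.
Proof.
move=> PB Pinj; have [->|[x0]] := set_0Vmem [set x | P x]; first by rewrite cards0.
rewrite inE => Px0.
pose F := [set h : {ffun J -> T} | h \in family (fun j =>
  if j \in D then mem (B j) else mem (pred1 (x0 j)))].
have <- : #|F| = (\prod_(j in D) #|B j|)%N.
  rewrite cardsE card_family foldrE big_image /= [RHS]big_mkcond /=.
  by apply: eq_bigr => j _; case: ifP; rewrite ?card1.
pose f (x : {ffun J -> T}) := [ffun j => if j \in D then x j else x0 j].
rewrite -(card_in_imset (f := f)).
  apply/subset_leq_card/subsetP=> _ /imsetP[x + ->]; rewrite !inE => /PB xB.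
  by apply/familyP=> j; rewrite ffunE; case: ifP => [/xB //|_]; rewrite inE.
move=> x y; rewrite !inE => Px Py /ffunP E; apply: Pinj => // j jD.
by have := E j; rewrite !ffunE jD.
Qed.

Section Injective.
Variables (gT : finGroupType) (L : nat) (T : finType).
Variable e : 'I_L.+2 -> option gT.
Hypothesis e_neq1 : forall j g, e j = Some g -> g != 1%g.
Hypothesis e_alt : forall j, e j -> ~~ e (j + 1).
Implicit Types (x : {ffun 'I_L.+2 -> T}) (f : {ffun gT -> {perm T}}).

Local Notation nxt := (@nxt L).
Local Notation realizes := (realizes nxt e).

Definition free : {set 'I_L.+2} := [set j | ~~ e (j - 1)].

Definition src (j : 'I_L.+2) : 'I_L.+2 := if j \in free then j else j - 1.

Lemma src_free j : src j \in free.
Proof.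
rewrite /src; case: ifP => // /negbT; rewrite !inE negbK => ej.
by apply/negP => /e_alt; rewrite subrK ej.
Qed.

Lemma src_inj f x y j : realizes f x -> realizes f y ->
  (x j == y j) = (x (src j) == y (src j)).
Proof.
move=> fx fy; rewrite /src; case: ifP => //; rewrite inE => /negbFE.
case ej : (e (j - 1)) => [g|] // _.
have := realizesP fx ej; have := realizesP fy ej; rewrite /nxt subrK => <- <-.
by rewrite (inj_eq perm_inj).
Qed.

(** Labelled steps are isolated by [e_alt]: each of them determines its end from
    its start, and all other points are arbitrary. *)
Lemma card_realizing_walks f : #|[set x : {ffun 'I_L.+2 -> T} | realizes f x]| = (#|T| ^ #|free|)%N.
Proof.
apply/eqP; rewrite eqn_leq; apply/andP; split.
  rewrite -prod_nat_const -[#|T|]cardsT; apply: (card_determined (B := fun=> [set: T])).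
    by move=> *; rewrite in_setT.
  move=> x y fx fy xy; apply/ffunP=> j; apply/eqP.
  by rewrite (src_inj j fx fy) xy ?eqxx // src_free.
have [T0|/card_gt0P[t0 _]] := posnP #|T|.
  have j0 : src 0 \in free by apply: src_free.
  by rewrite T0 exp0n // card_gt0; apply/set0Pn; exists (src 0).
pose D := pffun_on t0 (mem free) (mem T).
have <- : #|[set z | z \in D]| = (#|T| ^ #|free|)%N.
  by rewrite cardsE card_pffun_on; congr (_ ^ _)%N; apply: eq_card.
pose ext (z : {ffun 'I_L.+2 -> T}) := [ffun j => if j \in free then z j
  else if e (j - 1) is Some g then f g (z (j - 1)) else z j].
rewrite -(card_in_imset (f := ext) (D := mem [set z in D])).
  apply/subset_leq_card/subsetP=> _ /imsetP[z _ ->]; rewrite inE.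
  apply/forallP=> j; case ej : (e j) => [g|] //=; rewrite !ffunE.
  have -> : (j \in free) by rewrite inE; apply/negP=> /e_alt; rewrite subrK ej.
  have -> : (nxt j \in free) = false by rewrite inE /nxt addrK ej.
  by rewrite /nxt addrK ej.
move=> z z'; rewrite !inE => /pffun_onP[/subsetP zD _] /pffun_onP[/subsetP zD' _] /ffunP E.
apply/ffunP=> j; have := E j; rewrite !ffunE; case: ifP => // jF _.
have nz (u : {ffun _ -> T}) : {subset [pred i | u i != t0] <= mem free} -> u j = t0.
  by move=> uD; apply/eqP; apply/negPn/negP=> /uD; rewrite /= jF.
by rewrite (nz z) ?(nz z').
Qed.

(** A coincidence costs one free point, or it creates a loop, whose base point
    has a nontrivial stabilizer. *)
Lemma card_realizing_coincide f j k : f \in homs gT T -> j != k ->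
  (#|T| * #|[set x : {ffun 'I_L.+2 -> T} | realizes f x && (x j == x k)]|
    <= (1 + #|big_stab 2 f|) * #|T| ^ #|free|)%N.
Proof.
move=> fH jk; have kF := src_free k.
have FE : #|free| = #|free :\ src k|.+1 by rewrite (cardsD1 (src k)) kF.
have [jk'|jk'] := eqVneq (src j) (src k); last first.
  rewrite FE expnS mulnCA leq_mul2l mulnDl mul1n; apply/orP; right.
  apply: leq_trans (leq_addr _ _); rewrite -prod_nat_const -[#|T|]cardsT.
  apply: (card_determined (B := fun=> [set: T])) => [*|]; first by rewrite in_setT.
  move=> x y /andP[fx /eqP xjk] /andP[fy /eqP yjk] xy; apply/ffunP=> i; apply/eqP.
  rewrite (src_inj i fx fy); have [->|ik] := eqVneq (src i) (src k).
    rewrite -(src_inj k fx fy) -xjk -yjk (src_inj j fx fy) xy //.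
    by rewrite in_setD1 jk' src_free.
  by rewrite xy // in_setD1 ik src_free.
have loop x : realizes f x -> x j = x k -> x (src k) \in big_stab 2 f.
  move=> fx xjk.
  suff [g ej] : exists g, e (src k) = Some g /\ x (nxt (src k)) = x (src k).
    case: ej => ej xx; apply: (stab_gt1 fH (e_neq1 ej)).
    by rewrite (realizesP fx ej).
  move: jk'; rewrite /src.
  case: ifP => jF; case: ifP => kF'.
  - by move=> E; rewrite E eqxx in jk.
  - move=> E; move: kF'; rewrite inE => /negbFE; case ek: (e (k - 1)) => [g|] // _.
    by exists g; split=> //; rewrite /nxt subrK -E xjk.
  - move=> E; move: jF; rewrite inE => /negbFE; rewrite E; case ek: (e k) => [g|] // _.
    exists g; split=> //; have -> : nxt k = j by rewrite /nxt -E subrK.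
    exact: xjk.
  - by move/addIr => E; rewrite E eqxx in jk.
apply: (@leq_trans (#|T| * (#|big_stab 2 f| * #|T| ^ #|free :\ src k|))).
  rewrite leq_mul2l; apply/orP; right.
  pose B i : {set T} := if i == src k then big_stab 2 f else [set: T].
  apply: (@leq_trans (\prod_(i in free) #|B i|)).
    apply: card_determined => [x /andP[fx /eqP xjk] i _|x y /andP[fx _] /andP[fy _] xy].
      by rewrite /B; case: eqP => [->|_]; [apply: loop|rewrite in_setT].
    by apply/ffunP=> i; apply/eqP; rewrite (src_inj i fx fy) xy ?src_free.
  rewrite (big_setD1 _ kF) /= {1}/B eqxx leq_mul2l -prod_nat_const; apply/orP; right.
  by rewrite leq_eqVlt; apply/orP; left; apply/eqP/eq_bigr => i; rewrite in_setD1 /B => /andP[/negPf-> _]; rewrite cardsT.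
by rewrite FE expnS mulnCA mulnDl leq_addl.
Qed.

Lemma card_realizing_inj f : f \in homs gT T ->
  (#|T| * #|T| ^ #|free| <= #|T| * #|[set x : {ffun 'I_L.+2 -> T} | realizes f x && injectiveb x]|
     + L.+2 ^ 2 * ((1 + #|big_stab 2 f|) * #|T| ^ #|free|))%N.
Proof.
move=> fH; rewrite -{1}(card_realizing_walks f).
have sub : [set x : {ffun 'I_L.+2 -> T} | realizes f x] \subset [set x : {ffun 'I_L.+2 -> T} | realizes f x && injectiveb x] :|:
    \bigcup_(p : 'I_L.+2 * 'I_L.+2 | p.1 != p.2) [set x : {ffun 'I_L.+2 -> T} | realizes f x && (x p.1 == x p.2)].
  apply/subsetP=> x; rewrite !inE => fx; rewrite fx /=.
  case: (boolP (injectiveb x)) => //= /injectivePn[j [k jk xjk]].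
  by apply/bigcupP; exists (j, k) => //; rewrite inE fx xjk eqxx.
apply: (@leq_trans (#|T| * (#|[set x : {ffun 'I_L.+2 -> T} | realizes f x && injectiveb x]| +
   \sum_(p : 'I_L.+2 * 'I_L.+2 | p.1 != p.2) #|[set x : {ffun 'I_L.+2 -> T} | realizes f x && (x p.1 == x p.2)]|))).
  rewrite leq_mul2l; apply/orP; right; apply: leq_trans (subset_leq_card sub) _.
  apply: leq_trans (leq_card_setU _ _) _; rewrite leq_add2l.
  elim/big_rec2: _ => [|p n A _ IH]; first by rewrite cards0.
  by apply: leq_trans (leq_card_setU _ _) _; rewrite leq_add2l.
rewrite mulnDr leq_add2l big_distrr /=.
apply: (@leq_trans (\sum_(p : 'I_L.+2 * 'I_L.+2) (1 + #|big_stab 2 f|) * #|T| ^ #|free|)).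
  rewrite [leqLHS]big_mkcond; apply: leq_sum => p _; case: ifP => // pp.
  exact: card_realizing_coincide.
by rewrite sum_nat_const cardT -cardE card_prod !card_ord expnS expn1.
Qed.

End Injective.

Lemma expr1D_le (R : realType) (z : R) m : 0 <= z -> z <= 1 ->
  (1 + z) ^+ m <= 1 + 3 ^+ m * z.
Proof.
move=> z0 z1; elim: m => [|m IH]; first by rewrite !expr0 mul1r lerDl.
rewrite !exprS; apply: (@le_trans _ _ ((1 + z) * (1 + 3 ^+ m * z))).
  by rewrite ler_wpM2l // addr_ge0.
have p1 : 1 <= 3 ^+ m :> R by rewrite exprn_ege1 // ler1n.
set a := 3 ^+ m in p1 *.
have h1 : z <= a * z by rewrite ler_peMl.
have h2 : a * z * z <= a * z by rewrite ler_piMr // mulr_ge0 // (le_trans _ p1).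
by lra.
Qed.

Lemma prod_ge_1B (R : realType) (I : finType) (F : I -> R) (eps : R) : 0 <= eps ->
  (forall i, 1 - eps <= F i) -> (forall i, 0 <= F i) -> (0 < #|I|)%N ->
  1 - #|I|%:R * eps <= \prod_i F i.
Proof.
move=> e0 Fe F0 I0; have [e1|e1] := leP 1 eps.
  apply: (@le_trans _ _ 0); last exact: prodr_ge0.
  rewrite subr_le0; apply: (le_trans e1); rewrite ler_peMl //.
  by rewrite ler1n.
apply: (@le_trans _ _ (\prod_(i : I) (1 - eps))).
  rewrite prodr_const; move: #|I| => n.
  elim: n => [|n IH]; first by rewrite expr0 mul0r subr0.
  rewrite exprS; apply: (@le_trans _ _ ((1 - eps) * (1 - n%:R * eps))).
    rewrite -natr1 mulrDl mul1r.
    have : 0 <= n%:R * eps * eps by rewrite !mulr_ge0.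
    by lra.
  by rewrite ler_wpM2l // subr_ge0 ltW.
by apply: ler_prod => i _; rewrite Fe subr_ge0 ltW.
Qed.

Section InjectiveWalks.
Variables (R : realType) (m : nat) (G : 'I_m -> finGroupType) (L : nat).
Variable c : 'I_L.+2 -> letter G.
Hypothesis c_nontriv : forall j, nontriv (c j).
Hypothesis c_tag : forall j, tag (c j) != tag (c (j + 1)).

Local Notation nxt := (@nxt L).

Lemma label_alt i j : label c i j -> ~~ label c i (j + 1).
Proof.
case E: (label c i j) => [g|] // _; case F: (label c i (j + 1)) => [h|] //.
by have := c_tag j; rewrite (label_tagE E) (label_tagE F) eqxx.
Qed.

Lemma sum_card_free : (\sum_i #|free (label c i)| + L.+2 = m * L.+2)%N.
Proof.
have -> : (\sum_i #|free (label c i)| = \sum_(j : 'I_L.+2) m.-1)%N.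
  under eq_bigr do rewrite -sum1_card.
  rewrite (exchange_big_dep xpredT) //=; apply: eq_bigr => j _.
  rewrite sum1_card -[m in RHS]card_ord -(cardC1 (tag (c (j - 1)))).
  apply: eq_card => i; rewrite !inE; rewrite -[LHS]/(j \in free (label c i)) inE; congr negb.
  apply/idP/eqP => [|->]; last by rewrite label_tag.
  by case E: (label _ _ _) => [g|] // _; rewrite (label_tagE E).
have m0 : (0 < m)%N by case: (m) (tag (c 0)) => // -[].
by rewrite sum_nat_const card_ord -mulnSr prednK // mulnC.
Qed.

Section FixT.
Variables (T : finType) (tau : R).
Hypotheses (tau1 : 1 <= tau) (tauT : tau ^+ 6 = #|T|%:R).
Hypothesis T_large : (2 * L.+2 ^ 2 <= #|T|)%N.
Implicit Types (x : {ffun 'I_L.+2 -> T}).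

Local Notation count i x := #|[set f in homs (G i) T | realizes nxt (label c i) f x]|.
Local Notation prob := (@prob R m G L c T).
Local Notation h i := (#|homs (G i) T|).
Local Notation N := (#|T|).

Let tau_gt0 : 0 < tau. Proof. exact: lt_le_trans tau1. Qed.
Let T_gt0 : (0 < N)%N. Proof. by apply: leq_trans T_large; rewrite muln_gt0 expn_gt0. Qed.
Let N_gt0 : 0 < N%:R :> R. Proof. by rewrite ltr0n. Qed.
Let h_gt0 i : 0 < (h i)%:R :> R. Proof. by rewrite ltr0n homs_neq0. Qed.

(** All injective walks are equivalent under conjugation. *)
Lemma count_injective i x : injective x ->
  (count i x * N ^_ L.+2 = \sum_(f in homs (G i) T)
     #|[set y : {ffun 'I_L.+2 -> T} | realizes nxt (label c i) f y && injectiveb y]|)%N.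
Proof.
move=> xi; have <- : #|[set y : {ffun 'I_L.+2 -> T} | injectiveb y]| = (N ^_ L.+2)%N.
  by rewrite card_inj_ffuns card_ord.
under eq_bigr do rewrite -sum1_card.
rewrite (exchange_big_dep (fun y : {ffun 'I_L.+2 -> T} => injectiveb y)) /=; last first.
  by move=> f y _; rewrite inE => /andP[].
rewrite mulnC -sum_nat_const; apply: eq_big => [y|y]; first by rewrite inE.
rewrite inE => /injectiveP yi; have [s sxy] := perm_extend xi yi.
rewrite -(card_realizes_perm nxt (label c i) x s) -sum1_card.
apply: eq_bigl => f; rewrite !inE.
have -> : injectiveb y by apply/injectiveP.
by rewrite andbT; congr (_ && _); apply: eq_realizes.
Qed.

(** The probability of the steps in the factor [i], relative to the value that a
    free action would give. *)
Definition dens i x : R := (count i x)%:R * (N ^_ L.+2)%:R / ((h i)%:R * N%:R ^+ #|free (label c i)|).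

Lemma dens_le1 i x : injective x -> dens i x <= 1.
Proof.
move=> xi; rewrite ler_pdivrMr ?mulr_gt0 ?exprn_gt0 // mul1r -natrX -!natrM ler_nat.
rewrite (count_injective _ xi) -sum_nat_const; apply: leq_sum => f _.
rewrite -(card_realizing_walks (@label_alt i) f); apply/subset_leq_card/subsetP=> y.
by rewrite !inE => /andP[].
Qed.

Lemma dens_ge i x (C : R) : 0 <= C -> moment_bound (G i) 1 C -> injective x ->
  1 - (L.+2 ^ 2)%:R * (1 + C) / tau <= dens i x.
Proof.
move=> C0 [_ CP] xi; set F := #|free (label c i)|; set l2 := (L.+2 ^ 2)%N.
have [hY _] := CP T tau tau1 tauT 1%N isT.
rewrite ler_pdivlMr ?mulr_gt0 ?exprn_gt0 // -natrM (count_injective _ xi) natr_sum.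
set S := \sum_(f in _) _; pose A : R := N%:R ^+ F; pose H : R := (h i)%:R.
have A0 : 0 <= A by rewrite exprn_ge0.
set Y := \sum_(f in homs (G i) T) #|big_stab 2 f|%:R ^+ 1 in hY.
have ST : N%:R * A * H <= N%:R * S + l2%:R * ((H + Y) * A).
  have : \sum_(f in homs (G i) T) (N%:R * A) <= \sum_(f in homs (G i) T)
     (N%:R * #|[set y : {ffun 'I_L.+2 -> T} | realizes nxt (label c i) f y && injectiveb y]|%:R
      + l2%:R * ((1 + #|big_stab 2 f|%:R ^+ 1) * A)).
    apply: ler_sum => f fH.
    have := card_realizing_inj (@label_neq1 _ _ _ c c_nontriv i) (@label_alt i) fH.
    by rewrite -(ler_nat R) natrD !natrM natrD !natrX.
  rewrite sumr_const big_split /= -!mulr_sumr -mulr_suml big_split /= sumr_const.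
  by rewrite -[_ *+ _]mulr_natr.
rewrite -(ler_pM2l N_gt0).
have key : l2%:R * (H + Y) <= N%:R * (l2%:R * (1 + C) / tau) * H.
  have -> : N%:R * (l2%:R * (1 + C) / tau) * H = l2%:R * ((1 + C) * tau ^+ 5 * H).
    by rewrite -tauT exprS; field; rewrite gt_eqF.
  rewrite ler_wpM2l // mulrDl mulrDl; apply: lerD.
    by rewrite mul1r ler_peMl // exprn_ege1.
  apply: (le_trans hY); rewrite mulrAC ler_wpM2r // ler_wpM2l //.
  exact: ler_weXn2l.
have := ler_wpM2r A0 key; move: ST; rewrite -/A -/H.
set E := l2%:R * (1 + C) / tau.
have -> : N%:R * ((1 - E) * (H * A)) = N%:R * A * H - N%:R * E * H * A by ring.
have -> : l2%:R * (H + Y) * A = l2%:R * ((H + Y) * A) by ring.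
by lra.
Qed.

Lemma exists_injective : exists x : {ffun 'I_L.+2 -> T}, injective x.
Proof.
have LT : (L.+2 <= N)%N.
  by apply: leq_trans T_large; rewrite expnS expn1 mulnA leq_pmull ?muln_gt0.
have [t0 _] := card_gt0P T_gt0.
exists [ffun j : 'I_L.+2 => nth t0 (enum T) j] => j k; rewrite !ffunE => /eqP.
rewrite nth_uniq ?enum_uniq -?cardE ?(leq_trans (ltn_ord _)) //.
by move=> /eqP/val_inj.
Qed.

(** Walks through distinct points contribute [1] in the limit. *)
Lemma sum_injective (C : R) : 0 <= C -> (forall i, moment_bound (G i) 1 C) ->
  `|\sum_(x : {ffun 'I_L.+2 -> T} | injectiveb x) prob x - 1|
    <= (m%:R * (L.+2 ^ 2)%:R * (1 + C) + 3 ^+ m * (2 * (L.+2 ^ 2)%:R)) / tau.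
Proof.
move=> C0 CP; have [x0 x0i] := exists_injective.
set l2 := (L.+2 ^ 2)%N; set eps := l2%:R * (1 + C) / tau.
have m0 : (0 < m)%N by case: (m) (tag (c 0)) => // -[].
have FF : 0 < (N ^_ L.+2)%:R :> R.
  rewrite ltr0n ffact_gt0.
  by apply: leq_trans T_large; rewrite expnS expn1 mulnA leq_pmull ?muln_gt0.
pose rho : R := N%:R ^+ L.+2 / (N ^_ L.+2)%:R.
have probE : (N ^_ L.+2)%:R * prob x0 = rho ^+ m.-1 * \prod_i dens i x0.
  rewrite /prob /dens.
  rewrite [in RHS](eq_bigr (fun i => ((count i x0)%:R / (h i)%:R) *
     ((N ^_ L.+2)%:R * N%:R ^- #|free (label c i)|))); last first.
    by move=> i _; field; rewrite !gt_eqF ?exprn_gt0.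
  rewrite [X in _ = _ * X]big_split /= [X in _ = _ * (_ * X)]big_split /= prodr_const card_ord.
  rewrite prodfV -expr_sum /rho.
  have -> : (\sum_(i < m) #|free (label c i)| = L.+2 * m.-1)%N.
    by apply/eqP; rewrite -(eqn_add2r L.+2) sum_card_free -mulnSr prednK // mulnC.
  have -> : (N ^_ L.+2)%:R ^+ m = (N ^_ L.+2)%:R * (N ^_ L.+2)%:R ^+ m.-1 :> R.
    by rewrite -exprS prednK.
  rewrite expr_div_n -exprM.
  set Q := \prod_i _; set P := N%:R ^+ (L.+2 * m.-1).
  have P0 : P != 0 by rewrite expf_neq0 // gt_eqF.
  have F0 : (N ^_ L.+2)%:R ^+ m.-1 != 0 :> R by rewrite expf_neq0 // gt_eqF.
  by field; rewrite F0 P0.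
have sumE : \sum_(x : {ffun 'I_L.+2 -> T} | injectiveb x) prob x = (N ^_ L.+2)%:R * prob x0.
  rewrite (eq_bigr (fun _ => prob x0)); last first.
    move=> x /injectiveP xi; apply: eq_bigr => i _; congr (_%:R / _).
    have [s sx] := perm_extend x0i xi.
    rewrite -(card_realizes_perm nxt (label c i) x0 s); apply: eq_card => f.
    by rewrite !inE; congr (_ && _); apply: eq_realizes => j; rewrite /= sx.
  by rewrite sumr_const [RHS]mulr_natl -cardsE card_inj_ffuns card_ord.
have eps0 : 0 <= eps by rewrite divr_ge0 ?mulr_ge0 ?addr_ge0 // ltW.
have dens0 i : 0 <= dens i x0 by rewrite divr_ge0 ?mulr_ge0 ?exprn_ge0.
have lb : 1 - m%:R * eps <= \prod_i dens i x0.
  have := @prod_ge_1B R 'I_m (fun i => dens i x0) eps eps0; rewrite card_ord; apply=> // i.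
  exact: dens_ge.
have ub : \prod_i dens i x0 <= 1.
  by apply: prodr_ile1 => i _; rewrite dens0 dens_le1.
pose y : R := l2%:R / N%:R.
have y0 : 0 <= y by rewrite divr_ge0.
have yh : y <= 2^-1.
  by rewrite ler_pdivrMr // mulrC ler_pdivlMr // -natrM ler_nat mulnC.
have yt : y <= l2%:R / tau.
  rewrite ler_wpM2l // -tauT lef_pV2 ?posrE ?exprn_gt0 // -[leLHS]expr1.
  exact: ler_weXn2l.
have rho1 : 1 <= rho.
  rewrite ler_pdivlMr // mul1r -natrX ler_nat; elim: (L.+2) => // k IH.
  by rewrite ffactnSr expnSr leq_mul // leq_subr.
have rhoy : rho <= 1 + 2 * y.
  rewrite ler_pdivrMr //; have := ffact_lb R L.+2 T_gt0; rewrite -/l2 -/y.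
  set a := _ ^+ _; set b := _%:R => ab.
  have a0 : 0 <= a by rewrite exprn_ge0.
  have : 1 <= (1 + 2 * y) * (1 - y) by nra.
  move/(ler_wpM2l a0); rewrite mulr1 => /le_trans; apply.
  by rewrite mulrCA ler_wpM2l // addr_ge0 // mulr_ge0.
have rhom : rho ^+ m.-1 <= 1 + 3 ^+ m * (2 * (l2%:R / tau)).
  apply: (@le_trans _ _ (rho ^+ m)); first by apply: ler_weXn2l => //; apply: leq_pred.
  apply: (@le_trans _ _ ((1 + 2 * y) ^+ m)).
    by apply: lerXn2r; rewrite // nnegrE; [apply: le_trans rho1|rewrite addr_ge0 ?mulr_ge0].
  apply: le_trans (expr1D_le m _ _) _; rewrite ?mulr_ge0 //; first by lra.
  by rewrite lerD2l ler_wpM2l ?exprn_ge0 // ler_wpM2l.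
have rhom1 : 1 <= rho ^+ m.-1 by rewrite exprn_ege1.
rewrite sumE probE // ler_norml.
have -> : (m%:R * l2%:R * (1 + C) + 3 ^+ m * (2 * l2%:R)) / tau =
   m%:R * eps + 3 ^+ m * (2 * (l2%:R / tau)) by rewrite /eps; field; rewrite gt_eqF.
set B := 3 ^+ m * _ in rhom *.
have B0 : 0 <= B.
  by apply: mulr_ge0; rewrite ?exprn_ge0 //; apply: mulr_ge0 => //; apply: divr_ge0 => //; apply: ltW.
have P0 : 0 <= \prod_i dens i x0 by apply: prodr_ge0.
have e0 : 0 <= m%:R * eps by rewrite mulr_ge0.
move: (\prod_i _) lb ub P0 => P lb ub P0.
have h1 : P <= rho ^+ m.-1 * P by rewrite ler_peMl.
have h2 : rho ^+ m.-1 * P <= rho ^+ m.-1 by rewrite ler_piMr // (le_trans _ rhom1).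
by apply/andP; split; lra.
Qed.

End FixT.
End InjectiveWalks.

(** ** Asymptotics of the mean number of closed walks *)

Lemma moment_boundS (R : realType) (gT : finGroupType) (A B : nat) (C D : R) :
  (B <= A)%N -> C <= D -> moment_bound gT A C -> moment_bound gT B D.
Proof.
move=> BA CD [C0 CP]; split; first exact: le_trans CD.
move=> T tau tau1 tauT a aB; have [h1 h2] := CP T tau tau1 tauT a (leq_trans aB BA).
have tau0 : 0 <= tau by apply: le_trans tau1.
by split; [apply: le_trans h1 _|apply: le_trans h2 _]; rewrite !ler_wpM2r ?exprn_ge0.
Qed.

Lemma ex_moment_bounds (R : realType) (m : nat) (G : 'I_m -> finGroupType) (A : nat) :
  exists2 C : R, 1 <= C & forall i, moment_bound (G i) A C.
Proof.
have [C CP] := choice (fun i => ex_moment_bound R (G i) A).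
have C0 i : 0 <= C i by case: (CP i).
exists (1 + \sum_i C i); first by rewrite lerDl sumr_ge0.
move=> i; apply: moment_boundS (CP i) => //.
by rewrite (bigD1 i) //= addrCA lerDl addr_ge0 ?sumr_ge0.
Qed.

(** A cyclic word without rotation or reflection symmetry. *)
Definition rigid (m : nat) (G : 'I_m -> finGroupType) (L : nat) (c : 'I_L.+2 -> letter G) :=
  (forall d, d != 0 -> exists t, c t != c (t + d)) /\
  (forall s, exists t, c t != linv (c (s - 1 - t))).

Section MeanWalks.
Variables (R : realType) (m : nat) (G : 'I_m -> finGroupType).

Lemma prob_ge0 (L : nat) (c : 'I_L.+2 -> letter G) (T : finType) (x : {ffun 'I_L.+2 -> T}) :
  0 <= prob R c x.
Proof. by apply: prodr_ge0 => i _; rewrite divr_ge0. Qed.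

(** The constant in front of the polynomial bound is the same for all words. *)
Lemma mean_walks_le : exists2 D : R, 0 <= D &
  forall (L : nat) (c : 'I_L.+2 -> letter G), (forall j, nontriv (c j)) ->
    (forall j, tag (c j) != tag (c (j + 1))) ->
  exists K : R, forall (T : finType) (tau : R), 1 <= tau -> tau ^+ 6 = #|T|%:R ->
    (2 * L.+2 ^ 2 <= #|T|)%N ->
    \sum_(x : {ffun 'I_L.+2 -> T}) prob R c x <= D * (L.+3 ^ 2)%:R + K / tau.
Proof.
have [C C1 CP] := ex_moment_bounds R G 2; have C0 : 0 <= C by apply: le_trans C1.
exists ((2 * C) ^+ m); first by rewrite exprn_ge0 ?mulr_ge0.
move=> L c cN cT; have [C' C1' CP'] := ex_moment_bounds R G (2 * L.+2).
eexists => T tau tau1 tauT Tl; rewrite (bigID (fun x : {ffun 'I_L.+2 -> T} => good_walk c x)) /=.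
apply: lerD; first exact: (sum_good cN cT tau1 tauT Tl C0 CP).
exact: (sum_not_good cN cT tau1 tauT Tl C1' CP').
Qed.

(** A repeated point in a good walk would be a symmetry of the word. *)
Lemma rigid_good_walk (L : nat) (c : 'I_L.+2 -> letter G) (T : finType)
    (x : {ffun 'I_L.+2 -> T}) :
  (forall j, tag (c j) != tag (c (j + 1))) -> rigid c -> good_walk c x -> injective x.
Proof.
move=> cT [c1 c2] gx j k /(good_walk_sym cT gx) /orP[] /forallP h.
  have [/eqP|/c1[t]] := eqVneq (k - j) 0; first by rewrite subr_eq0 eq_sym => /eqP.
  by have /andP[_ ->] := h t.
by have [t] := c2 (j + k); have /andP[_ ->] := h t.
Qed.

Lemma mean_walks_rigid (L : nat) (c : 'I_L.+2 -> letter G) :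
  (forall j, nontriv (c j)) -> (forall j, tag (c j) != tag (c (j + 1))) -> rigid c ->
  exists K : R, forall (T : finType) (tau : R), 1 <= tau -> tau ^+ 6 = #|T|%:R ->
    (2 * L.+2 ^ 2 <= #|T|)%N ->
    `|\sum_(x : {ffun 'I_L.+2 -> T}) prob R c x - 1| <= K / tau.
Proof.
move=> cN cT rc; have [C C1 CP] := ex_moment_bounds R G (2 * L.+2).
have C0 : 0 <= C by apply: le_trans C1.
have CP1 i : moment_bound (G i) 1 C by apply: moment_boundS (CP i).
eexists => T tau tau1 tauT Tl; rewrite (bigID (fun x : {ffun 'I_L.+2 -> T} => injectiveb x)) /= addrAC.
have si := sum_injective cN cT tau1 tauT Tl C0 CP1.
have sn := sum_not_good cN cT tau1 tauT Tl C1 CP.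
apply: (le_trans (ler_normD _ _)).
apply: le_trans (_ : _ <= _ / tau + _ / tau) _; last by rewrite -mulrDl.
apply: (lerD si); apply: le_trans sn.
rewrite ger0_norm; last by apply: sumr_ge0 => x _; apply: prob_ge0.
rewrite big_mkcond [leRHS]big_mkcond /=; apply: ler_sum => x _.
have [gx|_] := boolP (good_walk c x); last by case: ifP => // _; apply: prob_ge0.
by have /injectiveP -> := rigid_good_walk cT rc gx.
Qed.

End MeanWalks.

Local Open Scope complex_scope.

(** * The expected trace as a mean number of fixed points *)

Section ExpectedTrace.
Variables (m : nat) (G : 'I_m -> finGroupType).
Local Notation Gam := (free_product G).

Section FixN.
Variable N : nat.
Implicit Types f : {dffun forall i, {ffun G i -> {perm 'I_N}}}.

Definition eval f (w : seq (letter G)) : {perm 'I_N} :=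
  (\prod_(a <- w) f (tag a) (tagged a))%g.

Definition extension f (x : Gam) : {perm 'I_N} := eval f (val x).

Lemma eval_cons f a w : eval f (a :: w) = (f (tag a) (tagged a) * eval f w)%g.
Proof. by rewrite /eval big_cons. Qed.

Lemma rhomsM f i (g h : G i) : f \in rhoms G 'I_N -> f i (g * h)%g = (f i g * f i h)%g.
Proof. by rewrite in_setXn => /forallP/(_ i); rewrite inE => /forallP/(_ g)/forallP/(_ h)/eqP. Qed.

Lemma rhoms1 f i : f \in rhoms G 'I_N -> f i 1%g = 1%g.
Proof. by move=> fR; apply: (mulgI (f i 1%g)); rewrite -rhomsM // !mulg1. Qed.

Lemma eval_consred f a w : f \in rhoms G 'I_N ->
  eval f (consred a w) = (f (tag a) (tagged a) * eval f w)%g.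
Proof.
move=> fR; rewrite /consred; case: ifP => [_|]; first exact: eval_cons.
by move=> /negbFE/eqP ->; rewrite rhoms1 // mul1g.
Qed.

Lemma eval_lmul f a w : f \in rhoms G 'I_N ->
  eval f (lmul a w) = (f (tag a) (tagged a) * eval f w)%g.
Proof.
move=> fR; case: w => [|b w]; rewrite /lmul; first exact: eval_consred.
case: eqP => [ab|_]; rewrite eval_consred //= eval_cons.
case: a b ab => [i g] [j h] /= ij; move: h; rewrite -ij => h.
by rewrite tagged_asE rhomsM // mulgA.
Qed.

Lemma extension_hom f : f \in rhoms G 'I_N -> @hom_sym m G N (extension f).
Proof.
move=> fR; split; first by rewrite /extension /eval /= big_nil.
move=> [v rv] [w rw]; rewrite /extension /=.
elim: v {rv} => [|a v IH] /=; first by rewrite /eval big_nil mul1g.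
by rewrite eval_lmul // IH eval_cons mulgA.
Qed.

Lemma extension_inj f i (g : G i) : f \in rhoms G 'I_N -> extension f (fp_inj g) = f i g.
Proof. by move=> fR; rewrite /extension /= eval_consred // /eval big_nil mulg1. Qed.

Lemma extension_injective : {in rhoms G 'I_N &, injective extension}.
Proof.
move=> f f' fR fR' E; apply/ffunP=> i; apply/ffunP=> g.
by rewrite -!extension_inj // E.
Qed.

Lemma extension_surj (phi : Gam -> 'S_N) : @hom_sym m G N phi ->
  exists2 f, f \in rhoms G 'I_N & extension f = phi.
Proof.
move=> [phi1 phiM].
exists [ffun i => [ffun g : G i => phi (fp_inj g)]].
  rewrite in_setXn; apply/forallP=> i; rewrite inE; apply/forallP=> g.
  by apply/forallP=> h; rewrite !ffunE fp_injM phiM.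
apply/funext=> x; rewrite [in RHS](fp_prod x) (big_morph phi phiM phi1).
by apply: eq_bigr => a _; rewrite !ffunE.
Qed.

Lemma perm_hom_sym :
  perm_eq (fset_set (@hom_sym m G N)) (map extension (enum (rhoms G 'I_N))).
Proof.
apply: uniq_perm; first exact: fset_uniq.
  by rewrite map_inj_in_uniq ?enum_uniq // => f f'; rewrite !mem_enum; apply: extension_injective.
move=> phi; rewrite in_fset_set; last exact: finite_hom_sym.
apply/idP/mapP => [/set_mem/extension_surj[f fR <-]|[f + ->]].
  by exists f; rewrite ?mem_enum.
by rewrite mem_enum => fR; apply/mem_set/extension_hom.
Qed.

Lemma expect_homE (R : realType) (F : (Gam -> 'S_N) -> R[i]) :
  expect_hom F = (\sum_(f in rhoms G 'I_N) F (extension f)) / #|rhoms G 'I_N|%:R.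
Proof.
rewrite /expect_hom fsbig_finite; last exact: finite_hom_sym.
rewrite (perm_big _ perm_hom_sym) big_map big_enum /=; congr (_ / _%:R).
by rewrite (perm_size perm_hom_sym) size_map -cardE.
Qed.

Definition fixed_points (s : {perm 'I_N}) : {set 'I_N} := [set t | s t == t].

End FixN.

Definition mean_fixed (R : realType) N (x : Gam) : R :=
  (\sum_(f in rhoms G 'I_N) #|fixed_points (extension f x)|)%:R / #|rhoms G 'I_N|%:R.

Lemma card_fixed_conj N (s t : {perm 'I_N}) :
  #|fixed_points (t * s * t^-1)%g| = #|fixed_points s|.
Proof.
rewrite -[RHS](card_imset _ (@perm_inj _ (t^-1)%g)); apply: eq_card => p; rewrite inE.
apply/eqP/imsetP => [|[q + ->]]; rewrite !permM.
  by move=> E; exists (t p); rewrite ?permK // inE -[X in _ == t X]E permKV.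
by rewrite inE permKV => /eqP ->.
Qed.

Lemma mean_fixed_conj (R : realType) N (x w : Gam) :
  mean_fixed R N (w * x * w^-1)%g = mean_fixed R N x.
Proof.
congr (_%:R / _); apply: eq_bigr => f fR.
have [e1 eM] := extension_hom fR.
have eV : extension f w^-1%g = (extension f w)^-1%g.
  by apply: (mulgI (extension f w)); rewrite -eM !mulgV.
by rewrite !eM eV card_fixed_conj.
Qed.

(** The standard representation is the permutation representation minus the
    trivial one: the complement of the projection has rank one and image the
    constant vectors, on which [s] acts trivially. *)
Lemma trace_std (R : realType) N (s : 'S_N.+1) :
  \tr (std R s) = #|fixed_points s|%:R - 1.
Proof.
rewrite /std /conjmx; set U := row_base _; set f := perm_mx s.
pose one : 'cV[R[i]]_N.+1 := const_mx 1.
have Ufree : row_free U by apply: row_base_free.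
have UV : U *m pinvmx U = 1%:M by apply: mulmxVp.
have Uone : U *m one = 0.
  have /submxP[D ->] : (U <= one_perp R N.+1)%MS by rewrite eq_row_base.
  by rewrite -mulmxA mulmx_ker mulmx0.
have fone : f *m one = one by apply/matrixP => i j; rewrite -row_permE !mxE.
set P := pinvmx U *m U.
have rU : \rank U = N by rewrite (eqP Ufree) rank_one_perp.
have /submxP[D DE] : ((1%:M - P)^T <= one^T)%MS.
  have oneK : (one^T <= kermx U^T)%MS.
    by apply/sub_kermxP; rewrite -trmx_mul Uone trmx0.
  have one1 : \rank one^T = 1%N.
    rewrite rank_rV; case: eqP => // /rowP/(_ ord0); rewrite !mxE => /eqP.
    by rewrite oner_eq0.
  have K1 : \rank (kermx U^T) = 1%N by rewrite mxrank_ker mxrank_tr rU subSnn.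
  have /eqmxP/eqmx_sym oneE : (one^T == kermx U^T)%MS.
    by rewrite -(geq_leqif (mxrank_leqif_eq oneK)) one1 K1.
  rewrite -oneE; apply/sub_kermxP.
  by rewrite -trmx_mul mulmxBr mulmx1 /P mulmxA UV mul1mx subrr trmx0.
have PE : 1%:M - P = one *m D^T by rewrite -[LHS]trmxK DE trmx_mul trmxK.
have trP : \tr P = N%:R by rewrite /P mxtrace_mulC UV mxtrace1 rank_one_perp.
have tr1 : \tr ((1%:M - P) *m f) = 1.
  rewrite PE mxtrace_mulC mulmxA fone -PE linearB /= mxtrace1 trP.
  by rewrite -natr1 addrAC subrr add0r.
have -> : \tr (U *m f *m pinvmx U) = \tr f - 1.
  rewrite mxtrace_mulC mulmxA -/P -tr1 mulmxBl mul1mx linearB /= opprB addrCA subrr addr0.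
  by [].
congr (_ - 1); rewrite /mxtrace -sum1_card natr_sum big_mkcond /=.
rewrite [RHS]big_mkcond /=; apply: eq_bigr => i _; rewrite !mxE inE eq_sym.
by case: eqP.
Qed.

Lemma expected_traceE (R : realType) N (x : Gam) : (0 < N)%N ->
  expected_trace R N x = ((mean_fixed R N x - 1) / N%:R)%:C.
Proof.
case: N => // N _; rewrite /expected_trace expect_homE.
under eq_bigr do rewrite trace_std.
rewrite -mulr_suml big_split /= sumr_const /mean_fixed.
have h0 : #|rhoms G 'I_N.+1|%:R != 0 :> R by rewrite pnatr_eq0 -lt0n rhoms_gt0.
have hC : #|rhoms G 'I_N.+1|%:R != 0 :> R[i] by rewrite pnatr_eq0 -lt0n rhoms_gt0.
rewrite fmorph_div rmorphB fmorph_div !rmorph_nat /= natr_sum rmorph1.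
by rewrite mulNrn; field; rewrite hC addrC natr1 pnatr_eq0.
Qed.

Section WordOfWalk.
Variables (L N : nat) (c : 'I_L.+2 -> letter G).
Let w := [seq c j | j <- enum 'I_L.+2].

Lemma size_wordc : size w = L.+2.
Proof. by rewrite size_map size_enum_ord. Qed.

Lemma nth_wordc a0 k (kL : (k < L.+2)%N) : nth a0 w k = c k%:R.
Proof.
rewrite (nth_map 0) ?size_enum_ord //; congr c; apply: ord_inj.
by rewrite nth_enum_ord // Zp_nat /= modn_small.
Qed.

Lemma eval_take (f : {dffun forall i, {ffun G i -> {perm 'I_N}}}) k t : (k < L.+2)%N ->
  eval f (take k.+1 w) t = f (tag (c k%:R)) (tagged (c k%:R)) (eval f (take k w) t).
Proof.
move=> kL; rewrite (take_nth (c 0)) ?size_wordc // /eval -cats1 big_cat /= big_seq1.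
by rewrite permM nth_wordc.
Qed.

(** A fixed point of a product of permutations is the same as the closed walk
    that its successive factors trace from there. *)
Lemma card_fixed_closed_walk (f : {dffun forall i, {ffun G i -> {perm 'I_N}}}) :
  #|fixed_points (eval f w)| = #|[set x : {ffun 'I_L.+2 -> 'I_N} | closed_walk c f x]|.
Proof.
have L0 : (L.+2%:R : 'I_L.+2) = 0 by apply: (@pchar_Zp L.+2).
have walkE (x : {ffun 'I_L.+2 -> 'I_N}) k : closed_walk c f x -> (k <= L.+2)%N ->
    eval f (take k w) (x 0) = x k%:R.
  move=> /forallP fx; elim: k => [|k IH] kL; first by rewrite take0 /eval big_nil perm1.
  by rewrite eval_take // IH 1?ltnW // (eqP (fx _)) /nxt natr1.
have all : take L.+2 w = w by rewrite take_oversize ?size_wordc.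
rewrite -[RHS](card_in_imset (f := fun x : {ffun 'I_L.+2 -> 'I_N} => x 0)); last first.
  move=> x y; rewrite !inE => fx fy xy; apply/ffunP=> j.
  by rewrite -(natr_Zp j) -!walkE ?xy // ltnW.
apply: eq_card => t; apply/idP/imsetP => [|[x + ->]]; last first.
  by rewrite !inE => fx; rewrite -[X in eval _ X]all walkE // L0.
rewrite inE => /eqP ft; exists [ffun j : 'I_L.+2 => eval f (take j w) t]; last first.
  by rewrite ffunE take0 /eval big_nil perm1.
rewrite inE; apply/forallP=> j; rewrite !ffunE; apply/eqP.
have jL := ltn_ord j; have := eval_take f t jL; rewrite natr_Zp => <-.
rewrite /nxt /= (@modn_small 1) // addn1; move: jL; rewrite leq_eqVlt => /orP[/eqP [E]|jL].
  by rewrite E modnn take0 all ft /eval big_nil perm1.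
by rewrite modn_small.
Qed.

Lemma mean_fixed_walks (R : realType) (x : Gam) : val x = w ->
  mean_fixed R N x = \sum_(y : {ffun 'I_L.+2 -> 'I_N}) prob R c y.
Proof.
move=> xw; rewrite -mean_closed_walks; congr (_%:R / _); apply: eq_bigr => f _.
by rewrite /extension xw card_fixed_closed_walk.
Qed.

End WordOfWalk.
End ExpectedTrace.

(** * Extracting the coefficients of the expansion *)

Section Roots.
Variable R : realType.

Definition root_nat (d N : nat) : R := N%:R `^ (d%:R^-1).

Lemma root_nat_ge0 d N : 0 <= root_nat d N.
Proof. exact: powR_ge0. Qed.

Lemma root_natX d N : (0 < d)%N -> root_nat d N ^+ d = N%:R.
Proof.
move=> d0; rewrite /root_nat -powR_mulrn ?powR_ge0 // -powRrM mulVf ?powRr1 //.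
by rewrite pnatr_eq0 -lt0n.
Qed.

Lemma root_nat_large d (A : R) : (0 < d)%N ->
  exists N0 : nat, forall N, (N0 <= N)%N -> A <= root_nat d N.
Proof.
move=> d0; have [A0|A0] := leP A 0.
  by exists 0%N => N _; apply: le_trans (root_nat_ge0 d N).
exists (Num.bound (A ^+ d)) => N hN; rewrite leNgt; apply/negP => lt.
have lt' : root_nat d N ^+ d < A ^+ d.
  by rewrite (ltrXn2r _ (root_nat_ge0 d N) lt) -lt0n.
move: lt'; rewrite root_natX // ltNge => /negP; apply.
apply: ltW; apply: lt_le_trans (archi_boundP (exprn_ge0 _ (ltW A0))) _.
by rewrite ler_nat.
Qed.

(** Coefficients of an expansion in powers of [N ^ (- 1 / d)] are unique. *)
Lemma expansion_unique (d s : nat) (c : nat -> R) (K : R) (N0 : nat) : (0 < d)%N ->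
  (forall N, (N0 <= N)%N ->
     `|\sum_(k < s) c k * root_nat d N ^- k| <= K * root_nat d N ^- s) ->
  forall k, (k < s)%N -> c k = 0.
Proof.
move=> d0 H; elim/ltn_ind => k IH ks; apply/eqP; apply/negPn/negP => ck.
have c0 : 0 < `|c k| by rewrite normr_gt0.
pose B := `|K| + \sum_(j < s) `|c j|.
have B0 : 0 <= B by rewrite addr_ge0 // sumr_ge0.
have [N1 N1P] := root_nat_large (Num.max 1 (B / `|c k| + 1)) d0.
set N := maxn N0 N1; have {}H := H N (leq_maxl _ _).
have := N1P N (leq_maxr _ _); set r := root_nat d N in H *.
rewrite ge_max => /andP[r1 rB]; have r0 : 0 < r by apply: lt_le_trans r1.
have dec i : (k < i)%N -> r ^+ k * r ^- i <= r^-1.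
  move=> ki; rewrite -(subnKC ki) addSn exprS exprD.
  have -> : r ^+ k * (r * (r ^+ k * r ^+ (i - k.+1)))^-1 = r^-1 * r ^- (i - k.+1).
    by field; rewrite !expf_neq0 gt_eqF.
  by rewrite ler_piMr ?invr_ge0 ?(ltW r0) // invf_le1 ?exprn_gt0 // exprn_ege1.
have eqS : r ^+ k * \sum_(j < s) c j * r ^- j = c k + \sum_(j < s | (k < j)%N) c j * (r ^+ k * r ^- j).
  rewrite mulr_sumr (bigD1 (Ordinal ks)) //=; congr (_ + _).
    by rewrite mulrCA divff ?mulr1 // expf_neq0 // gt_eqF.
  rewrite [LHS]big_mkcond [RHS]big_mkcond /=; apply: eq_bigr => j _.
  rewrite -(inj_eq val_inj) /=; case: ltngtP => [kj|jk|->]; rewrite ?eqxx //=.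
    by rewrite mulrCA.
  by rewrite IH // mul0r mulr0.
have le1 : `|c k| <= B / r.
  have -> : c k = r ^+ k * (\sum_(j < s) c j * r ^- j)
                 - \sum_(j < s | (k < j)%N) c j * (r ^+ k * r ^- j) by rewrite eqS addrK.
  apply: (le_trans (ler_normB _ _)); rewrite /B mulrDl; apply: lerD.
    rewrite normrM (ger0_norm (exprn_ge0 _ (ltW r0))).
    apply: (le_trans (ler_wpM2l (exprn_ge0 _ (ltW r0)) H)); rewrite mulrCA.
    apply: (@le_trans _ _ (`|K| * (r ^+ k * r ^- s))).
      rewrite ler_wpM2r ?ler_norm // mulr_ge0 ?invr_ge0 ?exprn_ge0 //; exact: ltW.
    by rewrite ler_wpM2l // dec.
  apply: (le_trans (ler_norm_sum _ _ _)); rewrite mulr_suml.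
  rewrite [leLHS]big_mkcond; apply: ler_sum => j _; case: ifP => kj.
    rewrite normrM ler_wpM2l // ger0_norm ?dec // mulr_ge0 ?invr_ge0 ?exprn_ge0 //; exact: ltW.
  by rewrite mulr_ge0 // invr_ge0 ltW.
move: le1; rewrite ler_pdivlMr // leNgt => /negP; apply.
rewrite mulrC -ltr_pdivrMr //; apply: lt_le_trans rB; by rewrite ltrDl.
Qed.

Lemma le_of_root_bound (d : nat) (a b K : R) (N0 : nat) : (0 < d)%N ->
  (forall N, (N0 <= N)%N -> a <= b + K / root_nat d N) -> a <= b.
Proof.
move=> d0 H; rewrite leNgt; apply/negP => ba.
have [N1 N1P] := root_nat_large (Num.max 1 (`|K| / (a - b) + 1)) d0.
set N := maxn N0 N1; have := H N (leq_maxl _ _); have := N1P N (leq_maxr _ _).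
set r := root_nat d N; rewrite ge_max => /andP[r1 rB].
have r0 : 0 < r by apply: lt_le_trans r1.
rewrite -lerBlDl ler_pdivlMr // leNgt => /negP; apply.
apply: le_lt_trans (ler_norm K) _; rewrite mulrC -ltr_pdivrMr ?subr_gt0 //.
by apply: lt_le_trans rB; rewrite ltrDl.
Qed.

End Roots.

Section Coefficients.
Variables (R : realType) (m : nat) (G : 'I_m -> finGroupType).
Local Notation Gam := (free_product G).
Variable u : nat -> Gam -> R.
Hypothesis uP : asymptotic_coefficients u.
Local Notation mu := (lcm_orders G).

Lemma lcm_orders_gt0 : (0 < mu)%N.
Proof.
rewrite /lcm_orders; elim/big_rec: _ => // i n _ n0; rewrite lcmn_gt0 n0 andbT.
by apply/card_gt0P; exists 1%g.
Qed.

Lemma normc_real (a : R) : normc (a%:C) = `|a|.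
Proof. by rewrite /= expr0n addr0 sqrtr_sqr. Qed.

Lemma coefficients_real x s : (0 < s)%N -> exists K (N0 : nat), forall N, (N0 <= N)%N ->
  `|(mean_fixed R N x - 1) / N%:R - \sum_(k < s) u k x * root_nat R mu N ^- k|
    <= K * root_nat R mu N ^- s.
Proof.
move=> s0; have [K [N0 _ HN]] := uP x s0.
exists K, N0.+1 => N hN; have N_gt0 : (0 < N)%N by apply: leq_trans hN.
have powE (k : nat) : N%:R `^ (- (k%:R / mu%:R)) = root_nat R mu N ^- k.
  by rewrite powRN mulrC powRrM powR_mulrn ?powR_ge0.
have := HN N (ltnW hN); rewrite /= expected_traceE // powE.
have -> : \sum_(k < s) (u k x * N%:R `^ (- (k%:R / mu%:R)))%:C
        = (\sum_(k < s) u k x * root_nat R mu N ^- k)%:C.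
  by rewrite rmorph_sum /=; apply: eq_bigr => k _; rewrite powE.
by rewrite -rmorphB normc_real.
Qed.

Lemma coefficient_conj k (x w : Gam) : u k (w * x * w^-1)%g = u k x.
Proof.
have [K [N0 H]] := coefficients_real x (ltn0Sn k).
have [K' [N0' H']] := coefficients_real (w * x * w^-1)%g (ltn0Sn k).
apply/eqP; rewrite -subr_eq0; apply/eqP.
apply: (@expansion_unique R mu k.+1 (fun j => u j (w * x * w^-1)%g - u j x) (K + K') (maxn N0 N0'))
  => //; first exact: lcm_orders_gt0.
move=> N; rewrite geq_max => /andP[/H h /H' h'].
rewrite mean_fixed_conj in h'.
have -> : \sum_(j < k.+1) (u j (w * x * w^-1)%g - u j x) * root_nat R mu N ^- j =
   ((mean_fixed R N x - 1) / N%:R - \sum_(j < k.+1) u j x * root_nat R mu N ^- j) -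
   ((mean_fixed R N x - 1) / N%:R - \sum_(j < k.+1) u j (w * x * w^-1)%g * root_nat R mu N ^- j).
  by under eq_bigr do rewrite mulrBl; rewrite sumrB; ring.
by apply: (le_trans (ler_normB _ _)); rewrite [leRHS]mulrDl lerD.
Qed.

Section BoundedMean.
Variables (x : Gam) (B : R) (N0 : nat).
Hypothesis mfB : forall N, (N0 <= N)%N -> mean_fixed R N x <= B.

Lemma mean_fixed_ge0 N : 0 <= mean_fixed R N x.
Proof. by rewrite divr_ge0. Qed.

(** A bounded mean contributes [O(1 / N)] to the trace, which is the term of
    order [mu]. *)
Lemma coefficient_lt k : (k < mu)%N -> u k x = 0.
Proof.
move=> kmu; have mu0 := lcm_orders_gt0.
have [K [N1 H]] := coefficients_real x mu0.
apply: (@expansion_unique R mu mu (fun j => u j x) (K + (1 + B)) (maxn 1 (maxn N0 N1))) => // N.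
rewrite !geq_max => /and3P[N_gt0 /mfB hB /H h].
set S := \sum_(j < mu) _ in h *; set A := (_ - 1) / _ in h.
have -> : S = A - (A - S) by rewrite opprB addrC subrK.
apply: (le_trans (ler_normB _ _)); rewrite addrC [leRHS]mulrDl lerD //.
rewrite /A normrM normfV root_natX // normr_nat ler_wpM2r ?invr_ge0 //.
by apply: (le_trans (ler_normB _ _)); rewrite normr1 addrC lerD2l ger0_norm ?mean_fixed_ge0.
Qed.

Lemma coefficient_mu : exists (K : R) (N1 : nat), forall N, (N1 <= N)%N ->
  `|mean_fixed R N x - 1 - u mu x| <= K / root_nat R mu N.
Proof.
have mu0 := lcm_orders_gt0; have [K [N1 H]] := coefficients_real x (ltn0Sn mu).
exists K, (maxn 1 N1) => N; rewrite geq_max => /andP[N_gt0 /H].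
have N0R : 0 < N%:R :> R by rewrite ltr0n.
rewrite big_ord_recr big1 /= ?add0r => [|i _]; last by rewrite coefficient_lt // mul0r.
rewrite exprS invfM root_natX // -mulrBl normrM normfV normr_nat mulrA => h.
by rewrite -(ler_pM2r (x := N%:R^-1)) ?invr_gt0.
Qed.

Lemma coefficient_mu_le : `|u mu x| <= 1 + `|B|.
Proof.
have mu0 := lcm_orders_gt0; have [K [N1 H]] := coefficient_mu.
apply: (@le_of_root_bound R mu _ _ K (maxn N0 N1) mu0) => N.
rewrite geq_max => /andP[/mfB hB /H]; set M := mean_fixed R N x in hB * => h.
have M0 : 0 <= M := mean_fixed_ge0 N.
have -> : u mu x = (M - 1) - (M - 1 - u mu x) by ring.
apply: (le_trans (ler_normB _ _)); apply: lerD => //.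
apply: (le_trans (ler_normB _ _)); rewrite normr1 addrC lerD2l ger0_norm //.
exact: le_trans hB (ler_norm B).
Qed.

(** [u mu x] is the limit of [mean_fixed R N x - 1]. *)
Lemma coefficient_mu_eq0 (K : R) : (forall N, (N0 <= N)%N ->
  `|mean_fixed R N x - 1| <= K / root_nat R 6 N) -> u mu x = 0.
Proof.
move=> M1; have mu0 := lcm_orders_gt0; have [K' [N1 H]] := coefficient_mu.
apply/eqP; rewrite -normr_le0 -[0]addr0.
have le1 N2 : (N0 <= N2)%N -> (N1 <= N2)%N ->
    `|u mu x| <= `|K| / root_nat R 6 N2 + K' / root_nat R mu N2.
  move=> /M1 h1 /H h2; set M := mean_fixed R N2 x in h1 h2.
  have -> : u mu x = (M - 1) - (M - 1 - u mu x) by ring.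
  apply: (le_trans (ler_normB _ _)); apply: lerD => //; apply: (le_trans h1).
  by rewrite ler_wpM2r ?ler_norm // invr_ge0 root_nat_ge0.
(* both error terms are powers of [N ^ (- 1 / (6 * mu))] *)
have d0 : (0 < 6 * mu)%N by rewrite muln_gt0.
apply: (@le_of_root_bound R (6 * mu) _ _ (`|K| + `|K'|) (maxn 1 (maxn N0 N1)) d0) => N.
rewrite !geq_max => /and3P[N_gt0 hN0 hN1].
rewrite addr0 add0r; apply: (le_trans (le1 N hN0 hN1)).
have N1R : 1 <= N%:R :> R by rewrite ler1n.
have rootS d : (0 < d)%N -> (d <= 6 * mu)%N ->
    (root_nat R d N)^-1 <= (root_nat R (6 * mu) N)^-1.
  move=> d_gt0 dle; rewrite lef_pV2 ?posrE ?powR_gt0 ?ltr0n //.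
  by apply: ler_powR => //; rewrite lef_pV2 ?posrE ?ltr0n // ler_nat.
rewrite mulrDl; apply: lerD; first by rewrite ler_wpM2l // rootS // leq_pmulr.
apply: (@le_trans _ _ (`|K'| / root_nat R mu N)).
  by rewrite ler_wpM2r ?ler_norm // invr_ge0 root_nat_ge0.
by rewrite ler_wpM2l // rootS // leq_pmull.
Qed.

End BoundedMean.
End Coefficients.

(** * Words with a cyclic symmetry *)

Section CyclicStructure.
Variables (m : nat) (G : 'I_m -> finGroupType).
Local Notation Gam := (free_product G).

Lemma cyc_word (x : Gam) : cyc_reduced x -> exists (L : nat) (c : 'I_L.+2 -> letter G),
  [/\ val x = [seq c j | j <- enum 'I_L.+2], forall j, nontriv (c j)
    & forall j, tag (c j) != tag (c (j + 1))].
Proof.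
rewrite /cyc_reduced; have := valP x; case: (val x) => [|a [|b s]] //= rx tx.
exists (size s); set w := [:: a, b & s] in rx *.
have sw : size w = (size s).+2 by [].
exists (fun j => nth a w j); split.
- apply: (@eq_from_nth _ a); first by rewrite size_map size_enum_ord.
  move=> k kw; rewrite (nth_map 0) ?size_enum_ord //.
  by rewrite nth_enum_ord.
- move=> j; case/andP: rx => /allP h _; apply: h; rewrite mem_nth // sw; exact: ltn_ord.
move=> j; have := ltn_ord j; rewrite /= (@modn_small 1) // addn1.
rewrite leq_eqVlt => /orP[/eqP [jE]|jL].
  rewrite jE modnn [nth _ _ 0]/=; move: tx; rewrite eq_sym.
  by rewrite -[last b s]/(last a w) -nth_last sw.
rewrite modn_small //; case/andP: rx => _ /(sortedP a)/(_ j); rewrite sw; exact.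
Qed.

(** A word with a period dividing its length is a power of its initial segment. *)
Lemma period_expg (r q : nat) (x v : Gam) : (0 < q)%N -> len x = (q * r)%N ->
  val v = take r (val x) ->
  (forall a0 k, (k + r < len x)%N -> nth a0 (val x) k = nth a0 (val x) (k + r)) ->
  x = (v ^+ q)%g.
Proof.
elim: q x => // -[|q] IH x _ lx vE per.
  by rewrite expg1; apply: val_inj; rewrite vE take_oversize // -/(len x) lx mul1n.
have rd : reduced (drop r (val x)).
  by apply: (reduced_catr (v := take r (val x))); rewrite cat_take_drop; apply: valP.
have ld : len (word rd) = (q.+1 * r)%N by rewrite /len /= size_drop -/(len x) lx; lia.
rewrite expgS -(IH (word rd)) //.
- by apply: val_cat_mul; rewrite vE /= cat_take_drop.
- have [E|[a0 _]] : val x = [::] \/ exists a0 : letter G, True.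
    by case: (val x) => [|a0 s]; [left|right; exists a0].
    by rewrite vE /= E.
  rewrite vE /=; apply: (@eq_from_nth _ a0).
    rewrite !size_takel // ?size_drop -/(len x) lx; lia.
  move=> k; rewrite size_takel -/(len x) ?lx; last by lia.
  move=> kr; rewrite !nth_take // nth_drop addnC per // lx; lia.
- move=> a0 k; rewrite ld => kr /=; rewrite !nth_drop addnA per ?lx; last by lia.
  by rewrite addnAC.
Qed.

Section Word.
Variables (L : nat) (c : 'I_L.+2 -> letter G) (x : Gam).
Hypothesis xc : val x = [seq c j | j <- enum 'I_L.+2].
Hypothesis c_tag : forall j, tag (c j) != tag (c (j + 1)).

Let len_x : len x = L.+2. Proof. by rewrite /len xc size_map size_enum_ord. Qed.
Let nth_x a0 k : (k < L.+2)%N -> nth a0 (val x) k = c k%:R.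
Proof. by move=> kL; rewrite xc nth_wordc. Qed.
Let L0 : (L.+2%:R : 'I_L.+2) = 0. Proof. exact: (@pchar_Zp L.+2). Qed.

Lemma rotation_power d : d != 0 -> (forall t, c t = c (t + d)) ->
  exists v q, [/\ (2 <= q)%N, (0 < len v)%N, x = (v ^+ q)%g & len x = (q * len v)%N].
Proof.
move=> d0 per; pose Q := [set d | [forall t, c t == c (t + d)]].
have [||r [r0 rL rP]] := @Zp_subgroup_dvd L Q.
- by rewrite inE; apply/forallP=> t; rewrite addr0.
- move=> a b; rewrite !inE => /forallP ha /forallP hb; apply/forallP=> t.
  have /eqP e1 := ha (t - b); have /eqP := hb (t - b); rewrite subrK => <-.
  by rewrite e1 -addrA [- b + a]addrC.
have dQ : d \in Q by rewrite inE; apply/forallP=> t; apply/eqP.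
have rl : (r < L.+2)%N.
  apply: leq_ltn_trans (ltn_ord d); apply: dvdn_leq; last by rewrite -rP.
  by rewrite lt0n; apply: contra d0 => /eqP d0; apply/eqP/val_inj.
have [q qE] := dvdnP rL.
have q2 : (2 <= q)%N by case: q qE => [|[|q]] // E; move: rl; rewrite E mul1n ltnn.
have rv : reduced (take r (val x)).
  by apply: (reduced_catl (w := drop r (val x))); rewrite cat_take_drop; apply: valP.
have lv : len (word rv) = r by rewrite /len /= size_takel // -/(len x) len_x ltnW.
exists (word rv), q; split; rewrite ?lv //; last by rewrite len_x.
apply: (@period_expg r) => //; first exact: leq_trans q2.
  by rewrite len_x.
move=> a0 k; rewrite len_x => kr; rewrite !nth_x //; last first.
  by apply: leq_ltn_trans kr; apply: leq_addr.
have : (r%:R : 'I_L.+2) \in Q by rewrite rP Zp_nat /= modn_small.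
by rewrite inE natrD => /forallP/(_ k%:R)/eqP.
Qed.

(** The reflection exchanges the positions [t] and [s - 1 - t] and inverts the
    letters, so it preserves the initial segment of length [s] and the rest, and
    both are equal to their inverse. *)
Lemma reflection_product s : (forall t, c t = linv (c (s - 1 - t))) ->
  exists y z, [/\ y^-1%g = y /\ z^-1%g = z, (0 < len y)%N, (0 < len z)%N,
                 x = (y * z)%g & len x = (len y + len z)%N].
Proof.
move=> ref; have s0 : (0 < s)%N.
  rewrite lt0n; apply/negP => /eqP s0.
  have sE : s = 0 by apply: val_inj.
  have := ref 0; rewrite sE subr0 sub0r => e.
  by have := c_tag (-1); rewrite addNr e eqxx.
have ry : reduced (take s (val x)).
  by apply: (reduced_catl (w := drop s (val x))); rewrite cat_take_drop; apply: valP.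
have rz : reduced (drop s (val x)).
  by apply: (reduced_catr (v := take s (val x))); rewrite cat_take_drop; apply: valP.
have sL : (s < L.+2)%N := ltn_ord s.
have ly : len (word ry) = s by rewrite /len /= size_takel // -/(len x) len_x ltnW.
have lz : len (word rz) = (L.+2 - s)%N by rewrite /len /= size_drop -/(len x) len_x.
have invE (v : seq (letter G)) a0 : (forall i, (i < size v)%N ->
    nth a0 v i = linv (nth a0 v (size v - i.+1))) -> winv v = v.
  move=> h; apply: (@eq_from_nth _ a0); first by rewrite size_rev size_map.
  move=> i; rewrite size_rev size_map => iv; rewrite nth_rev size_map //.
  have k : (size v - i.+1 < size v)%N by lia.
  by rewrite (nth_map a0) // -h.
exists (word ry), (word rz); split.
- split; apply: val_inj; rewrite val_inv /=.
    apply: (invE _ (c 0)) => i; rewrite size_takel -/(len x) ?len_x ?(ltnW sL) // => iv.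
    have is' : (s - i.+1 < s)%N by rewrite ltn_subrL.
    rewrite !nth_take // !nth_x; [|exact: ltn_trans is' sL|exact: ltn_trans iv sL].
    rewrite [LHS]ref; congr (linv (c _)).
    by rewrite natrB // natr_Zp -natr1; ring.
  apply: (invE _ (c 0)) => i; rewrite size_drop -/(len x) len_x => iv.
  rewrite !nth_drop !nth_x; [|lia|lia].
  rewrite [LHS]ref; congr (linv (c _)).
  have -> : (s + (L.+2 - s - i.+1) = L.+2 - i.+1)%N by lia.
  rewrite natrB; last by lia.
  by rewrite L0 natrD natr_Zp -natr1; ring.
- by rewrite ly.
- by rewrite lz subn_gt0.
- by apply: val_cat_mul; rewrite /= cat_take_drop.
- by rewrite ly lz len_x; lia.
Qed.

End Word.

(** ** Elements carrying a nonzero coefficient *)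

Definition is_power (x : Gam) : Prop :=
  exists v q, [/\ (2 <= q)%N, (0 < len v)%N, x = (v ^+ q)%g & len x = (q * len v)%N].

Definition is_dihedral (x : Gam) : Prop :=
  exists y z, [/\ y^-1%g = y /\ z^-1%g = z, (0 < len y)%N, (0 < len z)%N,
                 x = (y * z)%g & len x = (len y + len z)%N].

Lemma not_rigid_structure (x : Gam) (L : nat) (c : 'I_L.+2 -> letter G) :
  val x = [seq c j | j <- enum 'I_L.+2] -> (forall j, tag (c j) != tag (c (j + 1))) ->
  rigid c \/ is_power x \/ is_dihedral x.
Proof.
move=> xc cT.
have [/existsP[d /andP[d0 /forallP h]]|] :=
  boolP [exists d, (d != 0) && [forall t, c t == c (t + d)]].
  by right; left; apply: (rotation_power xc d0) => t; apply/eqP.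
move/existsPn => h1.
have [/existsP[s /forallP h]|] := boolP [exists s, [forall t, c t == linv (c (s - 1 - t))]].
  by right; right; apply: (reflection_product xc cT (s := s)) => t; apply/eqP.
move/existsPn => h2; left; split=> [d d0|s].
  by have := h1 d; rewrite d0 /= => /forallPn[t]; exists t.
by have /forallPn[t] := h2 s; exists t.
Qed.

Section Coefficient.
Variables (R : realType) (u : nat -> Gam -> R).
Hypothesis uP : asymptotic_coefficients u.
Local Notation mu := (lcm_orders G).

(** The walks of the word of [x] have a bounded mean by [mean_walks_le], which
    tends to one by [mean_walks_rigid] unless the word has a symmetry; and a
    symmetry of the word is a root or a factorization of [x]. *)
Lemma coefficient_cyc : exists2 D : R, 0 <= D & forall x, cyc_reduced x ->
  (forall k, (k < mu)%N -> u k x = 0) /\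
  (u mu x = 0 \/ (is_power x \/ is_dihedral x) /\ `|u mu x| <= D * (len x).+1%:R ^+ 2).
Proof.
have [D D0 DP] := mean_walks_le R G.
exists (2 + D); first by rewrite addr_ge0.
move=> x /cyc_word[L [c [xc cN cT]]]; have [K KP] := DP L c cN cT.
have lx : len x = L.+2 by rewrite /len xc size_map size_enum_ord.
have [N1 N1P] := @root_nat_large R 6 (Num.max 1 (`|K| + 1)) isT.
have root6 N : (N1 <= N)%N -> [/\ 1 <= root_nat R 6 N, `|K| <= root_nat R 6 N &
    root_nat R 6 N ^+ 6 = #|'I_N|%:R].
  move=> /N1P; rewrite ge_max => /andP[h1 h2]; split=> //; last by rewrite card_ord root_natX.
  by apply: le_trans h2; rewrite lerDl.
pose B : R := D * (L.+3 ^ 2)%:R + 1.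
have bound N : (maxn N1 (2 * L.+2 ^ 2) <= N)%N -> mean_fixed R N x <= B.
  rewrite geq_max => /andP[/root6[h1 h2 h3] hN]; rewrite (mean_fixed_walks N R xc).
  apply: le_trans (KP 'I_N _ h1 h3 _) _; first by rewrite card_ord.
  rewrite lerD2l; apply: le_trans (ler_norm _) _.
  have r0 : 0 < root_nat R 6 N by apply: lt_le_trans h1.
  by rewrite normrM normfV (gtr0_norm r0) ler_pdivrMr // mul1r.
split; first by move=> k kmu; apply: (coefficient_lt uP bound).
have [rc|str] := not_rigid_structure xc cT; last first.
  right; split=> //; apply: le_trans (coefficient_mu_le uP bound) _.
  rewrite ger0_norm ?addr_ge0 ?mulr_ge0 // /B lx natrX mulrDl addrC -addrA addrC lerD2r.
  have : 1 <= L.+3%:R ^+ 2 :> R by rewrite exprn_ege1 // ler1n.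
  by lra.
left; have [K' KP'] := mean_walks_rigid R cN cT rc.
apply: (coefficient_mu_eq0 uP bound (K := K')) => N.
rewrite geq_max => /andP[/root6[h1 h2 h3] hN]; rewrite (mean_fixed_walks N R xc).
by apply: KP' => //; rewrite card_ord.
Qed.

End Coefficient.
End CyclicStructure.

(** * Green's function of an element of the group algebra *)

Section Ball.
Variables (m : nat) (G : 'I_m -> finGroupType).
Local Notation Gam := (free_product G).

Definition ball (K : nat) : seq Gam :=
  pmap insub (flatten [seq [seq tval t | t <- enum {: n.-tuple (letter G)}] | n <- iota 0 K.+1]).

Lemma mem_ball K (g : Gam) : (g \in ball K) = (len g <= K)%N.
Proof.
rewrite /ball mem_pmap_sub; apply/flatten_mapP/idP => [[n]|gK].
  rewrite mem_iota add0n ltnS => /= nK /mapP[t _ E].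
  by rewrite -[len g]/(size (sval g)) E size_tuple.
exists (len g); first by rewrite mem_iota add0n ltnS.
by apply/mapP; exists (in_tuple (val g)); rewrite ?mem_enum.
Qed.

Lemma ball1 K : 1%g \in ball K. Proof. by rewrite mem_ball. Qed.

End Ball.
Arguments ball {m} G K.

Section Green.
Variables (R : realType) (m : nat) (G : 'I_m -> finGroupType).
Local Notation Gam := (free_product G).
Local Notation galg := (galg R Gam).
Implicit Types (y z : galg) (g h : Gam).

Lemma galgM y z g : (y * z) g = \sum_(a <- finsupp y) y a * z (a^-1 * g)%g.
Proof. exact: galg_mulE. Qed.

Lemma galgB y z g : (y - z) g = y g - z g.
Proof. by rewrite -[LHS]/(galg_add y (galg_opp z) g) galg_addE galg_oppE. Qed.

Lemma galg0 g : (0 : galg) g = 0.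
Proof. exact: fsfun0E. Qed.

Lemma galg1 g : (1 : galg) g = (g == 1%g)%:R.
Proof. exact: galg_oneE. Qed.

Definition restr (P : pred Gam) y : galg :=
  [fsfun g in finsupp y => if P g then y g else 0].

Lemma restrE P y g : restr P y g = if P g then y g else 0.
Proof.
rewrite fsfunE; case: ifPn => // gN; rewrite fsfun_dflt //; by case: ifP.
Qed.

Lemma normc_ge0 (a : R[i]) : 0 <= normc a.
Proof. by case: a => a b; apply: sqrtr_ge0. Qed.

Lemma normc_sum (I : Type) (r : seq I) (F : I -> R[i]) :
  normc (\sum_(i <- r) F i) <= \sum_(i <- r) normc (F i).
Proof.
elim/big_rec2: _ => [|i a b _ IH]; first by rewrite normc0.
by apply: (le_trans (le_normcD _ _)); rewrite lerD2l.
Qed.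

(** Multiplying a word ending with [w] by a shorter one on the left leaves the
    suffix [w] untouched. *)
Lemma wmul_catr (v b w : seq (letter G)) : (size v <= size b)%N ->
  wmul v (b ++ w) = wmul v b ++ w.
Proof.
elim: v => //= a v IH vb; rewrite IH; last exact: ltnW.
have sz : (size b <= size v + size (wmul v b))%N.
  elim: (v) => //= a' v' IH'; have [h _] := size_lmul a' (wmul v' b).
  by move: IH' h; rewrite addSn; lia.
case: (wmul v b) sz => [|b' s] sz /=; first by move: sz vb; rewrite /= addn0; lia.
by rewrite /lmul /consred; case: eqP => _; case: ifP.
Qed.

Definition has_suffix (w : seq (letter G)) (g : Gam) : bool :=
  drop (size (val g) - size w) (val g) == w.

Lemma has_suffixP w g : has_suffix w g -> exists b, val g = b ++ w.
Proof.
move=> /eqP E; exists (take (size (val g) - size w) (val g)).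
by rewrite -{2}E cat_take_drop.
Qed.

Lemma has_suffix_cat w g b : val g = b ++ w -> has_suffix w g.
Proof. by move=> E; rewrite /has_suffix E size_cat addnK drop_size_cat. Qed.

Lemma has_suffix_mul s g g2 : has_suffix (val g2) g ->
  ~~ has_suffix (val g2) (s * g)%g -> (len (g * g2^-1)%g < len s)%N.
Proof.
move=> /has_suffixP[b E] N; rewrite ltnNge; apply: contra N => sb.
have rb : reduced b by apply: (reduced_catl (w := val g2)); rewrite -E; apply: valP.
have gE : g = (word rb * g2)%g by apply: val_cat_mul.
apply: (@has_suffix_cat _ _ (wmul (val s) b)).
rewrite val_mul E wmul_catr //.
by move: sb; rewrite gE mulgK /len.
Qed.

Section Power.
Variable x : galg.

Definition supp_len : nat := \max_(s <- finsupp x) len s.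

Lemma supp_lenP s : s \in finsupp x -> (len s <= supp_len)%N.
Proof. by move=> sx; rewrite /supp_len (big_rem s) //= leq_maxl. Qed.

(** The commutator of a truncation with convolution by [x] is supported near
    the boundary of the truncated region. *)
Definition commut (P : pred Gam) y : galg := restr P (x * y) - x * restr P y.

Lemma commutE P y h : commut P y h =
  \sum_(s <- finsupp x) x s * (y (s^-1 * h)%g * ((P h)%:R - (P (s^-1 * h)%g)%:R)).
Proof.
rewrite galgB restrE [X in _ - X]galgM.
have -> : (if P h then (x * y) h else 0) = \sum_(s <- finsupp x) x s * (y (s^-1 * h)%g * (P h)%:R).
  by rewrite galgM; case: (P h); [apply: eq_bigr => s _; rewrite mulr1|
    rewrite big1 // => s _; rewrite mulr0 mulr0].
rewrite -sumrB; apply: eq_bigr => s _; rewrite restrE.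
by rewrite !mulrBr; congr (_ - _ * _); case: ifP => _; rewrite ?mulr1 ?mulr0.
Qed.

Lemma commut_supp g2 y h : ~~ ((h * g2^-1)%g \in ball G (2 * supp_len)) ->
  commut (has_suffix (val g2)) y h = 0.
Proof.
rewrite mem_ball => hN; rewrite commutE big_seq big1 // => s sx.
have sL := supp_lenP sx.
case h1: (has_suffix (val g2) h); case h2: (has_suffix (val g2) (s^-1 * h)%g);
  rewrite ?subrr ?mulr0 //; case/negP: hN.
  have := has_suffix_mul h1 (negbT h2); rewrite len_inv; lia.
have h3 : ~~ has_suffix (val g2) (s * (s^-1 * h))%g by rewrite mulKVg h1.
have := has_suffix_mul h2 h3.
have -> : (h * g2^-1)%g = (s * (s^-1 * h * g2^-1))%g by rewrite !mulgA mulgV mul1g.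
move: (s^-1 * h * g2^-1)%g => q lt; apply: (leq_trans (len_mul s q)).
by rewrite mul2n -addnn; apply: leq_add => //; apply: leq_trans (ltnW lt) sL.
Qed.

Definition norm1 : R := \sum_(s <- finsupp x) normc (x s).

Lemma norm1_ge0 : 0 <= norm1.
Proof. by apply: sumr_ge0 => s _; apply: normc_ge0. Qed.

Lemma commut_le g2 y b : b \in ball G (2 * supp_len) ->
  normc (commut (has_suffix (val g2)) y (b * g2)%g)
  <= norm1 * \sum_(d <- ball G (3 * supp_len)) normc (y (d * g2)%g).
Proof.
rewrite mem_ball => bL; rewrite commutE; apply: (le_trans (normc_sum _ _)).
rewrite mulr_suml [leLHS]big_seq [leRHS]big_seq; apply: ler_sum => s sx.
have sL := supp_lenP sx.
rewrite normcM ler_wpM2l ?normc_ge0 // normcM.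
have dB : (s^-1 * b)%g \in ball G (3 * supp_len).
  by rewrite mem_ball; apply: (leq_trans (len_mul _ _)); rewrite len_inv; lia.
rewrite (big_rem _ dB) /= -mulgA; apply: (@le_trans _ _ (normc (y (s^-1 * (b * g2))%g))).
  rewrite ler_piMr ?normc_ge0 //.
  by case: (has_suffix _ _); case: (has_suffix _ _); rewrite ?subrr ?subr0 ?sub0r ?normcN ?normc1 ?normc0.
by rewrite lerDl; apply: sumr_ge0 => d _; apply: normc_ge0.
Qed.

Lemma conv_commut_le (y z : galg) g1 g2 :
  normc ((y * commut (has_suffix (val g2)) z) (g1 * g2)%g)
  <= norm1 * \sum_(b <- ball G (2 * supp_len)) \sum_(d <- ball G (3 * supp_len))
       normc (y (g1 * b^-1)%g) * normc (z (d * g2)%g).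
Proof.
rewrite galgM; apply: (le_trans (normc_sum _ _)).
set C := commut _ z.
apply: (@le_trans _ _ (\sum_(a <- finsupp y) \sum_(b <- ball G (2 * supp_len))
   if a == (g1 * b^-1)%g then normc (y (g1 * b^-1)%g) * normc (C (b * g2)%g) else 0)).
  apply: ler_sum => a _; rewrite normcM.
  set b := (a^-1 * (g1 * g2) * g2^-1)%g.
  have s0 : 0 <= \sum_(b <- ball G (2 * supp_len))
     if a == (g1 * b^-1)%g then normc (y (g1 * b^-1)%g) * normc (C (b * g2)%g) else 0.
    by apply: sumr_ge0 => b' _; case: ifP => // _; rewrite mulr_ge0 ?normc_ge0.
  have [bB|bN] := boolP (b \in ball G (2 * supp_len)); last first.
    by rewrite [C _](commut_supp _ bN) normc0 mulr0.
  rewrite (big_rem _ bB) /=.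
  have -> : (g1 * b^-1)%g = a by rewrite /b !invMg !invgK !mulgA mulgK mulgV mul1g.
  have -> : (b * g2)%g = (a^-1 * (g1 * g2))%g by rewrite /b mulgKV.
  rewrite eqxx lerDl; apply: sumr_ge0 => b' _; case: ifP => // _.
  by rewrite mulr_ge0 ?normc_ge0.
rewrite exchange_big mulr_sumr /= [leLHS]big_seq [leRHS]big_seq; apply: ler_sum => b bB.
apply: (@le_trans _ _ (normc (y (g1 * b^-1)%g) * normc (C (b * g2)%g))).
  have [ay|ay] := boolP ((g1 * b^-1)%g \in finsupp y).
    rewrite (big_rem _ ay) /= eqxx gerDl big_seq big1 // => a.
    rewrite mem_rem_uniq ?fset_uniq // inE => /andP[/negPf -> _] //.
  rewrite big_seq big1 ?mulr_ge0 ?normc_ge0 // => a ain; case: eqP => // E.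
  by rewrite -E ain in ay.
rewrite -mulr_sumr mulrCA ler_wpM2l ?normc_ge0 //.
exact: commut_le.
Qed.

(** The restriction of [x ^ p] to the words ending with [g2], minus [x ^ p] times
    the restriction of [1], telescopes into a sum of commutators; these are
    supported near [g2]. *)
Lemma pow_cut p g1 g2 : val (g1 * g2)%g = val g1 ++ val g2 -> (0 < len g2)%N ->
  normc ((x ^+ p) (g1 * g2)%g) <= norm1 * \sum_(t < p)
    \sum_(b <- ball G (2 * supp_len)) \sum_(d <- ball G (3 * supp_len))
       normc ((x ^+ t) (g1 * b^-1)%g) * normc ((x ^+ (p - t.+1)) (d * g2)%g).
Proof.
move=> E g20; pose P := has_suffix (val g2).
have tel n : (n <= p)%N -> restr P (x ^+ p) =
    \sum_(t < n) (x ^+ t * commut P (x ^+ (p - t.+1))) + x ^+ n * restr P (x ^+ (p - n)).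
  elim: n => [|n IH] np; first by rewrite big_ord0 add0r expr0 mul1r subn0.
  rewrite (IH (ltnW np)) big_ord_recr /= -addrA; congr (_ + _).
  rewrite /commut mulrBr exprSr -mulrA subrK; congr (_ * restr P _).
  by rewrite -exprS; congr (_ ^+ _); lia.
have gP : P (g1 * g2)%g by apply: has_suffix_cat E.
have := congr1 (fun y : galg => y (g1 * g2)%g) (tel p (leqnn _)).
rewrite restrE gP => ->.
have -> : restr P (x ^+ (p - p)) = 0.
  apply/fsfunP=> h; rewrite restrE subnn expr0 galg1 galg0; case: ifP => // hP.
  case: eqP => // h1; have [b] := has_suffixP hP; rewrite h1 => /(congr1 size).
  by move: g20; rewrite /len size_cat /=; lia.
rewrite mulr0 addr0.
have sumE (n : nat) (F : nat -> galg) g : (\sum_(t < n) F t) g = \sum_(t < n) F t g.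
  elim: n => [|n IH]; first by rewrite !big_ord0 galg0.
  rewrite !big_ord_recr /= -IH.
  by rewrite -[LHS]/(galg_add (\sum_(t < n) F t) (F n) g) galg_addE.
rewrite (sumE p (fun t => x ^+ t * commut P (x ^+ (p - t.+1)))).
apply: (le_trans (normc_sum _ _)); rewrite mulr_sumr; apply: ler_sum => t _.
exact: conv_commut_le.
Qed.

End Power.
End Green.

(** ** Submultiplicativity *)

Section GreenFunction.
Variables (R : realType) (m : nat) (G : 'I_m -> finGroupType).
Local Notation Gam := (free_product G).
Local Notation galg := (galg R Gam).
Implicit Types (g h : Gam).
Variable x : galg.
Variable M : R.
Hypothesis M_gt0 : 0 < M.

(** The truncated resolvent of the absolute values of the powers of [x]; it is
    submultiplicative along paths of the tree, up to local corrections. *)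
Definition green (p : nat) g : R := \sum_(t < p.+1) M ^- t * normc ((x ^+ t) g).

(** Cutting a word changes its ends by bounded amounts; up to constants, [fat] is
    insensitive to that. *)
Definition fat (p K : nat) g : R :=
  \sum_(a <- ball G K) \sum_(b <- ball G K) green p (a * g * b)%g.

Lemma green_ge0 p g : 0 <= green p g.
Proof.
apply: sumr_ge0 => t _; apply: mulr_ge0; last exact: normc_ge0.
by rewrite invr_ge0 exprn_ge0 // ltW.
Qed.

Lemma pow_le_green p t g : (t <= p)%N -> normc ((x ^+ t) g) <= M ^+ t * green p g.
Proof.
move=> tp; have t1 : (t < p.+1)%N by [].
rewrite mulrC -ler_pdivrMr ?exprn_gt0 // /green (bigD1 (Ordinal t1)) //= [leLHS]mulrC lerDl.
apply: sumr_ge0 => i _; apply: mulr_ge0; last exact: normc_ge0.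
by rewrite invr_ge0 exprn_ge0 // ltW.
Qed.

Lemma fat_ge0 p K g : 0 <= fat p K g.
Proof. by do 2![apply: sumr_ge0 => ? _]; apply: green_ge0. Qed.

Lemma green_le_fat p K a b g : (len a <= K)%N -> (len b <= K)%N ->
  green p (a * g * b)%g <= fat p K g.
Proof.
rewrite -!mem_ball => aB bB; rewrite /fat (big_rem _ aB) /= (big_rem _ bB) /= -addrA lerDl.
apply: addr_ge0; first by apply: sumr_ge0 => *; apply: green_ge0.
by do 2![apply: sumr_ge0 => ? _]; apply: green_ge0.
Qed.

Lemma fat_shift p K d a b g : (len a <= d)%N -> (len b <= d)%N ->
  fat p K (a * g * b)%g <= (size (ball G K) ^ 2)%:R * fat p (K + d) g.
Proof.
move=> ad bd; rewrite expnS expn1 natrM -mulrA.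
have cst (A : R) : (size (ball G K))%:R * A = \sum_(i <- ball G K) A.
  by rewrite big_const_seq iter_addr_0 count_predT mulr_natl.
rewrite cst /fat [leLHS]big_seq [leRHS]big_seq; apply: ler_sum => c; rewrite mem_ball => cK.
rewrite cst [leLHS]big_seq [leRHS]big_seq; apply: ler_sum => e; rewrite mem_ball => eK.
have -> : (c * (a * g * b) * e)%g = ((c * a) * g * (b * e))%g by rewrite !mulgA.
apply: green_le_fat; apply: (leq_trans (len_mul _ _)); lia.
Qed.

Lemma fat_mono p K d g : fat p K g <= (size (ball G K) ^ 2)%:R * fat p (K + d) g.
Proof. by have := @fat_shift p K d 1%g 1%g g isT isT; rewrite mul1g mulg1. Qed.

Lemma green_le_fat1 p K g : green p g <= fat p K g.
Proof. by have := @green_le_fat p K 1%g 1%g g isT isT; rewrite mul1g mulg1. Qed.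

Lemma green1 p : 1 <= green p 1%g.
Proof.
have := @pow_le_green p 0 1%g isT; rewrite expr0 galg1 eqxx mul1r.
by rewrite normc1.
Qed.

Lemma conv_le (p : nat) (u v : nat -> R) : (forall t, 0 <= u t) -> (forall t, 0 <= v t) ->
  \sum_(q < p.+1) \sum_(t < q) u t * v (q - t.+1)%N
  <= (\sum_(t < p.+1) u t) * (\sum_(t < p.+1) v t).
Proof.
move=> u0 v0.
under eq_bigr => q _ do
  rewrite (big_ord_widen p.+1 (fun t => u t * v (q - t.+1)%N) (ltnW (ltn_ord q))).
rewrite (exchange_big_dep xpredT) //= mulr_suml; apply: ler_sum => t _.
rewrite -mulr_sumr ler_wpM2l //.
have -> : \sum_(q < p.+1 | (t < q)%N) v (q - t.+1)%N = \sum_(t.+1 <= q < p.+1) v (q - t.+1)%N.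
  by rewrite -(big_mkord (fun q => t < q)%N (fun q => v (q - t.+1)%N)) [RHS]big_geq_mkord
     big_mkord.
rewrite -[X in \sum_(X <= _ < _) _]add0n big_addn; under eq_bigr do rewrite addnK.
rewrite big_mkord (big_ord_widen p.+1 v (leq_subr _ _)) [leLHS]big_mkcond.
by apply: ler_sum => i _; case: ifP.
Qed.

Local Notation L := (supp_len x).

(** [pow_cut] summed over the exponents is a convolution in [t]. *)
Lemma green_cut_exact : exists2 C : R, 0 <= C & forall p g1 g2,
  val (g1 * g2)%g = val g1 ++ val g2 ->
  green p (g1 * g2)%g <= C * fat p (3 * L) g1 * fat p (3 * L) g2.
Proof.
pose B2 := ball G (2 * L); pose B3 := ball G (3 * L); pose n := size B2.
pose C : R := 1 + norm1 x / M * n%:R.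
have C1 : 1 <= C by rewrite lerDl ?mulr_ge0 ?invr_ge0 ?norm1_ge0 // ltW.
exists C; first exact: le_trans C1.
move=> p g1 g2 E; have [g20|g20] := posnP (len g2).
  have g2E : g2 = 1%g by apply: val_inj; apply: size0nil.
  rewrite g2E mulg1 -[leLHS]mul1r -mulrA; apply: ler_pM => //; first exact: green_ge0.
  rewrite -[leLHS]mulr1; apply: ler_pM => //; rewrite ?green_ge0 ?green_le_fat1 //.
  by apply: le_trans (green1 p) _; apply: green_le_fat1.
have M0 t : 0 <= M ^- t by rewrite invr_ge0 exprn_ge0 // ltW.
pose u b t := M ^- t * normc ((x ^+ t) (g1 * b^-1)%g).
pose v d t := M ^- t * normc ((x ^+ t) (d * g2)%g).
have u0 b t : 0 <= u b t by rewrite mulr_ge0 // normc_ge0.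
have v0 d t : 0 <= v d t by rewrite mulr_ge0 // normc_ge0.
have step1 : green p (g1 * g2)%g <= norm1 x / M *
    \sum_(b <- B2) \sum_(d <- B3) \sum_(q < p.+1) \sum_(t < q) u b t * v d (q - t.+1)%N.
  have -> : \sum_(b <- B2) \sum_(d <- B3) \sum_(q < p.+1) \sum_(t < q) u b t * v d (q - t.+1)%N =
     \sum_(q < p.+1) \sum_(t < q) \sum_(b <- B2) \sum_(d <- B3) u b t * v d (q - t.+1)%N.
    under eq_bigr do rewrite exchange_big /=.
    rewrite exchange_big /=; apply: eq_bigr => q _.
    under eq_bigr do rewrite exchange_big /=.
    by rewrite exchange_big.
  rewrite /green mulr_sumr; apply: ler_sum => q _.
  apply: le_trans (ler_wpM2l (M0 q) (pow_cut x q E g20)) _.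
  rewrite mulrCA -mulrA ler_wpM2l ?norm1_ge0 // !mulr_sumr; apply: ler_sum => t _.
  rewrite !mulr_sumr; apply: ler_sum => b _; rewrite !mulr_sumr; apply: ler_sum => d _.
  rewrite le_eqVlt; apply/orP; left; apply/eqP; rewrite /u /v.
  have -> : M ^- q = M^-1 * (M ^- t * M ^- (q - t.+1)).
    by rewrite -!invfM -exprD -exprS; congr (_ ^- _); have := ltn_ord t; lia.
  by rewrite !mulrA; congr (_ * _); rewrite -!mulrA; congr (_ * (_ * _)); rewrite mulrC.
apply: (le_trans step1).
apply: (@le_trans _ _ (norm1 x / M * \sum_(b <- B2) \sum_(d <- B3)
    green p (g1 * b^-1)%g * green p (d * g2)%g)).
  apply: ler_wpM2l; first by rewrite mulr_ge0 ?norm1_ge0 // invr_ge0 ltW.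
  by apply: ler_sum => b _; apply: ler_sum => d _; apply: conv_le.
apply: (@le_trans _ _ (norm1 x / M * \sum_(b <- B2) fat p (3 * L) g1 * fat p (3 * L) g2)).
  apply: ler_wpM2l; first by rewrite mulr_ge0 ?norm1_ge0 // invr_ge0 ltW.
  rewrite [leLHS]big_seq [leRHS]big_seq; apply: ler_sum => b; rewrite mem_ball => bB.
  rewrite -mulr_sumr; apply: ler_pM.
  - exact: green_ge0.
  - by apply: sumr_ge0 => *; apply: green_ge0.
  - by have := @green_le_fat p (3 * L) 1%g b^-1%g g1 isT; rewrite mul1g len_inv; apply; lia.
  - rewrite /fat [leLHS]big_seq [leRHS]big_seq; apply: ler_sum => d dB.
    rewrite (big_rem _ (ball1 G (3 * L))) /= mulg1 lerDl.
    by apply: sumr_ge0 => *; apply: green_ge0.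
rewrite big_const_seq iter_addr_0 count_predT -mulr_natl mulrA -[leRHS]mulrA.
apply: ler_wpM2r; first by rewrite mulr_ge0 ?fat_ge0.
by rewrite /C ler_wpDl.
Qed.

(** Letters may also merge or cancel where the two factors meet. *)
Lemma green_cut (kappa : nat) : exists (K : nat) (C : R), 0 <= C /\ forall p g1 g2,
  (len g1 + len g2 <= len (g1 * g2)%g + kappa)%N ->
  green p (g1 * g2)%g <= C * fat p K g1 * fat p K g2.
Proof.
have [C0 C00 C0P] := green_cut_exact.
have step g1 g2 : val (g1 * g2)%g = val g1 ++ val g2 \/
    exists g1' a, [/\ len g1 = (len g1').+1, (len a <= 1)%N, g1 = (g1' * a)%g
                    & (len (a * g2)%g <= len g2)%N].
  have [->|] := eqVneq g1 1%g; first by left; rewrite mul1g.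
  case/lastP E1 : (val g1) => [|w1 a]; first by case/eqP; apply: val_inj.
  case E2 : (val g2) => [|b w2] _.
    by left; rewrite cats0 (_ : g2 = 1%g) ?mulg1 ?E1 //; apply: val_inj.
  have r1 : reduced (w1 ++ [:: a]) by rewrite cats1 -E1; apply: valP.
  have r2 : reduced (b :: w2) by rewrite -E2; apply: valP.
  have na : nontriv a by case/andP: r1; rewrite all_cat /= andbT => /andP[].
  have [ab|ab] := eqVneq (tag a) (tag b); last first.
    left; rewrite val_mul E1 E2 wmul_cat // -cats1 -catA /=.
    rewrite /reduced all_cat; case/andP: r1; rewrite all_cat => /andP[-> _] s1.
    case/andP: r2 => /= /andP[-> ->] s2; rewrite na /=.
    case: (w1) s1 => [_|c w] /=; first by rewrite s2 andbT.
    by rewrite !cat_path /= => /and3P[-> -> _]; rewrite /tag_neq ab s2.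
  right; exists (word (reduced_catl r1)), (letter_elt a); split.
  - by rewrite /len E1 size_rcons.
  - exact: len_letter.
  - by apply: val_cat_mul; rewrite val_letter //= E1 cats1.
  rewrite /len val_mul val_letter // E2 /= /lmul.
  by case: eqP => // _; apply: size_consred.
elim: kappa => [|k [K [C [CC CP]]]].
  exists (3 * L)%N, C0; split=> // p g1 g2; rewrite addn0 => le.
  have [|[g1' [a [l1 _ E1 l2]]]] := step g1 g2; first exact: C0P.
  have h := len_mul g1' (a * g2)%g; rewrite mulgA -E1 in h.
  by move: (leq_trans le (leq_trans h (leq_add (leqnn _) l2))); rewrite l1 addSn ltnn.
pose s1 : R := (size (ball G K) ^ 2)%:R; pose s0 : R := (size (ball G (3 * L)) ^ 2)%:R.
pose K' := (K + (1 + 3 * L))%N; pose C' := C * s1 * s1 + C0 * s0 * s0.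
exists K', C'; split; first by rewrite addr_ge0 // !mulr_ge0.
have KE : K' = (3 * L + (K + 1))%N by rewrite /K'; lia.
move=> p g1 g2 le.
have conc (A s a b : R) : 0 <= A -> 0 <= s -> 0 <= a -> 0 <= b -> A * s * s <= C' ->
    a <= s * fat p K' g1 -> b <= s * fat p K' g2 ->
    A * a * b <= C' * fat p K' g1 * fat p K' g2.
  move=> A0 S0 a0 b0 AC ha hb; have f1 := fat_ge0 p K' g1; have f2 := fat_ge0 p K' g2.
  apply: (@le_trans _ _ (A * (s * fat p K' g1) * (s * fat p K' g2))).
    by apply: ler_pM; rewrite ?mulr_ge0 // ler_wpM2l.
  have -> : A * (s * fat p K' g1) * (s * fat p K' g2) = A * s * s * fat p K' g1 * fat p K' g2.
    by ring.
  by rewrite !ler_wpM2r.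
have [E|[g1' [a [l1 la E1 l2]]]] := step g1 g2.
  apply: le_trans (C0P p g1 g2 E) _; apply: (conc _ s0); rewrite ?fat_ge0 //.
  - by rewrite lerDr !mulr_ge0.
  - by rewrite KE; apply: fat_mono.
  - by rewrite KE; apply: fat_mono.
have gE : (g1 * g2 = g1' * (a * g2))%g by rewrite mulgA -E1.
have le' : (len g1' + len (a * g2)%g <= len (g1' * (a * g2))%g + k)%N.
  have h := leq_add (leqnn (len g1')) l2.
  by rewrite -gE -ltnS; apply: (leq_ltn_trans h); rewrite -addSn -l1 -addnS.
rewrite {1}gE; apply: le_trans (CP p _ _ le') _; apply: (conc _ s1); rewrite ?fat_ge0 //.
- by rewrite lerDl !mulr_ge0.
- have -> : g1' = (1 * g1 * a^-1)%g by rewrite E1 mul1g mulgK.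
  by apply: fat_shift => //; rewrite len_inv; apply: leq_trans la _.
have -> : (a * g2)%g = (a * g2 * 1)%g by rewrite mulg1.
by apply: fat_shift => //; apply: leq_trans la _.
Qed.

Lemma fat_cut (K0 kappa : nat) : exists (K : nat) (C : R), 0 <= C /\ forall p g1 g2,
  (len g1 + len g2 <= len (g1 * g2)%g + kappa)%N ->
  fat p K0 (g1 * g2)%g <= C * fat p K g1 * fat p K g2.
Proof.
have [K [C [C0 CP]]] := green_cut (kappa + 4 * K0).
pose s : R := (size (ball G K) ^ 2)%:R; pose n : R := (size (ball G K0))%:R.
exists (K + K0)%N, (n * n * (C * s * s)); split; first by rewrite !mulr_ge0.
move=> p g1 g2 le; set f1 := fat p (K + K0) g1; set f2 := fat p (K + K0) g2.
have f10 : 0 <= f1 := fat_ge0 _ _ _; have f20 : 0 <= f2 := fat_ge0 _ _ _.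
have cst (A : R) : n * A = \sum_(i <- ball G K0) A.
  by rewrite big_const_seq iter_addr_0 count_predT mulr_natl.
have -> : n * n * (C * s * s) * f1 * f2 = n * (n * (C * (s * f1) * (s * f2))) by ring.
rewrite cst /fat [leLHS]big_seq [leRHS]big_seq; apply: ler_sum => a; rewrite mem_ball => aK.
rewrite cst [leLHS]big_seq [leRHS]big_seq; apply: ler_sum => b; rewrite mem_ball => bK.
have -> : (a * (g1 * g2) * b = (a * g1) * (g2 * b))%g by rewrite !mulgA.
apply: le_trans (CP p _ _ _) _.
  have h1 := len_mul a g1; have h2 := len_mul g2 b.
  have h3 := len_mul a^-1%g (a * (g1 * g2))%g; rewrite mulKg len_inv in h3.
  have h4 := len_mul (a * (g1 * g2) * b)%g b^-1%g; rewrite mulgK len_inv in h4.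
  have -> : ((a * g1) * (g2 * b) = a * (g1 * g2) * b)%g by rewrite !mulgA.
  have aux l1 l2 q1 q2 u y z ka kb : (q1 <= ka + l1 -> q2 <= l2 + kb -> u <= ka + y ->
    y <= z + kb -> ka <= K0 -> kb <= K0 -> l1 + l2 <= u + kappa ->
    q1 + q2 <= z + (kappa + 4 * K0))%N by lia.
  exact: (aux _ _ _ _ _ _ _ _ _ h1 h2 h3 h4 aK bK le).
have ha : fat p K (a * g1)%g <= s * f1.
  by have := @fat_shift p K K0 a 1%g g1 aK isT; rewrite mulg1.
have hb : fat p K (g2 * b)%g <= s * f2.
  by have := @fat_shift p K K0 1%g b g2 isT bK; rewrite mul1g.
by apply: ler_pM; rewrite ?mulr_ge0 ?fat_ge0 // ler_wpM2l.
Qed.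

(** Cutting an almost geodesic product at all its joints. *)
Lemma fat_chain (n K0 kappa : nat) : exists (K : nat) (C : R), 0 <= C /\
  forall p (gs : seq Gam), size gs = n.+1 ->
  (\sum_(g <- gs) len g <= len (\prod_(g <- gs) g)%g + kappa)%N ->
  fat p K0 (\prod_(g <- gs) g)%g <= C * \prod_(g <- gs) fat p K g.
Proof.
elim: n K0 => [|n IH] K0.
  exists K0, 1; split=> // p [|g [|]] // _ _.
  by rewrite !big_seq1 mul1r.
have [K1 [C1 [C10 C1P]]] := fat_cut K0 kappa; have [K2 [C2 [C20 C2P]]] := IH K1.
pose s1 : R := (size (ball G K1) ^ 2)%:R; pose s2 : R := (size (ball G K2) ^ 2)%:R ^+ n.+1.
exists (K1 + K2)%N, (C1 * s1 * (C2 * s2)); split; first by rewrite !mulr_ge0 ?exprn_ge0.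
move=> p [|g gs] // [sz]; rewrite !big_cons => le.
have le_sub : (len (\prod_(h <- gs) h)%g <= \sum_(h <- gs) len h)%N.
  elim: (gs) => [|h hs IHh]; first by rewrite !big_nil.
  by rewrite !big_cons; apply: leq_trans (len_mul _ _) _; rewrite leq_add2l.
have lm := len_mul g (\prod_(h <- gs) h)%g.
apply: le_trans (C1P p _ _ _) _; first by apply: leq_trans le; rewrite leq_add2l.
have h2 : fat p K1 (\prod_(h <- gs) h)%g <= C2 * s2 * \prod_(h <- gs) fat p (K1 + K2) h.
  apply: le_trans (C2P p gs sz _) _.
    by rewrite -(leq_add2l (len g)) addnA; apply: leq_trans le _; rewrite leq_add2r.
  rewrite -mulrA ler_wpM2l // /s2 -sz; elim: (gs) => [|h hs IHh].
    by rewrite !big_nil expr0 mul1r.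
  rewrite !big_cons /= exprS mulrACA; apply: ler_pM; rewrite ?fat_ge0 ?prodr_ge0 //.
    by move=> *; apply: fat_ge0.
  by rewrite addnC; apply: fat_mono.
have h1 : fat p K1 g <= s1 * fat p (K1 + K2) g by apply: fat_mono.
have P0 : 0 <= \prod_(h <- gs) fat p (K1 + K2) h by apply: prodr_ge0 => *; apply: fat_ge0.
apply: (@le_trans _ _ (C1 * (s1 * fat p (K1 + K2) g) *
   (C2 * s2 * \prod_(h <- gs) fat p (K1 + K2) h))).
  by apply: ler_pM; rewrite ?mulr_ge0 ?fat_ge0 // ler_wpM2l.
by rewrite le_eqVlt; apply/orP; left; apply/eqP; ring.
Qed.

End GreenFunction.

(** ** Square-summability *)

Section L2.
Variables (R : realType) (Gam : groupType).
Local Notation galg := (galg R Gam).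
Implicit Types (x y : galg).

Definition sqnorm y : R := \sum_(g <- finsupp y) normc (y g) ^+ 2.

Lemma sqnorm_ge0 y : 0 <= sqnorm y.
Proof. by apply: sumr_ge0 => g _; apply: sqr_ge0. Qed.

Lemma sum_le_sqnorm y (s : seq Gam) : uniq s ->
  \sum_(g <- s) normc (y g) ^+ 2 <= sqnorm y.
Proof.
move=> us; rewrite (bigID (fun g => g \in finsupp y)) /= [X in _ + X]big1 ?addr0; last first.
  by move=> g /fsfun_dflt ->; rewrite normc0 expr0n.
rewrite -big_filter /sqnorm.
rewrite [leRHS](bigID (fun g => g \in s)) /= -[X in _ <= X + _]big_filter.
have -> : \sum_(i <- [seq i <- finsupp y | i \in s]) normc (y i) ^+ 2 =
          \sum_(i <- [seq i <- s | i \in finsupp y]) normc (y i) ^+ 2.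
  apply: perm_big; apply: uniq_perm; rewrite ?filter_uniq ?fset_uniq // => g.
  by rewrite !mem_filter andbC.
by rewrite lerDl; apply: sumr_ge0 => g _; apply: sqr_ge0.
Qed.

Lemma sqrte_le (e : \bar R) (a : R) : (0 <= e)%E -> (sqrte e <= a%:E)%E -> (e <= (a ^+ 2)%:E)%E.
Proof.
case: e => [r| |] //=; rewrite !lee_fin => r0 ra.
by rewrite -(sqr_sqrtr r0) lerXn2r // nnegrE ?sqrtr_ge0 // (le_trans _ ra) // sqrtr_ge0.
Qed.

(** A finitely supported function is, after normalization, an admissible vector
    in the definition of the operator norm. *)
Lemma sqnorm_mul x y (a : R) : lreg_opnorm x = a%:E -> sqnorm (x * y) <= a ^+ 2 * sqnorm y.
Proof.
move=> xa; have [y0|yN] := eqVneq (sqnorm y) 0.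
  have yz g : y g = 0.
    have [gy|/fsfun_dflt //] := boolP (g \in finsupp y).
    move/eqP: y0; rewrite /sqnorm psumr_eq0; last by move=> *; apply: sqr_ge0.
    by move=> /allP/(_ g gy) /=; rewrite sqrf_eq0 => /eqP/eq0_normc.
  rewrite y0 mulr0 /sqnorm big1 // => g _.
  rewrite -[(x * y) g]/(galg_mul x y g) galg_mulE big1 ?normc0 ?expr0n // => h _.
  by rewrite yz mulr0.
have y_gt0 : 0 < sqnorm y by rewrite lt_def yN sqnorm_ge0.
pose v := Num.sqrt (sqnorm y); have v0 : 0 < v by rewrite sqrtr_gt0.
have v2 : v ^+ 2 = sqnorm y by rewrite sqr_sqrtr // ltW.
pose f h : R[i] := (v^-1)%:C * y h.
have fn h : normc (f h) ^+ 2 = v ^- 2 * normc (y h) ^+ 2.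
  by rewrite normcM exprMn normc_real real_normK ?num_real // exprVn.
have f1 : (l2norm f <= 1)%E.
  rewrite /l2norm; have : (\esum_(h in [set: Gam]) (normc (f h) ^+ 2)%:E <= 1%:E)%E.
    apply: ge_ereal_sup => _ [A [fA _] <-].
    rewrite fsbig_finite //= sumEFin lee_fin; under eq_bigr do rewrite fn.
    rewrite -mulr_sumr mulrC ler_pdivrMr ?exprn_gt0 // mul1r v2.
    by apply: sum_le_sqnorm; apply: fset_uniq.
  case: (\esum_(h in _) _)%E => [r| |] //=; rewrite ?lee_fin // => r1.
  by rewrite -[leRHS]sqrtr1 ler_wsqrtr.
have : (l2norm (lreg x f) <= a%:E)%E.
  by rewrite -xa; apply: ereal_sup_ubound; exists f.
rewrite /l2norm => /sqrte_le => /(_ (esum_ge0 _)) h.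
have {h} : (\esum_(h in [set: Gam]) (normc (lreg x f h) ^+ 2)%:E <= (a ^+ 2)%:E)%E.
  by apply: h => g _; rewrite lee_fin sqr_ge0.
have lE h : normc (lreg x f h) ^+ 2 = v ^- 2 * normc ((x * y) h) ^+ 2.
  have -> : lreg x f h = (v^-1)%:C * (x * y) h.
    rewrite -[(x * y) h]/(galg_mul x y h) galg_mulE /lreg mulr_sumr.
    by apply: eq_bigr => g _; rewrite /f mulrCA.
  by rewrite normcM exprMn normc_real real_normK ?num_real // exprVn.
move=> le; rewrite -v2 mulrC -ler_pdivrMl ?exprn_gt0 //.
rewrite -lee_fin; apply: le_trans le.
have -> : (v ^+ 2)^-1 * sqnorm (x * y) = \sum_(g <- finsupp (x * y)) normc (lreg x f g) ^+ 2.
  by rewrite /sqnorm mulr_sumr; apply: eq_bigr => g _; rewrite lE.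
apply: esum_ge; exists [set` finsupp (x * y)]%classic; first by split=> //; apply: finite_fset.
by rewrite fsbig_finite ?finite_fset //= set_fsetK sumEFin.
Qed.

Lemma sqnorm_pow x (a : R) t : lreg_opnorm x = a%:E -> sqnorm (x ^+ t) <= a ^+ (t * 2).
Proof.
move=> xa; elim: t => [|t IH].
  rewrite mul0n !expr0 /sqnorm.
  rewrite (eq_bigr (fun g : Gam => (g == 1%g)%:R)); last first.
    by move=> g _; rewrite -[(1 : galg) g]/(galg_one R Gam g) galg_oneE; case: eqP; rewrite ?normc1 ?normc0 ?expr1n ?expr0n.
  have -> : finsupp (1 : galg) = [fset 1%g]%fset.
    apply/fsetP=> g; rewrite mem_finsupp -[(1 : galg) g]/(galg_one R Gam g) galg_oneE in_fset1.
    by rewrite pnatr_eq0 eqb0 negbK.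
  by rewrite big_seq_fset1 eqxx.
rewrite exprS mulSn exprD; apply: le_trans (sqnorm_mul _ xa) _.
by rewrite ler_wpM2l // sqr_ge0.
Qed.

End L2.

Lemma jensen_sq (R : realType) (I : Type) (r : seq I) (w b : I -> R) : (forall i, 0 <= w i) ->
  (\sum_(i <- r) w i * b i) ^+ 2 <= (\sum_(i <- r) w i) * \sum_(i <- r) w i * b i ^+ 2.
Proof.
move=> w0; rewrite -subr_ge0.
elim: r => [|i r IH]; first by rewrite !big_nil expr0n mul0r subrr.
rewrite !big_cons; set S := \sum_(j <- r) w j * b j in IH *.
set W := \sum_(j <- r) w j in IH *; set Q := \sum_(j <- r) _ * _ ^+ 2 in IH *.
have key : 0 <= W * b i ^+ 2 + Q - 2 * b i * S.
  have -> : W * b i ^+ 2 + Q - 2 * b i * S = \sum_(j <- r) w j * (b i - b j) ^+ 2.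
    rewrite /W /Q /S mulr_suml mulr_sumr -big_split /= -sumrB.
    by apply: eq_bigr => j _; ring.
  by apply: sumr_ge0 => j _; rewrite mulr_ge0 ?sqr_ge0.
have -> : (w i + W) * (w i * b i ^+ 2 + Q) - (w i * b i + S) ^+ 2 =
   (W * Q - S ^+ 2) + w i * (W * b i ^+ 2 + Q - 2 * b i * S) by ring.
by rewrite addr_ge0 // mulr_ge0.
Qed.

(** * Summing Green's function over conjugates, powers and dihedral elements *)

(** Square-summability, tested on finite sets of indices. *)
Definition sq_bounded (R : realType) (I : eqType) (F : I -> R) (B : R) : Prop :=
  forall s : seq I, uniq s -> \sum_(g <- s) F g ^+ 2 <= B.

Section Sums.
Variable R : realType.

Lemma sq_bounded_ge0 (I : eqType) (F : I -> R) B : sq_bounded F B -> 0 <= B.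
Proof. by move=> /(_ [::] isT); rewrite big_nil. Qed.

Lemma sq_bounded_le (I : eqType) (F : I -> R) B g : sq_bounded F B -> F g <= 1 + B.
Proof.
move=> FB; have := FB [:: g] isT; rewrite big_seq1.
by have := sqr_ge0 (F g - 1); nra.
Qed.

Lemma sum_mul_le (I J J' : eqType) (s : seq I) (d : I -> J) (d' : I -> J')
    (F : J -> R) (F' : J' -> R) (B B' : R) :
  uniq s -> {in s &, injective d} -> {in s &, injective d'} ->
  sq_bounded F B -> sq_bounded F' B' ->
  \sum_(i <- s) F (d i) * F' (d' i) <= B + B'.
Proof.
move=> us di di' FB FB'.
apply: (@le_trans _ _ (\sum_(i <- s) (F (d i) ^+ 2 + F' (d' i) ^+ 2))).
  apply: ler_sum => i _; have := sqr_ge0 (F (d i) - F' (d' i)).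
  by have := sqr_ge0 (F (d i)); have := sqr_ge0 (F' (d' i)); nra.
rewrite big_split /= -(big_map d xpredT (fun j => F j ^+ 2)).
rewrite -(big_map d' xpredT (fun j => F' j ^+ 2)).
by apply: lerD; [apply: FB|apply: FB']; rewrite map_inj_in_uniq.
Qed.

(** Enlarging a finite set of pairs to a product of two finite sets. *)
Lemma sum_pairs_le (A B : eqType) (s : seq (A * B)) (f : A -> R) (g : B -> R) :
  uniq s -> (forall a, 0 <= f a) -> (forall b, 0 <= g b) ->
  \sum_(p <- s) f p.1 * g p.2
  <= (\sum_(a <- undup (unzip1 s)) f a) * (\sum_(b <- undup (unzip2 s)) g b).
Proof.
move=> us f0 g0; set t := [seq (a, b) | a <- undup (unzip1 s), b <- undup (unzip2 s)].
have -> : (\sum_(a <- undup (unzip1 s)) f a) * (\sum_(b <- undup (unzip2 s)) g b) =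
    \sum_(p <- t) f p.1 * g p.2.
  by rewrite /t big_allpairs mulr_suml; apply: eq_bigr => a _; rewrite mulr_sumr.
have ut : uniq t by apply: allpairs_uniq; rewrite ?undup_uniq // => -[a b] [a' b'] _ _ [-> ->].
rewrite [leRHS](bigID (fun p => p \in s)) /= -[X in _ <= X + _]big_filter.
have -> : \sum_(p <- [seq p <- t | p \in s]) f p.1 * g p.2 = \sum_(p <- s) f p.1 * g p.2.
  apply: perm_big; apply: uniq_perm; rewrite ?filter_uniq // => -[a b].
  rewrite mem_filter; case: (boolP ((a, b) \in s)) => //= ps.
  apply/allpairsP; exists (a, b); rewrite /= !mem_undup; split=> //.
    by apply/mapP; exists (a, b).
  by apply/mapP; exists (a, b).
by rewrite lerDl; apply: sumr_ge0 => p _; rewrite mulr_ge0.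
Qed.

End Sums.

Lemma choice_in (I : eqType) (D : Type) (d0 : D) (s : seq I) (P : I -> D -> Prop) :
  (forall i, i \in s -> exists d, P i d) -> exists f : I -> D, forall i, i \in s -> P i (f i).
Proof.
move=> sP; have ex i : exists d, i \in s -> P i d.
  by have [/sP[d]|] := boolP (i \in s); [exists d|exists d0].
by have [f fP] := choice ex; exists f.
Qed.

Section GreenSums.
Variables (R : realType) (m : nat) (G : 'I_m -> finGroupType).
Local Notation Gam := (free_product G).
Variables (x : galg R Gam) (lam M : R).
Hypothesis x_norm : lreg_opnorm x = lam%:E.
Hypotheses (lam_ge0 : 0 <= lam) (lam_M : lam < M).

Let M_gt0 : 0 < M. Proof. exact: le_lt_trans lam_M. Qed.
Local Notation green := (green x M).
Local Notation fat := (fat x M).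

(** The powers of [x] have l2 norm at most [lam ^ t]; as [lam < M], the weights
    in [green] decrease geometrically. *)
Lemma green_sq : exists B : R, forall p, sq_bounded (green p) B.
Proof.
(* any ratio with [lam / M <= q < 1] *)
pose q := (lam + M) / (2 * M).
have q0 : 0 < q by rewrite divr_gt0 ?mulr_gt0 // ltr_wpDl.
have q1 : q < 1 by rewrite ltr_pdivrMr ?mulr_gt0 // mul1r mulr_natl mulr2n ltrD2r.
have lq : lam <= q * M.
  have -> : q * M = (lam + M) / 2 by rewrite /q; field; rewrite gt_eqF.
  by rewrite ler_pdivlMr // mulr_natr mulr2n lerD2l ltW.
pose W := (1 - q)^-1; exists (W * W) => p s us.
have geo : \sum_(t < p.+1) q ^+ t <= W.
  rewrite /W -[leRHS]mul1r ler_pdivlMr ?subr_gt0 //.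
  by rewrite mulrC -opprB mulNr -subrX1 opprB gerBl exprn_ge0 // ltW.
have W0 : 0 <= W by rewrite invr_ge0 subr_ge0 ltW.
pose b g (t : 'I_p.+1) := q ^- t * (M ^- t * normc ((x ^+ t) g)).
have gE g : green p g = \sum_(t < p.+1) q ^+ t * b g t.
  by apply: eq_bigr => t _; rewrite /b mulVKf // expf_neq0 // gt_eqF.
have qt0 (t : nat) : 0 <= q ^+ t by rewrite exprn_ge0 // ltW.
apply: (@le_trans _ _ (\sum_(g <- s) W * \sum_(t < p.+1) q ^+ t * b g t ^+ 2)).
  apply: ler_sum => g _; rewrite gE.
  apply: le_trans (jensen_sq _ _ _) _ => //; rewrite ler_wpM2r //.
  by apply: sumr_ge0 => t _; rewrite mulr_ge0 ?sqr_ge0.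
rewrite -mulr_sumr ler_wpM2l // exchange_big /=.
apply: le_trans geo; apply: ler_sum => t _.
have -> : \sum_(g <- s) q ^+ t * b g t ^+ 2 =
    q ^- t * M ^- (t * 2) * \sum_(g <- s) normc ((x ^+ t) g) ^+ 2.
  rewrite mulr_sumr; apply: eq_bigr => g _; rewrite /b exprM.
  by field; rewrite !expf_neq0 ?gt_eqF.
apply: (@le_trans _ _ (q ^- t * M ^- (t * 2) * (q * M) ^+ (t * 2))).
  apply: ler_wpM2l; first by rewrite mulr_ge0 ?invr_ge0 ?exprn_ge0 // ltW.
  apply: le_trans (sum_le_sqnorm _ us) _; apply: le_trans (sqnorm_pow t x_norm) _.
  by rewrite lerXn2r // nnegrE mulr_ge0 // ltW.
rewrite le_eqVlt; apply/orP; left; apply/eqP; rewrite [(q * M) ^+ _]exprMn !exprM.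
have : q ^+ t != 0 by rewrite expf_neq0 // gt_eqF.
have : M ^+ t != 0 by rewrite expf_neq0 // gt_eqF.
by move: (q ^+ t) (M ^+ t) => Q N N0 Q0; field; rewrite N0.
Qed.

(** Translations preserve the l2 norm. *)
Lemma fat_sq K : exists B : R, forall p, sq_bounded (fat p K) B.
Proof.
have [B BP] := green_sq; pose n : R := (size (ball G K))%:R.
have cst (A : R) : \sum_(i <- ball G K) A = n * A.
  by rewrite big_const_seq iter_addr_0 count_predT mulr_natl.
exists (n * (n * (n * (n * B)))) => p s us.
have J (F : Gam -> R) : (\sum_(a <- ball G K) F a) ^+ 2 <= n * \sum_(a <- ball G K) F a ^+ 2.
  have := @jensen_sq R _ (ball G K) (fun=> 1) F (fun=> ler01).
  rewrite cst mulr1; under eq_bigr do rewrite mul1r.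
  by under [X in _ <= _ * X -> _]eq_bigr do rewrite mul1r.
apply: (@le_trans _ _ (\sum_(g <- s) n * \sum_(a <- ball G K) (n * \sum_(b <- ball G K)
    green p (a * g * b)%g ^+ 2))).
  apply: ler_sum => g _; apply: le_trans (J _) _; rewrite ler_wpM2l //.
  by apply: ler_sum => a _; apply: J.
rewrite -mulr_sumr ler_wpM2l // exchange_big /= -cst; apply: ler_sum => a _.
rewrite -mulr_sumr ler_wpM2l // exchange_big /= -cst; apply: ler_sum => b _.
rewrite -(big_map (fun g => (a * g * b)%g) xpredT (fun h => green p h ^+ 2)).
by apply: BP; rewrite map_inj_uniq // => g h /mulIg/mulgI.
Qed.

Lemma green_chain n kappa : exists (K : nat) (C : R), 0 <= C /\
  forall p g (gs : seq Gam), size gs = n.+1 -> g = (\prod_(h <- gs) h)%g ->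
  (\sum_(h <- gs) len h <= len g + kappa)%N ->
  green p g <= C * \prod_(h <- gs) fat p K h.
Proof.
have [K [C [C0 CP]]] := fat_chain x M_gt0 n 0 kappa.
exists K, C; split=> // p g gs sz -> le; apply: le_trans (CP p gs sz le).
exact: green_le_fat1.
Qed.

Lemma inv_sq_bounded (F : Gam -> R) B : sq_bounded F B -> sq_bounded (fun g => F g^-1%g) B.
Proof.
move=> FB s us; rewrite -(big_map (fun g => g^-1%g) xpredT (fun h => F h ^+ 2)).
by apply: FB; rewrite map_inj_uniq //; apply: invg_inj.
Qed.

Lemma sum_wV_le (F : Gam -> R) (B : R) (s : seq Gam) : uniq s -> sq_bounded F B ->
  \sum_(w <- s) F w * F w^-1%g <= B + B.
Proof.
move=> us FB.
by apply: (sum_mul_le (d := id) (d' := id) us _ _ FB (inv_sq_bounded FB)) => ? ? _ _.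
Qed.

Definition conj_type (c g : Gam) : Prop :=
  exists w : Gam, g = (w * c * w^-1)%g /\ (2 * len w + len c <= len g + 1)%N.

(** The parameter [w] occurs in [w c w^-1] twice. *)
Lemma sum_conj_type c : exists C : R, 0 <= C /\ forall p (s : seq Gam), uniq s ->
  (forall g, g \in s -> conj_type c g) -> \sum_(g <- s) green p g <= C.
Proof.
have [K [C [C0 CP]]] := green_chain 2 1; have [B BP] := fat_sq K.
have B0 : 0 <= B := sq_bounded_ge0 (BP 0%N).
exists (C * (1 + B) * (B + B)); split; first by rewrite !mulr_ge0 ?addr_ge0.
move=> p s us sT.
have [w wP] : exists w : Gam -> Gam, forall g, g \in s ->
    g = (w g * c * (w g)^-1)%g /\ (2 * len (w g) + len c <= len g + 1)%N.
  exact: (choice_in 1%g sT).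
have wi : {in s &, injective w}.
  by move=> g h gs hs E; have [-> _] := wP g gs; have [-> _] := wP h hs; rewrite E.
apply: (@le_trans _ _ (C * (1 + B) * \sum_(g <- s) fat p K (w g) * fat p K (w g)^-1%g)).
  rewrite mulr_sumr [leLHS]big_seq [leRHS]big_seq; apply: ler_sum => g gs.
  have [E le] := wP g gs.
  have := CP p g [:: w g; c; (w g)^-1%g] erefl; rewrite !big_cons !big_nil mulg1 mulgA mulr1.
  rewrite len_inv => /(_ E) h; apply: le_trans (h _) _; first by move: le; lia.
  have fc := sq_bounded_le c (BP p).
  rewrite -[leRHS]mulrA ler_wpM2l // mulrCA ler_wpM2r // mulr_ge0 //; exact: fat_ge0.
rewrite ler_wpM2l ?mulr_ge0 ?addr_ge0 //.
exact: (sum_mul_le us wi wi (BP p) (inv_sq_bounded (BP p))).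
Qed.

Definition power_type (q : nat) (g : Gam) : Prop :=
  exists d : Gam * Gam, [/\ (2 <= q)%N, len (d.2 ^+ q)%g = (q * len d.2)%N,
    g = (d.1 * d.2 ^+ q * d.1^-1)%g & (2 * len d.1 + q * len d.2 <= len g + 1)%N].

Lemma len_expg (v : Gam) n : (len (v ^+ n)%g <= n * len v)%N.
Proof.
elim: n => [|n IH]; first by rewrite expg0.
by rewrite expgS mulSn; apply: leq_trans (len_mul _ _) _; rewrite leq_add2l.
Qed.

Lemma wmul_size_cat (v w : seq (letter G)) : reduced v -> reduced w ->
  size (wmul v w) = (size v + size w)%N -> wmul v w = v ++ w.
Proof.
elim: v => //= a v IH rv rw sz.
have szv : size (wmul v w) = (size v + size w)%N.
  by have [_ h] := size_lmul a (wmul v w); have := size_wmul v w; move: h; rewrite sz; lia.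
move: sz; rewrite IH // ?(reduced_cons rv) // addSn -size_cat.
rewrite /lmul /consred; case: (v ++ w) => [|b s]; case: ifP => //=.
  by move=> _; case: ifP => _ /= h; exfalso; move: h; clear; lia.
by move=> _; case: ifP => // _ /= h; exfalso; move: h; clear; lia.
Qed.

(** [v] is the initial segment of [v ^ (q - 1)]. *)
Lemma power_root (q : nat) (v v' : Gam) : (2 <= q)%N ->
  len (v ^+ q)%g = (q * len v)%N -> len (v' ^+ q)%g = (q * len v')%N ->
  (v ^+ q.-1)%g = (v' ^+ q.-1)%g -> v = v'.
Proof.
case: q => [|[|n]] // _ /=.
have lenS (u : Gam) : len (u ^+ n.+2)%g = (n.+2 * len u)%N ->
    len (u ^+ n.+1)%g = (n.+1 * len u)%N /\ val u = take (len u) (val (u ^+ n.+1)%g).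
  move=> h; have l1 : len (u ^+ n.+1)%g = (n.+1 * len u)%N.
    have := len_expg u n.+1; have := len_mul u (u ^+ n.+1)%g.
    by rewrite -(expgS u n.+1) h; clear; rewrite !mulSn; lia.
  split=> //; rewrite expgS val_mul wmul_size_cat ?take_size_cat //; try exact: valP.
  have := len_expg u n; have := len_mul u (u ^+ n)%g; rewrite -expgS l1 => h1 h2.
  by apply/eqP; rewrite -/(len u) -/(len (u ^+ n)%g) -val_mul -expgS -/(len _) l1; lia.
move=> /lenS[l1 e1] /lenS[l2 e2] E; apply: val_inj; rewrite e1 e2 E.
have : (n.+1 * len v)%N = (n.+1 * len v')%N by rewrite -l1 -l2 E.
by move=> /eqP; rewrite eqn_pmul2l // => /eqP ->.
Qed.

(** Splitting [v ^ q] as [v] times [v ^ (q - 1)] makes the parameter [v] occur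
    exactly twice, each time injectively, so that the bound does not depend on
    [q]. *)
Lemma sum_power_type : exists C : R, 0 <= C /\ forall q p (s : seq Gam), uniq s ->
  (forall g, g \in s -> power_type q g) -> \sum_(g <- s) green p g <= C.
Proof.
have [K [C [C0 CP]]] := green_chain 3 1; have [B BP] := fat_sq K.
have B0 : 0 <= B := sq_bounded_ge0 (BP 0%N).
exists (C * ((B + B) * (B + B))); split; first by rewrite !mulr_ge0 ?addr_ge0.
move=> q p s us sT.
have [d dP] : exists d : Gam -> Gam * Gam, forall g, g \in s ->
    [/\ (2 <= q)%N, len ((d g).2 ^+ q)%g = (q * len (d g).2)%N,
      g = ((d g).1 * (d g).2 ^+ q * (d g).1^-1)%g &
      (2 * len (d g).1 + q * len (d g).2 <= len g + 1)%N].
  exact: (choice_in (1%g, 1%g) sT).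
have di : {in s &, injective d}.
  by move=> g h gs hs E; have [_ _ -> _] := dP g gs; have [_ _ -> _] := dP h hs; rewrite E.
pose F1 w := fat p K w * fat p K w^-1%g.
pose F2 v := fat p K v * fat p K (v ^+ q.-1)%g.
have F10 w : 0 <= F1 w by rewrite mulr_ge0 ?fat_ge0.
have F20 v : 0 <= F2 v by rewrite mulr_ge0 ?fat_ge0.
apply: (@le_trans _ _ (C * \sum_(g <- s) F1 (d g).1 * F2 (d g).2)).
  rewrite mulr_sumr [leLHS]big_seq [leRHS]big_seq; apply: ler_sum => g gs.
  have [q2 lq E le] := dP g gs; set w := (d g).1 in lq E le *; set v := (d g).2 in lq E le *.
  have := CP p g [:: w; v; (v ^+ q.-1)%g; w^-1%g] erefl.
  rewrite !big_cons !big_nil mulg1 mulr1 len_inv.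
  have -> : (w * (v * (v ^+ q.-1 * w^-1)) = w * v ^+ q * w^-1)%g.
    by rewrite !mulgA -[in RHS](prednK (ltnW q2)) expgS mulgA.
  move=> /(_ E) h; apply: le_trans (h _) _.
    have := len_expg v q.-1; rewrite -subn1 mulnBl mul1n => h'.
    have : (len v <= q * len v)%N by rewrite leq_pmull // ltnW.
    by move: h' le; rewrite subn1; lia.
  by rewrite ler_wpM2l // /F1 /F2 le_eqVlt; apply/orP; left; apply/eqP; ring.
rewrite ler_wpM2l // -(big_map d xpredT (fun d => F1 d.1 * F2 d.2)).
apply: le_trans (sum_pairs_le _ F10 F20) _; first by rewrite map_inj_in_uniq.
apply: ler_pM; rewrite ?sumr_ge0 //.
  exact: (sum_wV_le (undup_uniq _) (BP p)).
apply: (sum_mul_le (d := id) (d' := fun v : Gam => (v ^+ q.-1)%g) (undup_uniq _) _ _ (BP p) (BP p)).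
  by move=> ? ?.
have lv (v : Gam) : v \in undup (unzip2 [seq d i | i <- s]) -> (2 <= q)%N /\ len (v ^+ q)%g = (q * len v)%N.
  rewrite mem_undup => /mapP[_ /mapP[g gs ->] ->]; by have [] := dP g gs.
by move=> v v' /lv[q2 h] /lv[_ h']; apply: power_root.
Qed.

Definition dihedral_type (ab : letter G * letter G) (g : Gam) : Prop :=
  exists d : Gam * (Gam * Gam),
    g = (d.1 * (d.2.1 * letter_elt ab.1 * d.2.1^-1 * (d.2.2 * letter_elt ab.2 * d.2.2^-1))
         * d.1^-1)%g
    /\ (2 * len d.1 + 2 * len d.2.1 + 2 * len d.2.2 + 2 <= len g + 1)%N.

(** Each of the three parameters [w], [y], [z] occurs together with its inverse. *)
Lemma sum_dihedral_type ab : exists C : R, 0 <= C /\ forall p (s : seq Gam), uniq s ->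
  (forall g, g \in s -> dihedral_type ab g) -> \sum_(g <- s) green p g <= C.
Proof.
have [K [C [C0 CP]]] := green_chain 7 1; have [B BP] := fat_sq K.
have B0 : 0 <= B := sq_bounded_ge0 (BP 0%N).
exists (C * (1 + B) * (1 + B) * ((B + B) * ((B + B) * (B + B)))).
split; first by rewrite !mulr_ge0 ?addr_ge0.
move=> p s us sT; set a := letter_elt ab.1; set b := letter_elt ab.2.
have [d dP] : exists d : Gam -> Gam * (Gam * Gam), forall g, g \in s ->
    g = ((d g).1 * ((d g).2.1 * a * (d g).2.1^-1 * ((d g).2.2 * b * (d g).2.2^-1)) * (d g).1^-1)%g
    /\ (2 * len (d g).1 + 2 * len (d g).2.1 + 2 * len (d g).2.2 + 2 <= len g + 1)%N.
  exact: (choice_in (1%g, (1%g, 1%g)) sT).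
have di : {in s &, injective d}.
  by move=> g h gs hs E; have [-> _] := dP g gs; have [-> _] := dP h hs; rewrite E.
pose F1 w := fat p K w * fat p K w^-1%g.
have F10 w : 0 <= F1 w by rewrite mulr_ge0 ?fat_ge0.
apply: (@le_trans _ _ (C * (1 + B) * (1 + B) *
    \sum_(g <- s) F1 (d g).1 * (F1 (d g).2.1 * F1 (d g).2.2))).
  rewrite mulr_sumr [leLHS]big_seq [leRHS]big_seq; apply: ler_sum => g gs.
  have [E le] := dP g gs; move: (d g).1 (d g).2.1 (d g).2.2 E le => w y z E le.
  have := CP p g [:: w; y; a; y^-1%g; z; b; z^-1%g; w^-1%g] erefl.
  rewrite !big_cons !big_nil mulg1 mulr1 !len_inv.
  have -> : (w * (y * (a * (y^-1 * (z * (b * (z^-1 * w^-1)))))) =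
     w * (y * a * y^-1 * (z * b * z^-1)) * w^-1)%g by rewrite !mulgA.
  move=> /(_ E) h; apply: le_trans (h _) _.
    have := len_letter ab.1; have := len_letter ab.2; rewrite -/a -/b.
    by move: le; lia.
  have fa := sq_bounded_le a (BP p); have fb := sq_bounded_le b (BP p).
  have -> : C * (1 + B) * (1 + B) * (F1 w * (F1 y * F1 z)) =
    C * (((1 + B) * (1 + B)) * (F1 w * (F1 y * F1 z))) by ring.
  rewrite ler_wpM2l //.
  apply: (@le_trans _ _ ((fat p K a * fat p K b) * (F1 w * (F1 y * F1 z)))).
    by rewrite /F1 le_eqVlt; apply/orP; left; apply/eqP; ring.
  apply: ler_wpM2r; first by rewrite !mulr_ge0 ?fat_ge0.
  by apply: ler_pM; rewrite ?fat_ge0.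
rewrite ler_wpM2l ?mulr_ge0 ?addr_ge0 //.
rewrite -(big_map d xpredT (fun d => F1 d.1 * (F1 d.2.1 * F1 d.2.2))).
apply: le_trans (@sum_pairs_le _ _ _ _ F1 (fun yz => F1 yz.1 * F1 yz.2) _ F10 _) _.
- by rewrite map_inj_in_uniq.
- by move=> yz; rewrite mulr_ge0.
apply: ler_pM; rewrite ?sumr_ge0 //; first by move=> yz _; rewrite mulr_ge0.
  exact: (sum_wV_le (undup_uniq _) (BP p)).
apply: le_trans (sum_pairs_le (undup_uniq _) F10 F10) _.
by apply: ler_pM; rewrite ?sumr_ge0 //; apply: (sum_wV_le (undup_uniq _) (BP p)).
Qed.

End GreenSums.

(** * Temperedness *)

Lemma sum_cover_le (R : realType) (I J : eqType) (r : seq J) (s : seq I)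
    (Q : J -> I -> Prop) (f : I -> R) (B : J -> R) :
  (forall i, 0 <= f i) -> (forall i, i \in s -> exists2 j, j \in r & Q j i) ->
  (forall j, \sum_(i <- [seq i <- s | `[< Q j i >]]) f i <= B j) ->
  \sum_(i <- s) f i <= \sum_(j <- r) B j.
Proof.
move=> f0 cov QB; apply: (@le_trans _ _ (\sum_(j <- r) \sum_(i <- s | `[< Q j i >]) f i)).
  under [leRHS]eq_bigr do rewrite big_mkcond.
  rewrite exchange_big /= [leLHS]big_seq [leRHS]big_seq; apply: ler_sum => i /cov[j jr Qji].
  rewrite (big_rem _ jr) /= (introT (asboolP _) Qji) lerDl.
  by apply: sumr_ge0 => j' _; case: ifP.
by apply: ler_sum => j _; rewrite -big_filter.
Qed.

Section Temperedness.
Variables (R : realType) (m : nat) (G : 'I_m -> finGroupType).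
Local Notation Gam := (free_product G).
Variable u : nat -> Gam -> R.
Hypothesis uP : asymptotic_coefficients u.
Variable k : nat.
Hypothesis k_le : (k <= lcm_orders G)%N.

(** Writing [g] as a conjugate of a cyclically reduced element reduces the claim
    to [coefficient_cyc]; an involution is itself a conjugate of a letter. *)
Lemma coefficient_types : exists D : R, 0 <= D /\ forall g, u k g = 0 \/
  `|u k g| <= D * (len g + 2)%:R ^+ 2 /\
  [\/ exists2 c, c \in ball G 1 & conj_type c g,
      exists2 q, (q < len g + 2)%N & power_type q g |
      exists ab, dihedral_type ab g].
Proof.
have [D D0 DP] := coefficient_cyc uP.
pose E : R := \sum_(c <- ball G 1) `|u k c|.
have E0 : 0 <= E by apply: sumr_ge0.
exists (D + E); split=> [|g]; first exact: addr_ge0.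
have sq1 (n n' : nat) : (n <= n')%N -> n%:R ^+ 2 <= n'%:R ^+ 2 :> R.
  by move=> le; rewrite -!natrX ler_nat leq_exp2r.
have [w [c [gE le]]] := conj_decomp g.
have uc : u k g = u k c by rewrite gE (coefficient_conj uP).
case/orP=> [c1|cc].
  have cB : c \in ball G 1 by rewrite mem_ball.
  right; split; last by constructor 1; exists c => //; exists w.
  apply: (@le_trans _ _ E); first by rewrite uc /E (big_rem _ cB) /= lerDl sumr_ge0.
  rewrite -[leLHS]mulr1; apply: ler_pM => //; first by rewrite lerDr.
  by have := sq1 1%N (len g + 2)%N; rewrite expr1n; apply; lia.
have [ulow utop] := DP c cc.
have [kmu|muk] := ltnP k (lcm_orders G); first by left; rewrite uc ulow.
have kE : k = lcm_orders G by apply/eqP; rewrite eqn_leq k_le.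
rewrite uc kE; case: utop => [->|[cT cD]]; [by left|right]; split.
  apply: le_trans cD _; apply: ler_pM => //; first by rewrite lerDl.
  by apply: sq1; move: le; lia.
case: cT => [[v [q [q2 v0 vE vl]]]|[y [z [[yV zV] y0 z0 yz lyz]]]].
  constructor 2; exists q.
    have : (q <= q * len v)%N by rewrite leq_pmulr.
    by move: le; rewrite vl; lia.
  by exists (w, v); rewrite /= -vE -vl.
have [p1 [a [yE yl]]] := involution_decomp yV y0.
have [p2 [b [zE zl]]] := involution_decomp zV z0.
constructor 3; exists (a, b), (w, (p1, p2)); rewrite /= -yE -zE -yz; split=> //.
by move: le; rewrite lyz; lia.
Qed.

Variables (x : galg R Gam) (lam M : R).
Hypothesis x_norm : lreg_opnorm x = lam%:E.
Hypotheses (lam_ge0 : 0 <= lam) (lam_M : lam < M).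
Let M_gt0 : 0 < M. Proof. exact: le_lt_trans lam_M. Qed.

(** Up to length [l] there are finitely many types of the first and third kind,
    and at most [l + 2] of the second. *)
Lemma sum_coefficient_green : exists C : R, 0 <= C /\ forall p l (s : seq Gam), uniq s ->
  (forall g, g \in s -> (len g <= l)%N) ->
  \sum_(g <- s) `|u k g| * green x M p g <= C * (l + 2)%:R ^+ 3.
Proof.
have [D [D0 DP]] := coefficient_types.
have [Cc CcP] := choice (sum_conj_type x_norm lam_ge0 lam_M).
have [Cp [Cp0 CpP]] := sum_power_type x_norm lam_ge0 lam_M.
have [Cd CdP] := choice (sum_dihedral_type x_norm lam_ge0 lam_M).
pose A := \sum_(c <- ball G 1) Cc c; pose E := \sum_(ab : letter G * letter G) Cd ab.
have A0 : 0 <= A by apply: sumr_ge0 => c _; case: (CcP c).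
have E0 : 0 <= E by apply: sumr_ge0 => c _; case: (CdP c).
exists (D * (A + Cp + E)); split=> [|p l s us sl]; first by rewrite mulr_ge0 ?addr_ge0.
pose s' := [seq g <- s | u k g != 0].
have us' : uniq s' by rewrite filter_uniq.
have g0 := green_ge0 x M_gt0 p.
pose J : Type := Gam + (nat + letter G * letter G).
pose Q (j : J) g := match j with
  | inl c => conj_type c g | inr (inl q) => power_type q g
  | inr (inr ab) => dihedral_type ab g end.
pose B (j : J) := match j with inl c => Cc c | inr (inl q) => Cp | inr (inr ab) => Cd ab end.
pose r : seq J := map inl (ball G 1) ++ (map (inr \o inl) (iota 0 (l + 2)) ++
   map (inr \o inr) (index_enum {: letter G * letter G})).
have s'P g : g \in s' -> [/\ g \in s & u k g != 0] by rewrite mem_filter => /andP[].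
have cover : \sum_(g <- s') green x M p g <= \sum_(j <- r) B j.
  apply: (@sum_cover_le _ _ _ r s' Q) => // [g gs|j].
    have [gs1 u0] := s'P g gs; have gl := sl g gs1.
    case: (DP g) => [/eqP|[_ gT]]; first by rewrite (negPf u0).
    case: gT => [[c cB cT]|[q qB qT]|[ab abT]].
    - by exists (inl c) => //; rewrite mem_cat map_f.
    - exists (inr (inl q)) => //; rewrite !mem_cat; apply/orP; right; apply/orP; left.
      apply: (map_f (inr \o inl)); rewrite mem_iota add0n /=.
      by apply: leq_trans qB _; rewrite leq_add2r.
    - exists (inr (inr ab)) => //; rewrite !mem_cat; apply/orP; right; apply/orP; right.
      by apply: (map_f (inr \o inr)); exact: mem_index_enum.
  have uf (P : pred Gam) : uniq [seq g <- s' | P g] by rewrite filter_uniq.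
  have Pf (P : Gam -> Prop) g : g \in [seq g <- s' | `[< P g >]] -> P g.
    by rewrite mem_filter => /andP[/asboolP].
  case: j => [c|[q|ab]] /=.
  - by case: (CcP c) => _; apply=> // g /Pf.
  - by apply: (CpP q) => // g /(Pf (power_type q)).
  - by case: (CdP ab) => _; apply=> // g /Pf.
have l1 : 1 <= (l + 2)%:R :> R by rewrite ler1n addn2.
have rB : \sum_(j <- r) B j <= (A + Cp + E) * (l + 2)%:R.
  rewrite /r !big_cat !big_map /= -/A -/E big_const_seq iter_addr_0 count_predT.
  by rewrite size_iota -[Cp *+ _]mulr_natr !mulrDl addrA; do 2?apply: lerD; rewrite ?ler_peMr.
have -> : \sum_(g <- s) `|u k g| * green x M p g = \sum_(g <- s') `|u k g| * green x M p g.
  rewrite big_filter [LHS](bigID (fun g => u k g != 0)) /= [X in _ + X]big1 ?addr0 // => g.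
  by rewrite negbK => /eqP ->; rewrite normr0 mul0r.
apply: (@le_trans _ _ (\sum_(g <- s') D * (l + 2)%:R ^+ 2 * green x M p g)).
  rewrite [leLHS]big_seq [leRHS]big_seq; apply: ler_sum => g /s'P[gs u0].
  rewrite ler_wpM2r //; case: (DP g) => [/eqP|[gD _]]; first by rewrite (negPf u0).
  apply: le_trans gD _; rewrite ler_wpM2l // -!natrX ler_nat leq_exp2r //.
  by rewrite leq_add2r sl.
rewrite -mulr_sumr.
apply: (@le_trans _ _ (D * (l + 2)%:R ^+ 2 * ((A + Cp + E) * (l + 2)%:R))).
  rewrite ler_wpM2l ?mulr_ge0 ?exprn_ge0 //; exact: le_trans cover rB.
by rewrite le_eqVlt; apply/orP; left; apply/eqP; ring.
Qed.

Lemma supp_pow_len p g : g \in finsupp (x ^+ p) -> (len g <= p * supp_len x)%N.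
Proof.
elim: p g => [|p IH] g.
  by rewrite expr0 mem_finsupp galg1; have [->|] := eqVneq g 1%g; rewrite ?eqxx.
rewrite exprS mem_finsupp galgM => N.
have [[a ax ag]|] := pselect (exists2 a, a \in finsupp x & (a^-1 * g)%g \in finsupp (x ^+ p)).
  have := len_mul a (a^-1 * g)%g; rewrite mulKVg => h.
  by apply: leq_trans h _; rewrite mulSn leq_add ?supp_lenP // IH.
move=> no; case/eqP: N; rewrite big_seq big1 // => a ax.
rewrite [(x ^+ p) _]fsfun_dflt ?mulr0 //; apply/negP => ag; apply: no; by exists a.
Qed.

Lemma coefficient_pow_le : exists C : R, 0 <= C /\ forall p,
  normc (lin_ext (u k) (x ^+ p)) <= C * p.+1%:R ^+ 3 * M ^+ p.
Proof.
have [C [C0 CP]] := sum_coefficient_green; pose L := supp_len x.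
exists (C * (L + 2)%:R ^+ 3); split=> [|p]; first by rewrite mulr_ge0 ?exprn_ge0.
apply: le_trans (normc_sum _ _) _.
apply: (@le_trans _ _ (M ^+ p * \sum_(g <- finsupp (x ^+ p)) `|u k g| * green x M p g)).
  rewrite mulr_sumr; apply: ler_sum => g _.
  rewrite normcM normc_real mulrC mulrCA ler_wpM2l //.
  exact: pow_le_green.
rewrite mulrC; apply: ler_wpM2r; first by rewrite exprn_ge0 // ltW.
apply: le_trans (CP p (p * L)%N _ (fset_uniq _) (@supp_pow_len p)) _.
rewrite -mulrA ler_wpM2l // -exprMn -natrM -!natrX ler_nat leq_exp2r //.
by rewrite mulnDl !mulnS; clear; nia.
Qed.

End Temperedness.

Lemma bernoulli_ge (R : realType) (d : R) n : 0 <= d -> d * n%:R <= (1 + d) ^+ n.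
Proof.
move=> d0; suff : 1 + d * n%:R <= (1 + d) ^+ n by apply: le_trans; rewrite lerDr.
elim: n => [|n IH]; first by rewrite expr0 mulr0 addr0.
rewrite exprS; apply: le_trans (ler_wpM2l _ IH); last by rewrite addr_ge0.
have -> : (1 + d) * (1 + d * n%:R) = 1 + d * n.+1%:R + d * d * n%:R by rewrite -natr1; ring.
by rewrite lerDl !mulr_ge0.
Qed.

(** By Bernoulli's inequality applied to the fourth root. *)
Lemma cubic_le_exp (R : realType) (C d : R) : 0 <= C -> 0 < d ->
  exists n0, forall n, (n0 <= n)%N -> C * n.+1%:R ^+ 3 <= (1 + d) ^+ (4 * n.+1).
Proof.
move=> C0 d0; have [n0 n0P] : exists n0 : nat, C / d ^+ 4 <= n0%:R.
  exists (Num.trunc (C / d ^+ 4)).+1; rewrite ltW // truncnS_gt //.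
exists n0 => n le; rewrite mulnC exprM.
apply: (@le_trans _ _ ((d * n.+1%:R) ^+ 4)); last first.
  have d0' := ltW d0.
  by rewrite lerXn2r ?nnegrE ?exprn_ge0 ?mulr_ge0 ?addr_ge0 // bernoulli_ge.
rewrite exprMn [n.+1%:R ^+ 4]exprS mulrA ler_wpM2r ?exprn_ge0 //.
rewrite mulrC -ler_pdivrMr ?exprn_gt0 //; apply: le_trans n0P _.
by rewrite ler_nat; apply: leq_trans le _.
Qed.

Lemma powR_root_le (R : realType) (a b : R) p : (0 < p)%N -> 0 <= a -> 0 <= b ->
  a <= b ^+ p -> a `^ (p%:R^-1) <= b.
Proof.
move=> p0 a0 b0 ab; apply: (@le_trans _ _ ((b ^+ p) `^ (p%:R^-1))).
  by apply: ge0_ler_powR; rewrite ?nnegrE ?invr_ge0 ?exprn_ge0.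
by rewrite -powR_mulrn // -powRrM divff ?powRr1 // pnatr_eq0 -lt0n.
Qed.

Lemma limn_esup_le (R : realType) (f : nat -> \bar R) (b : \bar R) n0 :
  (forall n, (n0 <= n)%N -> (f n <= b)%E) -> (limn_esup f <= b)%E.
Proof.
move=> fb; apply: (@le_trans _ _ (ereal_sup [set f n | n in [set n | (n0 <= n)%N]]%classic)).
  by apply: ereal_inf_lbound; exists [set n | (n0 <= n)%N]%classic => //; exists n0.
by apply: ge_ereal_sup => _ [n /= /fb h <-].
Qed.

Theorem theorem6p7 (R : realType) (m : nat) (G : 'I_m -> finGroupType)
    (u : nat -> free_product G -> R) :
  (2 <= m)%N ->
  asymptotic_coefficients u ->
  forall k : nat, (0 < k)%N -> (k <= lcm_orders G)%N ->
  forall x : galg R (free_product G), selfadjoint x -> tempered_at (u k) x.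
Proof.
move=> _ uP k _ kmu x _; rewrite /tempered_at.
have op0 : (0 <= lreg_opnorm x)%E.
  apply: le_trans (sqrte_ge0 _) (ereal_sup_ubound _); exists (fun=> 0) => //=.
  by rewrite /l2norm esum1 ?sqrte0 ?lee01 // => h _; rewrite normc0 expr0n.
case xn : (lreg_opnorm x) op0 => [lam| |]; first 1 last.
- by move=> _; rewrite leey.
- by rewrite leeNy_eq.
rewrite lee_fin => lam0; apply/lee_addgt0Pr => e e0.
pose M := lam + e / 2; have lM : lam < M by rewrite ltrDl divr_gt0.
have M0 : 0 < M := le_lt_trans lam0 lM.
(* [d] is so small that [M * (1 + d) ^+ 4 <= lam + e]: a fourth power, to absorb
   the cubic factor. *)
pose d := Num.min 1 (e / (30 * M)).
have d0 : 0 < d by rewrite lt_min ltr01 divr_gt0 ?mulr_gt0.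
have dM : M * (1 + d) ^+ 4 <= lam + e.
  have d1 : d <= 1 by rewrite ge_min lexx.
  have d2 : M * d <= e / 30.
    have : d <= e / (30 * M) by rewrite ge_min lexx orbT.
    by rewrite invfM mulrA ler_pdivlMr // mulrC.
  have : (1 + d) ^+ 4 <= 1 + 15 * d.
    have : d ^+ 2 <= d by rewrite expr2 ler_piMr // ltW.
    have : d ^+ 3 <= d by rewrite exprS ler_piMr ?exprn_ile1 // ltW.
    have : d ^+ 4 <= d by rewrite exprS ler_piMr ?exprn_ile1 // ltW.
    have -> : (1 + d) ^+ 4 = 1 + 4 * d + 6 * d ^+ 2 + 4 * d ^+ 3 + d ^+ 4 by ring.
    by clear; lra.
  move=> /(ler_wpM2l (ltW M0)) h; apply: le_trans h _.
  by rewrite mulrDr mulr1 mulrCA; move: d2; rewrite /M; clear; lra.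
have [C [C0 CP]] := coefficient_pow_le uP kmu xn lam0 lM.
have C1 : 0 <= C * (1 + d) ^+ 4 by rewrite mulr_ge0 // exprn_ge0 // addr_ge0 // ltW.
have [n0 n0P] := cubic_le_exp C1 d0.
apply: (@limn_esup_le _ _ _ n0.+1) => p np; rewrite -EFinD lee_fin.
apply: powR_root_le; first exact: leq_trans np.
- exact: normc_ge0.
- by rewrite addr_ge0 // ltW.
apply: le_trans (CP p) _; apply: (@le_trans _ _ ((M * (1 + d) ^+ 4) ^+ p)); last first.
  have h0 : 0 <= M * (1 + d) ^+ 4 by rewrite mulr_ge0 ?(ltW M0) ?exprn_ge0 ?addr_ge0 ?(ltW d0).
  by apply: lerXn2r => //; rewrite ?nnegrE ?(le_trans h0 dM).
rewrite exprMn mulrC; apply: ler_wpM2l; first by rewrite exprn_ge0 // ltW.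
have := n0P p (ltnW np); rewrite mulnS exprD mulrAC [leLHS]mulrC exprM.
by rewrite ler_pM2l // exprn_gt0 // addr_gt0.
Qed.
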